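(* Let $d\geqslant1$, let $0<p_1<p_2<\dots<p_d<\infty$, and let $\Gamma$ be either the rank $d$ Gelfand--Tsetlin graph or the Young jumps graph (with $d$ rows). Let $B_p$ be the product of the Cesàro measures with frequencies $p_1,\dots,p_d$, regarded as a measure on the path space of $\mathbf{Ces}^d$, which contains the path space of $\Gamma$. Then the path space of $\Gamma$ has positive $B_p$-measure, there is a unique ergodic central probability measure on the path space of $\Gamma$ with frequencies $(p_1,\dots,p_d)$, and this measure is the normalized restriction of $B_p$ to the path space of $\Gamma$.
   Context: Let $\mathcal C=\{(x_1,\dots,x_d)\in\mathbb R^d: 0\leqslant x_1\leqslant\dots\leqslant x_d\}$. In both graphs every level $\Gamma_n$, $n=0,1,2,\dots$, is a copy of $\mathcal C$. A vertex $x\in\Gamma_n$ is joined by an edge to $y\in\Gamma_{n+1}$ iff: - rank $d$ Gelfand--Tsetlin graph: $0\leqslant x_1\leqslant y_1\leqslant x_2\leqslant y_2\leqslant\dots\leqslant x_d\leqslant y_d$; - Young jumps graph: $x_i\leqslant y_i$ for all $i=1,\dots,d$ (with $x,y\in\mathcal C$). The graph $\mathbf{Ces}^d$ has every level equal to $[0,\infty)^d$, with an edge from $x$ at level $n$ to $y$ at level $n+1$ iff $x_i\leqslant y_i$ for all $i$. The path space of a graph is the set of all infinite sequences $(x(0),x(1),\dots)$, with $x(n)$ a vertex of level $n$ and consecutive vertices joined by edges, with the topology and Borel structure induced from the product space. The Cesàro measure with frequency $\lambda>0$ is the law of a random sequence $0\leqslant x_0\leqslant x_1\leqslant\dots$ for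 which $x_0,x_1-x_0,x_2-x_1,\dots$ are i.i.d. exponential with mean $\lambda$. Under the product $B_p$ the $d$ coordinate sequences $(x_i(n))_{n\geqslant0}$, $i=1,\dots,d$, are independent, the $i$th one being distributed according to the Cesàro measure with frequency $p_i$. For a vertex $x\in\Gamma_n$, $\mathcal P(x)$ is the set of finite paths from $\Gamma_0$ to $x$, and $\mu_x$ is the normalized Lebesgue measure on it (for interior $x$ it is a compact set of full dimension $nd$; for other $x$ the Lebesgue measure on its affine hull is used). A Borel probability measure on the path space of $\Gamma$ is central if for every $n\geqslant 1$ the conditional distribution of the initial segment $(x(0),\dots,x(n))$ given the tail $(x(n),x(n+1),\dots)$ is almost surely $\mu_{x(n)}$. It is ergodic (indecomposable) if it is not a nontrivial convex combination of two distinct central probability measures. An ergodic central measure $\mu$ is said to have frequencies $(\lambda_1,\dots,\lambda_d)$ if there is a path $x(n)=(x_1(n),\dots,x_d(n))\in\Gamma_n$, or a sequence of such vertices along a subsequence of levels $n$, such that the measures $\mu_{x(n)}$ converge weakly to $\mu$ (that is, for every fixed $k$ the distributions of the first $k$ vertices of the path converge weakly) and $\lim x_i(n)/n=\lambda_i$ for all $i$. *)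

(* Defs.v *)
From HB Require Import structures.
From mathcomp Require Import all_boot all_order all_algebra.
From mathcomp Require Import all_classical all_reals all_analysis.

Set Implicit Arguments.
Unset Strict Implicit.
Unset Printing Implicit Defensive.

Import Order.TTheory GRing.Theory Num.Theory.
Import numFieldNormedType.Exports.
Import ArrowAsProduct. (* function types carry the product topology *)

Local Open Scope classical_set_scope.
Local Open Scope ring_scope.

Notation borel T := (g_sigma_algebraType (@open T)).

Definition chamber (R : realType) (d : nat) : set ('I_d -> R) :=
  [set x | (forall i, 0 <= x i) /\
           (forall i j : 'I_d, (i <= j)%N -> x i <= x j)].

Inductive branching_graph := GelfandTsetlin | YoungJumps.

(* The edge relations are only used between points of [chamber]. *)
Definition edge (R : realType) (d : nat) (g : branching_graph)
    (x y : 'I_d -> R) : Prop :=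
  match g with
  | GelfandTsetlin => (forall i, x i <= y i) /\
      (forall i j : 'I_d, j = i.+1 :> nat -> y i <= x j)
  | YoungJumps => forall i, x i <= y i
  end.

(* All sequences of vectors.  Measures on the path space of a graph (or of
   Ces^d) are measures on this product space that are carried by the closed
   set of its paths. *)
Definition vector_seq (R : realType) (d : nat) := borel (nat -> 'I_d -> R).
HB.instance Definition _ (R : realType) (d : nat) :=
  Measurable.on (vector_seq R d).

Definition segments (R : realType) (d n : nat) := borel ('I_n.+1 -> 'I_d -> R).
HB.instance Definition _ (R : realType) (d n : nat) :=
  Measurable.on (segments R d n).

Definition path_space (R : realType) (d : nat) (g : branching_graph) :
    set (vector_seq R d) :=
  [set x | (forall n, chamber (x n)) /\ (forall n, edge g (x n) (x n.+1))].

Definition finite_paths (R : realType) (d : nat) (g : branching_graph) (n : nat)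
    (v : 'I_d -> R) : set (segments R d n) :=
  [set y | [/\ forall i, chamber (y i),
               forall i j : 'I_n.+1, j = i.+1 :> nat -> edge g (y i) (y j)
             & y ord_max = v]].

Definition affine_hull (R : realType) (I : finType) (K : set (I -> R)) :
    set (I -> R) :=
  [set z | exists (m : nat) (a : 'I_m -> R) (y : 'I_m -> I -> R),
     [/\ \sum_l a l = 1, forall l, K (y l)
       & forall c, z c = \sum_l a l * y l c]].

Definition coord_proj (R : realType) (I : finType) (S : {set I}) (z : I -> R) :
    I -> R :=
  fun c => if c \in S then z c else 0.

(* The coordinates in [S] form an affine coordinate system on [V]; the space
   R^S is realized as the set of vectors vanishing outside [S]. *)
Definition affine_chart (R : realType) (I : finType) (V : set (I -> R))
    (S : {set I}) : Prop :=
  set_bij V [set z | forall c, c \notin S -> z c = 0] (coord_proj S).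

Fixpoint iterated_lebesgue (R : realType) (I : finType) (s : seq I)
    (z : I -> R) (B : set (I -> R)) : \bar R :=
  if s is c :: s' then
    (\int[lebesgue_measure]_t
       iterated_lebesgue s' (fun c' => if c' == c then t else z c') B)%E
  else (\1_B z)%:E.

(* Lebesgue measure on R^S, computed by integrating over the coordinates in [S]
   successively. *)
Definition lebesgue_coord (R : realType) (I : finType) (S : {set I})
    (B : set (I -> R)) : \bar R :=
  iterated_lebesgue (enum S) (fun=> 0) B.

(* Lebesgue measure on the affine hull of [K] is transported from R^S by an
   affine chart.  Two charts yield proportional measures, so the normalization
   makes the choice of [S] immaterial.  If [K] is of full dimension in the
   coordinates [S] and constant in the others, [S] is the only chart. *)
Definition normalized_lebesgue (R : realType) (I : finType)
    (K A : set (I -> R)) : \bar R :=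
  let S := xget finset.set0 [set S | affine_chart (affine_hull K) S] in
  (lebesgue_coord S (coord_proj S @` (K `&` A)) /
   lebesgue_coord S (coord_proj S @` K))%E.

(* Here [v] is a vertex of level [n]. *)
Definition path_measure (R : realType) (d : nat) (g : branching_graph) (n : nat)
    (v : 'I_d -> R) (A : set (segments R d n)) : \bar R :=
  let flat (y : 'I_n.+1 -> 'I_d -> R) (c : 'I_n.+1 * 'I_d) := y c.1 c.2 in
  normalized_lebesgue (flat @` finite_paths g v) (flat @` A).

Definition initial_segment (R : realType) (d n : nat) (x : vector_seq R d) :
    segments R d n :=
  fun i => x i.

Definition path_tail (R : realType) (d n : nat) (x : vector_seq R d) :
    vector_seq R d :=
  fun m => x (n + m)%N.

Arguments initial_segment {R d} n x.
Arguments path_tail {R d} n x.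

(* The last clause says that [path_measure g (x n)] is a version of the
   conditional law of [initial_segment n x] given [path_tail n x]. *)
Definition central (R : realType) (d : nat) (g : branching_graph)
    (mu : probability (vector_seq R d) R) : Prop :=
  mu (path_space g) = 1%E /\
  forall n : nat, (1 <= n)%N ->
  forall (A : set (segments R d n)) (B : set (vector_seq R d)),
    measurable A -> measurable B ->
    mu [set x | A (initial_segment n x) /\ B (path_tail n x)] =
    (\int[mu]_(x in [set x | B (path_tail n x)]) path_measure g (x n) A)%E.

(* A measure is a function on all sets, so equality of measures means
   equality on measurable sets. *)
Definition same_measure (R : realType) (d : nat)
    (mu nu : probability (vector_seq R d) R) : Prop :=
  forall A : set (vector_seq R d), measurable A -> mu A = nu A.

Definition ergodic (R : realType) (d : nat) (g : branching_graph)
    (mu : probability (vector_seq R d) R) : Prop :=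
  central g mu /\
  ~ exists (nu1 nu2 : probability (vector_seq R d) R) (t : R),
      [/\ central g nu1, central g nu2, ~ same_measure nu1 nu2, 0 < t < 1
        & forall A : set (vector_seq R d), measurable A ->
            mu A = (t%:E * nu1 A + (1 - t)%:E * nu2 A)%E].

(* Weak convergence of the measures mu_{v m}, with [v m] at level [N m], to
   [mu]: for each [k] the laws of the first [k.+1] vertices converge weakly.
   [inord i] is the index [i] as soon as [k <= N m]; the finitely many other
   [m] do not matter when [N] is strictly increasing. *)
Definition path_measures_cvg (R : realType) (d : nat) (g : branching_graph)
    (N : nat -> nat) (v : nat -> 'I_d -> R)
    (mu : probability (vector_seq R d) R) : Prop :=
  forall (k : nat) (f : ('I_k.+1 -> 'I_d -> R) -> R),
    continuous f -> (exists M : R, forall y, `|f y| <= M) ->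
    (\int[@path_measure R d g (N m) (v m)]_y
        (f (fun i : 'I_k.+1 => y (inord i)))%:E)%E @[m --> \oo]
      --> (\int[mu]_x (f (initial_segment k x))%:E)%E.

(* The vertices [v m] at the levels [N m] need not be joined by edges; a single
   path is the case [N = id]. *)
Definition has_frequencies (R : realType) (d : nat) (g : branching_graph)
    (lambda : 'I_d -> R) (mu : probability (vector_seq R d) R) : Prop :=
  exists (N : nat -> nat) (v : nat -> 'I_d -> R),
    [/\ forall m n : nat, (m < n)%N -> (N m < N n)%N,
        forall m, chamber (v m),
        path_measures_cvg g N v mu
      & forall i, v m i / (N m)%:R @[m --> \oo] --> lambda i].

Definition increment (R : realType) (x : nat -> R) (n : nat) : R :=
  if n is m.+1 then x n - x m else x 0%N.

(* Product rule for all finite families of increments: they are independent and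
   exponential with mean [lambda], i.e. with rate [lambda^-1]. *)
Definition is_cesaro (R : realType) (lambda : R)
    (m : set (borel (nat -> R)) -> \bar R) : Prop :=
  forall (k : nat) (A : nat -> set R), (forall n, measurable (A n)) ->
    m [set x | forall n, (n < k)%N -> A n (increment x n)] =
    (\prod_(n < k) exponential_prob lambda^-1 (A n))%E.

(* [cesaro_product p B] determines [B] on Borel sets; it is carried by the
   paths of Ces^d because exponential variables are nonnegative. *)
Definition cesaro_product (R : realType) (d : nat) (p : 'I_d -> R)
    (B : probability (vector_seq R d) R) : Prop :=
  let coord (i : 'I_d) (x : vector_seq R d) : borel (nat -> R) :=
    fun n => x n i in
  (forall i, is_cesaro (p i) (pushforward B (coord i))) /\
  (forall A : 'I_d -> set (borel (nat -> R)), (forall i, measurable (A i)) ->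
    B [set x | forall i, A i (coord i x)] =
    (\prod_i pushforward B (coord i) (A i))%E).

(* Main.v *)
Require Import Defs.
From HB Require Import structures.
From mathcomp Require Import all_boot all_order all_algebra.
From mathcomp Require Import all_classical all_reals all_analysis measurable_realfun.
From mathcomp Require Import ring lra.

Set Implicit Arguments.
Unset Strict Implicit.
Unset Printing Implicit Defensive.

Import Order.TTheory GRing.Theory Num.Theory.
Import numFieldNormedType.Exports.
Import ArrowAsProduct.

Local Open Scope classical_set_scope.
Local Open Scope ring_scope.

(** Let [B] be the product of the Cesaro measures with frequencies [p].  Its
    first [n + 1] vertices have a joint density, a product of exponential
    densities of increments.  On nondecreasing paths the exponents telescope, so
    that the density depends on the vertex at level [n] only.  Hence, given the
    tail from level [n] on, the initial segment is uniformly distributed on the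
    nondecreasing paths that end at that vertex.  Scaling the rows carries the
    polytopes of nondecreasing paths to different ends into each other;
    therefore this uniform law is also the law of a bridge, that is, of an
    independent Cesaro path whose rows are rescaled so that it ends where it
    should ([gibbs]).  Imposing the inequalities of the graph, one sees that the
    normalized Lebesgue measure on the finite paths to an interior vertex [v] is
    the law of the bridge to [v], conditioned to obey these inequalities up to
    the level of [v] ([path_measure_bridge]), and that the normalized restriction
    [mu] of [B] to the path space is central ([restricted_central]).

    The path space has positive measure ([path_space_gt0]) because the law of
    large numbers separates the rows linearly: with positive probability the rows
    violate the inequalities by at most a constant, and independently of this the
    rows may start further apart than this constant.

    The main step is the convergence of conditioned bridges to [mu]
    ([conditional_bridge_mean_cvg]).  If the vertices [v m] at levels [N m]
    satisfy [v m / N m --> p], then by the law of large numbers the bridge to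
    [v m] is obtained from a typical Cesaro path by scaling its rows by factors
    that tend to [1].  So it converges to this path in every coordinate.
    Moreover, for large [m] it obeys the inequalities up to level [N m] if and
    only if the path obeys all inequalities: all but finitely many of them hold
    with a margin proportional to the level, and none of them is an equality
    ([bridge_path_upto]).  Dominated convergence does the rest, and it follows
    that the normalized Lebesgue measures on the paths to [v m] converge weakly
    to [mu] ([restricted_path_measures_cvg]).

    Thus [mu] has the frequencies [p], and any measure with these frequencies is
    a weak limit of the same kind, hence equal to [mu].  For the ergodicity, let
    [nu] be a component of [mu] in a convex combination of central measures.  It
    is absolutely continuous with respect to [mu], so the law of large numbers
    holds [nu]-almost surely.  By centrality the [nu]-measure of an event about
    the first vertices is the mean of its probability under the normalized
    Lebesgue measure on the paths to the vertex of level [n], and this tends to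
    its [mu]-measure ([central_dominated_eq]).

    The measure [B] itself is constructed from independent uniform variables on
    the unit interval, which are read off from the binary digits of a single one
    ([digits_independent], [uniform_seq_iid]). *)

(** * Measurability of maps into spaces of sequences *)

(** For a countable base, measurability of a map into the Borel space has to be
    checked on the preimages of the base only. *)
Definition topological_base (T : topologicalType) (J : countType)
    (b : J -> set T) : Prop :=
  (forall j, open (b j)) /\
  forall x U, nbhs x U -> exists2 j, b j x & b j `<=` U.

Definition rational_interval (R : realType) (q : rat * rat) : set R :=
  `]ratr q.1, ratr q.2[%classic.

Lemma rational_interval_base (R : realType) :
  topological_base (@rational_interval R).
Proof.
split=> [q|x U]; first exact: interval_open.
rewrite -nbhs_ballE => -[e /= e0 exU].
have [a /[!in_itv]/= /andP[a1 a2]] : exists a : rat, ratr a \in `]x - e, x[.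
  by apply: rat_in_itvoo; rewrite ltrBlDr ltrDl.
have [b /[!in_itv]/= /andP[b1 b2]] : exists a : rat, ratr a \in `]x, x + e[.
  by apply: rat_in_itvoo; rewrite ltrDl.
exists (a, b); rewrite /rational_interval/=; first by rewrite in_itv/= a2.
move=> y /=; rewrite in_itv/= => /andP[ay yb]; apply: exU.
by rewrite -ball_normE/= ltr_norml; apply/andP; split; lra.
Qed.

(** The positions of [s] below its size always carry an item, so that the value
    at [None] is irrelevant. *)
Definition cylinder (K : Type) (T : topologicalType) (J : countType)
    (b : J -> set T) (s : seq (K * J)) : set (K -> T) :=
  [set x | forall n, (n < size s)%N ->
     if onth s n is Some c then b c.2 (x c.1) else True].

Section cylinders.
Context {K : countType} {T : topologicalType} {J : countType}.
Variable b : J -> set T.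
Hypothesis bb : topological_base b.

Lemma cylinder_cons (c : K * J) s :
  cylinder b (c :: s) = [set x | b c.2 (x c.1)] `&` cylinder b s.
Proof.
apply/seteqP; split => x /=.
  by move=> h; split; [exact: (h 0%N)|move=> n ns; exact: (h n.+1)].
by move=> [h1 h2] [|n] // ns; exact: h2.
Qed.

Lemma cylinder_nil : cylinder b [::] = [set: K -> T].
Proof. by apply/seteqP; split => x //= _ []. Qed.

Lemma cylinder_cat s1 s2 :
  cylinder b (s1 ++ s2) = @cylinder K T J b s1 `&` cylinder b s2.
Proof.
elim: s1 => [|c s IH]; first by rewrite cylinder_nil setTI.
by rewrite cat_cons !cylinder_cons IH setIA.
Qed.

Lemma cylinder_open s : open (@cylinder K T J b s).
Proof.
elim: s => [|c s IH]; first by rewrite cylinder_nil; exact: openT.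
rewrite cylinder_cons; apply: openI => //.
have := @proj_continuous K (fun=> T) c.1.
by move/continuousP => /(_ _ (bb.1 c.2)).
Qed.

Lemma cylinder_base : topological_base (@cylinder K T J b).
Proof.
split; first exact: cylinder_open.
move=> x U xU.
(* the sets containing a cylinder around [x] form a filter, which converges
   to [x] in every coordinate, hence in the product topology *)
pose F : set_system (K -> T) :=
  [set A | exists2 s, cylinder b s x & cylinder b s `<=` A].
have FF : Filter F.
  split.
  - by exists [::]; rewrite cylinder_nil.
  - move=> A B [s sx sA] [t tx tB]; exists (s ++ t).
      by rewrite cylinder_cat; split.
    by rewrite cylinder_cat => y [/sA ? /tB].
  - by move=> A B AB [s sx sA]; exists s => //; exact: subset_trans AB.
have : F --> x; last by move/(_ U xU).
apply/cvg_sup => k; rewrite nbhsE => A /= [V [[W oW WV] Vx] VA].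
have [j bj jW] : exists2 j, b j (x k) & b j `<=` W.
  by apply: bb.2; apply: open_nbhs_nbhs; split => //; move: Vx; rewrite -WV.
exists [:: (k, j)]; rewrite cylinder_cons cylinder_nil setIT //.
by move=> y /= yj; apply: VA; rewrite -WV; exact: jW.
Qed.

End cylinders.

Lemma measurable_preimage_open d (S : measurableType d) (T : topologicalType)
    (J : countType) (b : J -> set T) (f : S -> T) :
  topological_base b -> (forall j, measurable (f @^-1` b j)) ->
  forall U, open U -> measurable (f @^-1` U).
Proof.
move=> [ob bb] mf U oU.
have -> : f @^-1` U = \bigcup_(j in [set j | b j `<=` U]) f @^-1` (b j).
  apply/seteqP; split => [x Ux|x [j /= jU jx]]; last exact: jU.
  by have [j jx jU] := bb (f x) U (open_nbhs_nbhs (conj oU Ux)); exists j.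
rewrite bigcup_mkcond; apply: countable_bigcupT_measurable => // j.
by case: ifPn => // _; exact: mf.
Qed.

Lemma measurable_preimage_cylinder d (S : measurableType d) (K : countType)
    (T : topologicalType) (J : countType) (b : J -> set T) (f : S -> K -> T) :
  (forall k j, measurable ((fun t => f t k) @^-1` b j)) ->
  forall s, measurable (f @^-1` cylinder b s).
Proof.
move=> mf; elim=> [|c s IH]; first by rewrite cylinder_nil preimage_setT.
by rewrite cylinder_cons preimage_setI; apply: measurableI => //; exact: mf.
Qed.

Section measurable_sequences.
Context {R : realType}.

Let b1 := @rational_interval_base R.
Let mb1 d (S : measurableType d) (f : S -> R) (j : rat * rat) :
  measurable_fun setT f -> measurable (f @^-1` (@rational_interval R j)).
Proof.
by move=> mf; rewrite -[X in measurable X]setTI; apply: mf => //;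
  exact: measurable_itv.
Qed.

Lemma measurable_to_scalar_seq d (S : measurableType d)
    (f : S -> borel (nat -> R)) :
  (forall k, measurable_fun setT (fun t => f t k)) -> measurable_fun setT f.
Proof.
move=> mf; apply: (@measurability _ _ S (borel (nat -> R)) setT f open erefl).
move=> _ [U oU <-]; rewrite setTI.
apply: (@measurable_preimage_open _ S (nat -> R) _ _ f (cylinder_base (K := nat) b1)) => //.
by apply: measurable_preimage_cylinder => k j; exact: mb1.
Qed.

Lemma measurable_to_array d (S : measurableType d) (K : countType) (e : nat)
    (f : S -> K -> 'I_e -> R) :
  (forall k i, measurable_fun setT (fun t => f t k i)) ->
  forall U : set (K -> 'I_e -> R), open U -> measurable (f @^-1` U).
Proof.
move=> mf; apply: (@measurable_preimage_open _ S _ _ _ f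
  (cylinder_base (K := K) (cylinder_base (K := 'I_e) b1))) => //.
apply: measurable_preimage_cylinder => k j.
apply: measurable_preimage_cylinder => i q; exact: mb1.
Qed.

Lemma measurable_to_vector_seq d (S : measurableType d) (e : nat)
    (f : S -> vector_seq R e) :
  (forall k i, measurable_fun setT (fun t => f t k i)) -> measurable_fun setT f.
Proof.
move=> mf; apply: (@measurability _ _ S (borel (nat -> 'I_e -> R)) setT f open erefl).
by move=> _ [U oU <-]; rewrite setTI; exact: measurable_to_array.
Qed.

Lemma measurable_to_segments d (S : measurableType d) (e n : nat)
    (f : S -> segments R e n) :
  (forall k i, measurable_fun setT (fun t => f t k i)) -> measurable_fun setT f.
Proof.
move=> mf; apply: (@measurability _ _ S (borel ('I_n.+1 -> 'I_e -> R)) setT f open erefl).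
by move=> _ [U oU <-]; rewrite setTI; exact: measurable_to_array.
Qed.

Lemma open_measurable_real (d : measure_display) (S : measurableType d) (f : S -> R) :
  (forall U : set R, open U -> measurable (f @^-1` U)) -> measurable_fun setT f.
Proof.
move=> h; apply: (measurability _ (RGenOpens.measurableE R)).
by move=> _ [_ [a [b ->]] <-]; rewrite setTI; apply: h; exact: interval_open.
Qed.

Lemma array_coord_continuous (K : countType) (e : nat) (k : K) (i : 'I_e) :
  continuous (fun x : K -> 'I_e -> R => x k i).
Proof.
move=> x; apply: (@continuous_comp (K -> 'I_e -> R) ('I_e -> R) R
  (fun x : K -> 'I_e -> R => x k) (fun y => y i)).
  exact: (@proj_continuous K (fun=> 'I_e -> R) k).
exact: (@proj_continuous 'I_e (fun=> R) i).
Qed.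

Lemma measurable_coord (e : nat) (k : nat) (i : 'I_e) :
  measurable_fun setT (fun x : vector_seq R e => x k i).
Proof.
apply: open_measurable_real => U oU; apply: sub_sigma_algebra.
by have /continuousP := @array_coord_continuous nat e k i; exact.
Qed.

Lemma measurable_segments_continuous (e n : nat) (f : ('I_n.+1 -> 'I_e -> R) -> R) :
  continuous f -> measurable_fun setT (f : segments R e n -> R).
Proof.
move=> cf; apply: open_measurable_real => U oU; apply: sub_sigma_algebra.
by move/continuousP : cf; exact.
Qed.

Lemma measurable_segments_coord (e n : nat) (k : 'I_n.+1) (i : 'I_e) :
  measurable_fun setT (fun x : segments R e n => x k i).
Proof.
apply: (@measurable_segments_continuous _ _ (fun x => x k i)).
exact: array_coord_continuous.
Qed.

Lemma measurable_scalar_coord (k : nat) :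
  measurable_fun setT (fun x : borel (nat -> R) => x k).
Proof.
apply: open_measurable_real => U oU; apply: sub_sigma_algebra.
by have /continuousP := @proj_continuous nat (fun=> R) k; exact.
Qed.

Lemma measurable_initial_segment (e n : nat) :
  measurable_fun setT (@initial_segment R e n).
Proof. by apply: measurable_to_segments => k i; exact: measurable_coord. Qed.

Lemma measurable_path_tail (e n : nat) :
  measurable_fun setT (@path_tail R e n).
Proof. by apply: measurable_to_vector_seq => k i; exact: measurable_coord. Qed.

End measurable_sequences.

(** * Changes of measure in integrals *)

Section integral_lemmas.
Local Open Scope ereal_scope.
Import HBNNSimple.

(** Integrals of arbitrary set functions only involve preimages of points under
    simple functions; this allows to replace a set function that is a measure on
    measurable sets only by a genuine measure. *)
Lemma eq_raw_measure_integral d (T : measurableType d) (R : realType)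
    (m1 m2 : set T -> \bar R) (f : T -> \bar R) :
  (forall A, measurable A -> m1 A = m2 A) ->
  \int[m1]_x f x = \int[m2]_x f x.
Proof.
move=> m12; have E (h : {nnsfun T >-> R}) : sintegral m1 h = sintegral m2 h.
  by rewrite /sintegral; apply: eq_fsbigr => r _; rewrite m12.
rewrite /integral; congr (ereal_sup _ - ereal_sup _).
  by apply/seteqP; split => _ [h hf <-]; exists h.
by apply/seteqP; split => _ [h hf <-]; exists h.
Qed.

(** Change of variables for a set function that agrees with the image of [m] on
    measurable sets. *)
Lemma ge0_integral_law d (T : measurableType d) (R : realType)
    d' (T' : measurableType d') (phi : T -> T')
    (m : {measure set T -> \bar R}) (m' : set T' -> \bar R) (f : T' -> \bar R) :
  measurable_fun setT phi ->
  (forall A, measurable A -> m' A = m (phi @^-1` A)) ->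
  measurable_fun setT f -> (forall x, 0 <= f x) ->
  \int[m']_x f x = \int[m]_x f (phi x).
Proof.
move=> mphi mm' mf f0.
rewrite -[RHS](@ge0_integral_pushforward _ _ _ _ R phi mphi m setT f)//.
exact: eq_raw_measure_integral.
Qed.

Lemma ge0_integral_density d (T : measurableType d) (R : realType)
    (m1 m2 : {measure set T -> \bar R}) (g : T -> R) (f : T -> \bar R) :
  measurable_fun setT g -> (forall x, (0 <= g x)%R) ->
  (forall A, measurable A -> m2 A = \int[m1]_(x in A) (g x)%:E) ->
  measurable_fun setT f -> (forall x, 0 <= f x) ->
  \int[m2]_x f x = \int[m1]_x (f x * (g x)%:E).
Proof.
move=> mg g0 m12 mf f0; pose f_ := nnsfun_approx measurableT mf.
have mEg : measurable_fun setT (EFin \o g) by exact/measurable_EFinP.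
rewrite (@nd_ge0_integral_lim _ _ _ m2 f f_ f0); last 2 first.
- by move=> x a b ab; exact/lefP/nd_nnsfun_approx.
- by move=> x; exact: cvg_nnsfun_approx.
transitivity (lim (\int[m1]_x ((f_ n x)%:E * (g x)%:E) @[n --> \oo])).
  apply: congr_lim; apply/funext => n /=.
  under eq_integral.
    move=> x _; rewrite fimfunE -fsumEFin// ge0_mule_fsuml; last first.
      by move=> r; rewrite EFinM nnfun_muleindic_ge0.
    over.
  rewrite /= ge0_integral_fsum//; last 2 first.
  - move=> r; apply: emeasurable_funM => //.
    by apply/measurable_EFinP; exact/measurableT_comp.
  - by move=> r x _; rewrite mule_ge0 ?lee_fin// -lee_fin EFinM nnfun_muleindic_ge0.
  rewrite sintegralE; apply: eq_fsbigr => r _; rewrite m12//.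
  have [r0|r0] := ltP r 0%R.
    rewrite preimage_nnfun0// integral_set0 mule0 integral0_eq// => x _.
    by rewrite indic0 mulr0 mul0e.
  rewrite integral_mkcond -ge0_integralZl//; last 2 first.
  - by apply/(measurable_restrictT _ _).1 => //; exact: measurable_funTS.
  - by move=> x _; rewrite erestrict_ge0// => y _; rewrite lee_fin.
  apply: eq_integral => x _; rewrite EFinM patchE indicE muleAC -muleA.
  by case: ifPn => _; rewrite ?mule1 ?mule0.
rewrite -monotone_convergence//=.
- apply: eq_integral => x _; apply/cvg_lim => //.
  by apply: cvgeZr => //; exact: cvg_nnsfun_approx.
- move=> n; apply: emeasurable_funM => //.
  exact/measurable_EFinP/measurable_funTS.
- by move=> n x _; rewrite mule_ge0// lee_fin.
- move=> x _ a b ab; rewrite lee_wpmul2r ?lee_fin//.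
  exact/lefP/nd_nnsfun_approx.
Qed.

(** The integral of a nonnegative function is a supremum over the simple
    functions below it, so it ignores null sets even if the function is not
    measurable. *)
Lemma ge0_integral_ae_eq d (T : measurableType d) (R : realType)
    (m : {measure set T -> \bar R}) (N : set T) (f g : T -> \bar R) :
  measurable N -> m N = 0 -> (forall x, 0 <= f x) -> (forall x, 0 <= g x) ->
  (forall x, ~ N x -> f x = g x) -> \int[m]_x f x = \int[m]_x g x.
Proof.
move=> mN mN0; have mNc := measurableC mN.
suff h (f1 g1 : T -> \bar R) : (forall x, 0 <= f1 x) -> (forall x, 0 <= g1 x) ->
    (forall x, ~ N x -> f1 x = g1 x) -> \int[m]_x f1 x <= \int[m]_x g1 x.
  move=> f0 g0 fg; apply/eqP; rewrite eq_le !h//.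
  by move=> x Nx; rewrite fg.
move=> f0 g0 fg; rewrite !ge0_integralTE//.
apply: ge_ereal_sup => _ [h hf <-]; apply: ereal_sup_ubound.
exists (proj_nnsfun h mNc).
  move=> x /=; rewrite mindicE; have [Nx|Nx] := pselect (N x).
    by rewrite memNset ?mulr0//=; apply.
  by rewrite mem_set// mulr1 -fg.
rewrite -!integralT_nnsfun; apply: ae_eq_integral => //.
- exact/measurable_EFinP.
- exact/measurable_EFinP.
exists N; split => // x /= /not_implyP[_ hx]; apply: contrapT => Nx; apply: hx.
by rewrite /= mindicE mem_set// mulr1.
Qed.

End integral_lemmas.

(** * Independent increments *)

Section rectangles.
Context {R : realType} {e : nat}.
Implicit Types (x : vector_seq R e) (A : nat -> 'I_e -> set R).

Definition incr x k i : R := increment (fun n => x n i) k.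

Lemma measurable_incr k i : measurable_fun setT (fun x => incr x k i).
Proof.
case: k => [|k]; first exact: measurable_coord.
by apply: measurable_funB; exact: measurable_coord.
Qed.

Lemma sum_incr x k i : \sum_(j < k.+1) incr x j i = x k i.
Proof.
elim: k => [|k IH]; first by rewrite big_ord1.
by rewrite big_ord_recr/= IH /incr/= addrC subrK.
Qed.

Definition rect (Z : nat -> 'I_e -> vector_seq R e -> R) K A :=
  [set x | forall k, (k < K)%N -> forall i, A k i (Z k i x)].

Lemma measurable_rect Z K A :
  (forall k i, measurable_fun setT (Z k i)) ->
  (forall k i, measurable (A k i)) -> measurable (rect Z K A).
Proof.
move=> mZ mA.
have -> : rect Z K A = \bigcap_(k in `I_K) \bigcap_(i in [set: 'I_e])
    (Z k i @^-1` A k i).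
  by apply/seteqP; split => x /= h k kK i => [_|]; exact: h.
apply: bigcap_measurableType => k _.
apply: fin_bigcap_measurable => [|i _]; first exact: finite_finset.
by rewrite -[X in measurable X]setTI; exact: mZ.
Qed.

(** [Z] stands for any system of coordinates, positions or increments, that
    generates the Borel sets.  Rectangles with sides in a pi-system [AA] that
    generates the Borel sets of the line form a generating pi-system. *)
Lemma measure_unique_rect (Z : nat -> 'I_e -> vector_seq R e -> R)
    (AA : set (set R)) (m1 m2 : {measure set (vector_seq R e) -> \bar R}) :
  (forall k i, measurable_fun setT (Z k i)) ->
  (forall d (S : measurableType d) (f : S -> vector_seq R e),
    (forall k i, measurable_fun setT (fun t => Z k i (f t))) ->
    measurable_fun setT f) ->
  AA setT -> setI_closed AA -> @measurable _ (measurableTypeR R) = <<s AA >> ->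
  (m1 setT < +oo)%E ->
  (forall K A, (forall k i, AA (A k i)) -> m1 (rect Z K A) = m2 (rect Z K A)) ->
  forall U, measurable U -> m1 U = m2 U.
Proof.
move=> mZ genZ AT AI sA m1oo m12 U mU.
pose G := [set V | exists K A, (forall k i, AA (A k i)) /\ V = rect Z K A].
have mAA B : AA B -> @measurable _ (measurableTypeR R) B.
  by move=> AB; rewrite sA; exact: sub_sigma_algebra.
have rT : rect Z 0%N (fun _ _ => setT) = setT by apply/seteqP; split.
have GT : G setT by exists 0%N, (fun _ _ => setT).
have GI : setI_closed G.
  move=> _ _ [K1 [A1 [hA1 ->]]] [K2 [A2 [hA2 ->]]].
  exists (maxn K1 K2), (fun k i => (if (k < K1)%N then A1 k i else setT) `&`
     (if (k < K2)%N then A2 k i else setT)); split.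
    by move=> k i; apply: AI; case: ifP.
  apply/seteqP; split => x /=.
    by move=> [h1 h2] k _ i; split; case: ifP => // kK; [exact: h1|exact: h2].
  move=> h; split => k kK i.
    by have [] := h k (leq_trans kK (leq_maxl _ _)) i; rewrite kK.
  by have [] := h k (leq_trans kK (leq_maxr _ _)) i; rewrite kK.
have mG V : G V -> measurable V.
  by move=> [K [A [hA ->]]]; apply: measurable_rect => // k i; exact: mAA.
have sG : @measurable _ (vector_seq R e) = <<s G >>.
  apply/seteqP; split => [V mV|]; last first.
    by apply: smallest_sub => //; exact: sigma_algebra_measurable.
  have mid : measurable_fun setT (id : g_sigma_algebraType G -> vector_seq R e).
    apply: genZ => k i; apply: (measurability AA) => //.
    move=> _ [B AB <-]; rewrite setTI; apply: sub_sigma_algebra.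
    exists k.+1, (fun k' i' => if (k' == k) && (i' == i) then B else setT).
    split; first by move=> k' i'; case: ifP.
    apply/seteqP; split => x /= h.
      by move=> k' _ i'; case: ifP => // /andP[/eqP-> /eqP->].
    by have := h k (ltnSn k) i; rewrite !eqxx.
  by have := mid measurableT V mV; rewrite setTI.
apply: (measure_unique G (fun _ => setT)) => //.
- by apply/seteqP; split => // x _; exists 0%N.
- by move=> _ [K [A [hA ->]]]; exact: m12.
Qed.

Lemma measure_unique_incr (m1 m2 : {measure set (vector_seq R e) -> \bar R}) :
  (m1 setT < +oo)%E ->
  (forall K A, (forall k i, measurable (A k i)) ->
    m1 (rect (fun k i x => incr x k i) K A) =
    m2 (rect (fun k i x => incr x k i) K A)) ->
  forall U, measurable U -> m1 U = m2 U.
Proof.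
move=> m1oo m12; apply: (@measure_unique_rect (fun k i x => incr x k i)
  (@measurable _ (measurableTypeR R))) => //.
- exact: measurable_incr.
- move=> d S f mf; apply: measurable_to_vector_seq => k i.
  under eq_fun do rewrite -sum_incr.
  by apply: measurable_sum => j; exact: mf.
- exact: measurableI.
- by apply/esym/sigma_algebra_id; exact: sigma_algebra_measurable.
Qed.

Definition exponential_increments (p : 'I_e -> R)
    (B : set (vector_seq R e) -> \bar R) :=
  forall K A, (forall k i, measurable (A k i)) ->
    B (rect (fun k i x => incr x k i) K A) =
    (\prod_(k < K) \prod_i exponential_prob (p i)^-1 (A k i))%E.

Lemma cesaro_product_increments p (B : probability (vector_seq R e) R) :
  cesaro_product p B -> exponential_increments p B.
Proof.
move=> [ces ind] K A mA.
pose coord (i : 'I_e) (x : vector_seq R e) : borel (nat -> R) := fun n => x n i.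
pose AI i : set (borel (nat -> R)) :=
  [set y | forall k, (k < K)%N -> A k i (increment y k)].
have mAI i : measurable (AI i).
  have -> : AI i = \bigcap_(k in `I_K)
      ((fun y : borel (nat -> R) => increment y k) @^-1` A k i).
    by apply/seteqP; split => y /= h k kK; exact: h.
  apply: bigcap_measurableType => k _; rewrite -[X in measurable X]setTI.
  have : measurable_fun setT (fun y : borel (nat -> R) => increment y k).
    case: k => [|k]; first exact: measurable_scalar_coord.
    by apply: measurable_funB; exact: measurable_scalar_coord.
  by apply.
have -> : rect (fun k i x => incr x k i) K A =
    [set x | forall i, AI i (coord i x)].
  by apply/seteqP; split => x /= h; [move=> i k kK|move=> k kK i]; exact: h.
rewrite ind//= [RHS]exchange_big/=; apply: eq_bigr => i _.
exact: (ces i K (fun k => A k i)).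
Qed.

Lemma exponential_prob_setT (r : R) : 0 < r -> exponential_prob r setT = 1%E.
Proof. exact: integral_exponential_pdf. Qed.

(** Replaces the increments of [x] in the positions [D] by those of [w]. *)
Definition mix (D : nat -> 'I_e -> bool) x w : vector_seq R e :=
  fun k i => \sum_(j < k.+1) (if D j i then incr w j i else incr x j i).

Lemma incr_mix D x w k i :
  incr (mix D x w) k i = if D k i then incr w k i else incr x k i.
Proof.
case: k => [|k]; first by rewrite /incr/= /mix big_ord1.
by rewrite {1}/incr/= /mix big_ord_recr/= addrAC subrr add0r.
Qed.

Lemma measurable_mix D :
  measurable_fun setT (fun z : vector_seq R e * vector_seq R e => mix D z.1 z.2).
Proof.
apply: measurable_to_vector_seq => k i; apply: measurable_sum => j.
case: (D j i).
  exact: (measurableT_comp (measurable_incr j i) measurable_snd).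
exact: (measurableT_comp (measurable_incr j i) measurable_fst).
Qed.

End rectangles.

Section push_measure.
Context d d' (T1 : measurableType d) (T2 : measurableType d') (R : realType).
Variables (f : T1 -> T2) (mf : measurable_fun [set: T1] f).
Variable m : {measure set T1 -> \bar R}.

(** The image measure; the proof of measurability is an argument, so that the
    measure structure can be inferred. *)
Definition push_measure of measurable_fun [set: T1] f := pushforward m f.

Let push0 : push_measure mf set0 = 0%E.
Proof. exact: measure0. Qed.

Let push_ge0 A : (0 <= push_measure mf A)%E.
Proof. exact: measure_ge0. Qed.

Let push_sigma_additive : semi_sigma_additive (push_measure mf).
Proof. exact: measure_semi_sigma_additive. Qed.

HB.instance Definition _ := isMeasure.Build _ _ _ (push_measure mf)
  push0 push_ge0 push_sigma_additive.

End push_measure.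

Section mixing.
Context {R : realType} {e : nat} (p : 'I_e -> R).
Variable B : probability (vector_seq R e) R.
Hypothesis p_gt0 : forall i, 0 < p i.
Hypothesis Bp : exponential_increments p B.
Implicit Types (D : nat -> 'I_e -> bool).

(** Independence: a path put together from the increments of two independent
    Cesaro paths is again a Cesaro path. *)
Lemma mix_law D (U : set (vector_seq R e)) : measurable U ->
  B U = (B \x B)%E ((fun z => mix D z.1 z.2) @^-1` U).
Proof.
have mm := @measurable_mix R e D.
have xr K A : (forall k i, measurable (A k i)) ->
    measurable (rect (fun k i (x : vector_seq R e) => incr x k i) K A).
  by move=> mA; apply: measurable_rect => // k i; exact: measurable_incr.
move: U; apply: (@measure_unique_incr R e B (push_measure (B \x B)%E mm)).
  exact: le_lt_trans (probability_le1 B measurableT) (ltry _).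
move=> K A mA; rewrite [LHS](Bp K mA) /push_measure /pushforward.
pose A1 k i := if D k i then setT else A k i.
pose A2 k i := if D k i then A k i else setT.
have mA1 k i : measurable (A1 k i) by rewrite /A1; case: (D k i).
have mA2 k i : measurable (A2 k i) by rewrite /A2; case: (D k i).
transitivity ((B \x B)%E (rect (fun k i x => incr x k i) K A1 `*`
    rect (fun k i x => incr x k i) K A2)); last first.
  congr ((B \x B)%E _); apply/seteqP; split=> [[x w]/= [h1 h2] k kK i|[x w]/= h].
    by have := h1 k kK i; have := h2 k kK i; rewrite /= incr_mix /A1 /A2;
      case: (D k i).
  split => k kK i /=; have := h k kK i; rewrite /= incr_mix /A1 /A2;
    by case: (D k i).
rewrite product_measure1E; [|exact: xr|exact: xr].
rewrite [X in (_ = X * _)%E](Bp K mA1) [X in (_ = _ * X)%E](Bp K mA2).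
rewrite -big_split/=; apply: eq_bigr => k _.
rewrite -big_split/=; apply: eq_bigr => i _.
by rewrite /A1 /A2; case: (D k i);
  rewrite exponential_prob_setT ?invr_gt0// ?mule1 ?mul1e.
Qed.

Lemma integral_mix D (f : vector_seq R e -> \bar R) :
  measurable_fun setT f -> (forall x, 0 <= f x)%E ->
  (\int[B]_x f x = \int[B]_x \int[B]_w f (mix D x w))%E.
Proof.
move=> mf f0; have mm := @measurable_mix R e D.
rewrite (ge0_integral_law mm (mix_law D))//.
by rewrite (fubini_tonelli1 (fun z => f (mix D z.1 z.2)))//; exact: measurableT_comp.
Qed.

Lemma incr_law k i (A : set R) : measurable A ->
  exponential_prob (p i)^-1 A = B ((fun x => incr x k i) @^-1` A).
Proof.
move=> mA; pose A' k' i' := if (k' == k) && (i' == i) then A else setT.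
have mA' k' i' : measurable (A' k' i') by rewrite /A'; case: ifP.
have -> : (fun x => incr x k i) @^-1` A = rect (fun k i (x : vector_seq R e) => incr x k i) k.+1 A'.
  apply/seteqP; split => x /= h.
    by move=> k' _ i'; rewrite /A'; case: ifP => // /andP[/eqP-> /eqP->].
  by have := h k (ltnSn k) i; rewrite /A' !eqxx.
rewrite Bp// (bigD1 ord_max)//= (bigD1 i)//= /A' !eqxx/=.
rewrite big1 ?mule1; last first.
  by move=> i' /negbTE ->; rewrite exponential_prob_setT ?invr_gt0.
rewrite big1 ?mule1// => k' k'k; rewrite big1// => i' _.
case: ifPn => [/andP[/eqP kk _]|_]; last by rewrite exponential_prob_setT ?invr_gt0.
by case/eqP: k'k; apply/val_inj.
Qed.

Lemma integral_incr k i (h : R -> \bar R) :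
  measurable_fun setT h -> (forall t, 0 <= h t)%E ->
  (\int[B]_x h (incr x k i) =
   \int[lebesgue_measure]_t (h t * (exponential_pdf (p i)^-1 t)%:E))%E.
Proof.
move=> mh h0; have r0 : 0 < (p i)^-1 by rewrite invr_gt0.
have mx : measurable_fun setT (fun x : vector_seq R e => incr x k i : measurableTypeR R) :=
  @measurable_incr R e k i.
rewrite -(@ge0_integral_density _ (measurableTypeR R) R lebesgue_measure
  (push_measure B mx) (exponential_pdf (p i)^-1))//.
- apply/esym/(@ge0_integral_law _ _ R _ _ (fun x => incr x k i : measurableTypeR R) B) => //.
- exact: measurable_exponential_pdf.
- by move=> t; apply/exponential_pdf_ge0/ltW.
- by move=> A mA; rewrite /push_measure /pushforward/= -incr_law.
Qed.

End mixing.

(** * Iterated Lebesgue integrals *)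

Section affine_change.
Context {R : realType}.
Local Open Scope ereal_scope.

Lemma lebesgue_measure_affine (c a : R) (A : set R) : (0 < c)%R -> measurable A ->
  lebesgue_measure A = c%:E * lebesgue_measure ((fun t => c * t + a)%R @^-1` A).
Proof.
move=> c0; pose phi (t : measurableTypeR R) : measurableTypeR R := (c * t + a)%R.
have mphi : measurable_fun setT phi.
  by apply: measurable_funD => //; apply: measurable_funM.
pose m := mscale (NngNum (ltW c0)) (@lebesgue_measure R).
suff h X : ocitv X -> lebesgue_measure X = push_measure m mphi X.
  exact: (lebesgue_measure_unique h).
move=> [[x y] _ <-]; rewrite /push_measure /pushforward /m /mscale/=.
have -> : phi @^-1` `]x, y] = `]((x - a) / c)%R, ((y - a) / c)%R]%classic.
  apply/seteqP; split => t /=; rewrite !in_itv/= /phi ltr_pdivrMr// ler_pdivlMr//;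
    by rewrite ltrBlDr lerBrDr mulrC.
rewrite -[RHS]/(c%:E * lebesgue_measure _).
rewrite !lebesgue_measure_itv/= !lte_fin ltr_pM2r ?invr_gt0// ltrD2r.
case: ifPn => // _; last by rewrite mule0.
by rewrite -!EFinD -EFinM; congr EFin; field; rewrite gt_eqF.
Qed.

Lemma ge0_integral_affine (c a : R) (f : R -> \bar R) :
  (0 < c)%R -> measurable_fun setT f -> (forall t, 0 <= f t) ->
  \int[lebesgue_measure]_t f t =
  c%:E * \int[lebesgue_measure]_t f (c * t + a)%R.
Proof.
move=> c0 mf f0; pose phi (t : measurableTypeR R) : measurableTypeR R := (c * t + a)%R.
have mphi : measurable_fun setT phi.
  by apply: measurable_funD => //; apply: measurable_funM.
pose m := mscale (NngNum (ltW c0)) (@lebesgue_measure R).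
have mE A : measurable A -> lebesgue_measure A = m (phi @^-1` A).
  by move=> mA; rewrite (lebesgue_measure_affine a c0 mA).
rewrite (ge0_integral_law mphi mE)// ge0_integral_mscale//.
exact: measurableT_comp.
Qed.

End affine_change.

Section iterated_integral.
Context {R : realType} {e : nat}.
Local Notation cell := (nat * 'I_e)%type.
Local Notation VS := (vector_seq R e).
Local Open Scope ereal_scope.
Implicit Types (s : seq cell) (c : cell) (z : VS) (f : VS -> \bar R).

Definition upd z c (t : R) : VS := fun k i => if (k, i) == c then t else z k i.

Lemma upd_same z c t : upd z c t c.1 c.2 = t.
Proof. by rewrite /upd -surjective_pairing eqxx. Qed.

Lemma updC z c c' t t' : c != c' ->
  upd (upd z c t) c' t' = upd (upd z c' t') c t.
Proof.
move=> cc'; apply/funext => k; apply/funext => i; rewrite /upd.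
by case: eqP => // ->; rewrite eq_sym (negbTE cc').
Qed.

Lemma measurable_upd c : measurable_fun setT
  (fun zt : VS * measurableTypeR R => upd zt.1 c zt.2).
Proof.
apply: measurable_to_vector_seq => k i; rewrite /upd; case: ((k, i) == c).
  exact: measurable_snd.
exact: (measurableT_comp (measurable_coord k i) measurable_fst).
Qed.

(** Integration of [f] over the coordinates listed in [s] with respect to
    Lebesgue measure, the remaining coordinates being those of [z]. *)
Fixpoint iterint s f z : \bar R :=
  if s is c :: s' then
    \int[lebesgue_measure]_t iterint s' f (upd z c t)
  else f z.

Lemma iterint_ge0 s f z : (forall z', 0 <= f z') -> 0 <= iterint s f z.
Proof.
by move=> f0; elim: s z => //= c s IH z; apply: integral_ge0 => t _; exact: IH.
Qed.

Lemma measurable_iterint s f : measurable_fun setT f ->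
  (forall z', 0 <= f z') -> measurable_fun setT (iterint s f).
Proof.
move=> mf f0; elim: s => //= c s IH.
apply: (measurable_fun_fubini_tonelli_F (m2 := lebesgue_measure)
  (fun zt : VS * measurableTypeR R => iterint s f (upd zt.1 c zt.2))).
  exact: (measurableT_comp IH (measurable_upd c)).
by move=> zt; exact: iterint_ge0.
Qed.

Lemma measurable_iterint_upd s f z c : measurable_fun setT f ->
  (forall z', 0 <= f z') ->
  measurable_fun setT (fun t : measurableTypeR R => iterint s f (upd z c t)).
Proof.
move=> mf f0; apply: measurableT_comp; first exact: measurable_iterint.
exact: (measurableT_comp (measurable_upd c) (measurable_pair1 z)).
Qed.

Lemma iterint_eq s f g z1 z2 :
  (forall z1' z2' : VS,
    (forall k i, (k, i) \notin s -> z1' k i = z1 k i) ->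
    (forall k i, (k, i) \notin s -> z2' k i = z2 k i) ->
    (forall k i, (k, i) \in s -> z1' k i = z2' k i) -> f z1' = g z2') ->
  iterint s f z1 = iterint s g z2.
Proof.
elim: s z1 z2 => [|c s IH] z1 z2 H /=; first exact: H.
apply: eq_integral => t _; apply: IH => z1' z2' h1 h2 h3; apply: H.
- move=> k i; rewrite inE negb_or => /andP[kc ks].
  by rewrite h1// /upd (negbTE kc).
- move=> k i; rewrite inE negb_or => /andP[kc ks].
  by rewrite h2// /upd (negbTE kc).
- move=> k i; rewrite inE => /orP[kc|]; last exact: h3.
  have [ks|ks] := boolP ((k, i) \in s); first exact: h3.
  by rewrite h1// h2// /upd kc.
Qed.

Lemma iterint_ext s f g z :
  (forall z' : VS, (forall k i, (k, i) \notin s -> z' k i = z k i) -> f z' = g z') ->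
  iterint s f z = iterint s g z.
Proof.
move=> H; apply: iterint_eq => z1 z2 h1 h2 h3.
suff -> : z1 = z2 by exact: H.
apply/funext => k; apply/funext => i.
have [ks|ks] := boolP ((k, i) \in s); first exact: h3.
by rewrite h1// h2.
Qed.

Lemma iterintZ s f z (a : \bar R) : measurable_fun setT f ->
  (forall z', 0 <= f z') -> 0 <= a ->
  iterint s (fun z' => a * f z') z = a * iterint s f z.
Proof.
move=> mf f0 a0; elim: s z => //= c s IH z.
rewrite -ge0_integralZl//; last 2 first.
- exact: measurable_iterint_upd.
- by move=> t _; exact: iterint_ge0.
by apply: eq_integral => t _; exact: IH.
Qed.

Lemma iterint_factor s f h z : measurable_fun setT f ->
  (forall z', 0 <= f z') -> (forall z', 0 <= h z') ->
  (forall z1 z2 : VS, (forall k i, (k, i) \notin s -> z1 k i = z2 k i) -> h z1 = h z2) ->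
  iterint s (fun z' => h z' * f z') z = h z * iterint s f z.
Proof.
move=> mf f0 h0 hs; rewrite -iterintZ//; apply: iterint_ext => z' zz'.
by rewrite (hs _ z).
Qed.

Lemma iterint_cat s1 s2 f z :
  iterint (s1 ++ s2) f z = iterint s1 (iterint s2 f) z.
Proof.
by elim: s1 z => //= c s IH z; apply: eq_integral => t _; exact: IH.
Qed.

Lemma iterint_swap c c' s f z : measurable_fun setT f ->
  (forall z', 0 <= f z') -> iterint (c :: c' :: s) f z = iterint (c' :: c :: s) f z.
Proof.
move=> mf f0; have [->//|cc'] := eqVneq c c'.
rewrite /= (fubini_tonelli (m1 := lebesgue_measure) (m2 := lebesgue_measure)
  (fun tt : measurableTypeR R * measurableTypeR R =>
    iterint s f (upd (upd z c tt.1) c' tt.2)))/=; last 2 first.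
- apply: measurableT_comp; first exact: measurable_iterint.
  apply: measurable_to_vector_seq => k i; rewrite /upd; case: ((k, i) == c').
    exact: measurable_snd.
  by case: ((k, i) == c) => //; exact: measurable_fst.
- by move=> tt; exact: iterint_ge0.
by apply: eq_integral => t _; apply: eq_integral => t' _; rewrite updC.
Qed.

Lemma iterint_perm s1 s2 f z : measurable_fun setT f ->
  (forall z', 0 <= f z') -> perm_eq s1 s2 -> iterint s1 f z = iterint s2 f z.
Proof.
move=> mf f0 s12; move: z.
have move_cons c t1 t2 z : iterint (t1 ++ c :: t2) f z = iterint (c :: t1 ++ t2) f z.
  elim: t1 z => // c1 t1 IH z.
  by rewrite cat_cons -iterint_swap//=; apply: eq_integral => t _; exact: IH.
pose P s := forall z, iterint s1 f z = iterint s f z.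
apply: (@catCA_perm_ind _ P _ s1 s2) => // t1 t2 t3 H z; rewrite H {H}.
elim: t1 z => // c t1 IH z; rewrite !cat_cons move_cons/=.
by apply: eq_integral => t _; exact: IH.
Qed.

Definition scale_seq (a : 'I_e -> R) z : VS := fun k i => (a i * z k i)%R.

Lemma measurable_scale_seq a : measurable_fun setT (scale_seq a).
Proof.
apply: measurable_to_vector_seq => k i; apply: measurable_funM => //.
exact: measurable_coord.
Qed.

Lemma iterint_scale s f a z : (forall i, 0 < a i)%R ->
  measurable_fun setT f -> (forall z', 0 <= f z') ->
  iterint s f (scale_seq a z) =
  (\prod_(c <- s) a c.2)%:E * iterint s (f \o scale_seq a) z.
Proof.
move=> a0 mf f0; elim: s z => [|c s IH] z; first by rewrite big_nil mul1e.
have mfa : measurable_fun setT (f \o scale_seq a).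
  by apply: measurableT_comp => //; exact: measurable_scale_seq.
rewrite big_cons EFinM /= (@ge0_integral_affine _ (a c.2) 0%R)//; last 2 first.
- exact: measurable_iterint_upd.
- by move=> t; exact: iterint_ge0.
rewrite -muleA; congr (_ * _); rewrite -ge0_integralZl//; last 3 first.
- by apply: measurable_iterint_upd => // z1; exact: f0.
- by move=> t _; apply: iterint_ge0 => z'; exact: f0.
- by rewrite lee_fin prodr_ge0// => c' _; exact: ltW.
apply: eq_integral => t _; rewrite addr0 -IH; congr (iterint _ _ _).
apply/funext => k; apply/funext => i; rewrite /scale_seq /upd.
by case: eqP => // <-.
Qed.

End iterated_integral.

(** * The joint density of the first vertices *)

Definition depends_below (R : realType) (e : nat) (T : Type) (N : nat)
    (F : vector_seq R e -> T) :=
  forall z z' : vector_seq R e,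
    (forall k, (k < N)%N -> forall i, z k i = z' k i) -> F z = F z'.

Section cesaro_density.
Context {R : realType} {e : nat} (p : 'I_e -> R).
Local Notation cell := (nat * 'I_e)%type.
Local Notation VS := (vector_seq R e).
Variable B : probability VS R.
Hypothesis p_gt0 : forall i, 0 < p i.
Hypothesis Bp : exponential_increments p B.
Implicit Types (s : seq cell) (c : cell) (x z : VS) (F : VS -> \bar R).

Definition previous x c : R := if c.1 is k.+1 then x k c.2 else 0.

Lemma incr_previous x c : incr x c.1 c.2 = x c.1 c.2 - previous x c.
Proof. by case: c => -[|k] i; rewrite /incr /previous/= ?subr0. Qed.

(** Path with the increment in the cell [c] replaced by [t]. *)
Definition resample c x (t : R) : VS :=
  fun k i => \sum_(j < k.+1) (if (nat_of_ord j, i) == c then t else incr x j i).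

Lemma mix_resample c x w :
  mix (fun k i => (k, i) == c) x w = resample c x (incr w c.1 c.2).
Proof.
apply/funext => k; apply/funext => i; rewrite /mix /resample.
by apply: eq_bigr => j _; case: eqP => // <-.
Qed.

Lemma resample_out c x t k i : (i == c.2) && (c.1 <= k)%N = false ->
  resample c x t k i = x k i.
Proof.
move=> h; rewrite -[RHS]sum_incr; apply: eq_bigr => j _.
case: eqP => // jc; move: h; rewrite -jc/= eqxx/=.
by have := ltn_ord j; rewrite ltnS => ->.
Qed.

Lemma resample_in c x t : resample c x t c.1 c.2 = previous x c + t.
Proof.
rewrite /resample big_ord_recr/= -surjective_pairing eqxx; congr (_ + _).
case: c => -[|k] i; first by rewrite big_ord0.
rewrite /previous/= -[RHS]sum_incr; apply: eq_bigr => j _.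
by case: eqP => // -[jk]; have := ltn_ord j; rewrite jk ltnn.
Qed.

Lemma measurable_resample c :
  measurable_fun setT (fun z : VS * measurableTypeR R => resample c z.1 z.2).
Proof.
apply: measurable_to_vector_seq => k i; apply: measurable_sum => j.
case: (_ == c); first exact: measurable_snd.
exact: (measurableT_comp (measurable_incr j i) measurable_fst).
Qed.

Local Notation pdf i := (exponential_pdf (p i)^-1).

Lemma pdf_ge0 i t : 0 <= pdf i t.
Proof. by apply: exponential_pdf_ge0; rewrite invr_ge0 ltW. Qed.

(** Given all other increments, the increment in the cell [c] has an exponential
    density. *)
Lemma integral_resample c F : measurable_fun setT F -> (forall x, 0 <= F x)%E ->
  (\int[B]_x F x = \int[B]_x \int[lebesgue_measure]_t
     (F (resample c x t) * (pdf c.2 t)%:E))%E.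
Proof.
move=> mF F0; rewrite (integral_mix p_gt0 Bp (fun k i => (k, i) == c))//.
apply: eq_integral => x _; under eq_integral do rewrite mix_resample.
rewrite (integral_incr p_gt0 Bp c.1 c.2 (h := fun t => F (resample c x t)))//.
apply: (measurableT_comp mF).
exact: (measurableT_comp (measurable_resample c) (measurable_pair1 x)).
Qed.

Fixpoint resampled s F x : \bar R :=
  if s is c :: s' then
    (\int[lebesgue_measure]_t (resampled s' F (resample c x t) * (pdf c.2 t)%:E))%E
  else F x.

Lemma resampled_ge0 s F x : (forall x, 0 <= F x)%E -> (0 <= resampled s F x)%E.
Proof.
move=> F0; elim: s x => //= c s IH x; apply: integral_ge0 => t _.
by rewrite mule_ge0// lee_fin pdf_ge0.
Qed.

Lemma measurable_resampled s F : measurable_fun setT F ->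
  (forall x, 0 <= F x)%E -> measurable_fun setT (resampled s F).
Proof.
move=> mF F0; elim: s => //= c s IH.
apply: (measurable_fun_fubini_tonelli_F (m2 := lebesgue_measure)
  (fun zt : VS * measurableTypeR R =>
     resampled s F (resample c zt.1 zt.2) * (pdf c.2 zt.2)%:E)%E).
  apply: emeasurable_funM; first exact: (measurableT_comp IH (measurable_resample c)).
  apply/measurable_EFinP; apply: measurableT_comp; last exact: measurable_snd.
  exact: measurable_exponential_pdf.
by move=> zt; rewrite mule_ge0// ?resampled_ge0// lee_fin pdf_ge0.
Qed.

Lemma integral_resampled s F : measurable_fun setT F -> (forall x, 0 <= F x)%E ->
  (\int[B]_x F x = \int[B]_x resampled s F x)%E.
Proof.
move=> mF F0; elim: s => //= c s ->; rewrite (integral_resample c)//.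
  exact: measurable_resampled.
by move=> x; exact: resampled_ge0.
Qed.

Definition increment_density s z : R := \prod_(c <- s) pdf c.2 (incr z c.1 c.2).

Lemma increment_density_ge0 s z : 0 <= increment_density s z.
Proof. by apply: prodr_ge0 => c _; exact: pdf_ge0. Qed.

Lemma measurable_increment_density s : measurable_fun setT (increment_density s).
Proof.
apply: measurable_prod => c _; apply: measurableT_comp.
  exact: measurable_exponential_pdf.
exact: measurable_incr.
Qed.

Lemma increment_density_below N s : (forall c, c \in s -> (c.1 < N)%N) ->
  depends_below N (increment_density s).
Proof.
move=> sN z z' zz'; rewrite /increment_density !big_seq.
apply: eq_bigr => -[k i] /sN /= kN; congr (pdf i _).
case: k kN => [|k] kN; rewrite /incr/= ?zz'//.
exact: ltnW.
Qed.

Lemma measurable_mul_density s F : measurable_fun setT F ->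
  measurable_fun setT (fun z => F z * (increment_density s z)%:E)%E.
Proof.
move=> mF; apply: emeasurable_funM => //; apply/measurable_EFinP.
exact: measurable_increment_density.
Qed.

(** Passing from increments to positions is a triangular change of variables
    with unit diagonal: it translates one variable after the other. *)
Lemma resampled_iterint N s F x :
  measurable_fun setT F -> (forall x, 0 <= F x)%E -> depends_below N F ->
  uniq s -> pairwise (fun c c' : cell => (c.1 <= c'.1)%N) s ->
  (forall c, c \in s -> (c.1 < N)%N) ->
  (forall c k, c \in s -> (c.1 < k < N)%N -> (k, c.2) \in s) ->
  resampled s F x = iterint s (fun z => F z * (increment_density s z)%:E)%E x.
Proof.
move=> mF F0 FN; elim: s x => [|c s IH] x.
  by move=> _ _ _ _; rewrite /= /increment_density big_nil mule1.
move=> /= /andP[cs us] /andP[/allP cle ps] sN scl.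
have sN' c' : c' \in s -> (c'.1 < N)%N by move=> h; apply: sN; rewrite inE h orbT.
have scl' c' k : c' \in s -> (c'.1 < k < N)%N -> (k, c'.2) \in s.
  move=> c's kN; have := scl c' k; rewrite !inE c's orbT => /(_ isT kN).
  case/orP => // /eqP kc; have := cle _ c's; rewrite -kc/=.
  by move: kN => /andP[+ _]; rewrite ltnNge => /negbTE->.
pose G z := (F z * (increment_density s z)%:E)%E.
have G0 z : (0 <= G z)%E by rewrite mule_ge0// lee_fin increment_density_ge0.
have mG : measurable_fun setT G by exact: measurable_mul_density.
have GN : depends_below N G.
  by move=> z z' zz'; rewrite /G (FN _ _ zz') (increment_density_below sN' zz').
have prevs : (forall k, c.1 = k.+1 -> (k, c.2) \notin s).
  by move=> k ck; apply/negP => /cle; rewrite ck/= ltnn.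
transitivity (\int[lebesgue_measure]_t
    (iterint s G (upd x c (1 * t + previous x c)%R) *
     (pdf c.2 (1 * t + previous x c - previous x c)%R)%:E))%E.
  apply: eq_integral => t _; rewrite mul1r addrK IH//; congr (_ * _)%E.
  apply: iterint_eq => z1 z2 h1 h2 h3; apply: GN => k kN i.
  have [ks|ks] := boolP ((k, i) \in s); first exact: h3.
  rewrite h1// h2// /upd; case: eqP => [<-|/eqP kc].
    by rewrite -[in LHS]/(k, i).1 (resample_in (k, i)) addrC.
  rewrite resample_out//; apply/negbTE/negP => /andP[/eqP ic].
  rewrite leq_eqVlt => /orP[/eqP ck|ck].
    by move/eqP: kc; apply; rewrite ic -ck -surjective_pairing.
  have := scl c k; rewrite !inE eqxx ck kN => /(_ isT isT).
  by rewrite -ic (negbTE kc) (negbTE ks).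
rewrite -(mul1e (integral _ _ _)) -(@ge0_integral_affine R 1 (previous x c)
  (fun u => iterint s G (upd x c u) * (pdf c.2 (u - previous x c)%R)%:E)%E)//; last 2 first.
- apply: emeasurable_funM; first exact: measurable_iterint_upd.
  apply/measurable_EFinP; apply: measurableT_comp; first exact: measurable_exponential_pdf.
  exact: measurable_funB.
- by move=> t; rewrite mule_ge0// ?iterint_ge0// lee_fin pdf_ge0.
apply: eq_integral => u _.
have prev_upd z : (forall k i, (k, i) \notin s -> z k i = upd x c u k i) ->
    incr z c.1 c.2 = u - previous x c.
  move=> zx; rewrite incr_previous zx -?surjective_pairing// upd_same; congr (_ - _).
  rewrite /previous; case ck : c.1 => [//|k].
  rewrite zx ?prevs// /upd; case: eqP => // kc.
  by move: ck; rewrite -kc/= => /eqP; rewrite eqn_leq ltnn andbF.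
transitivity (iterint s (fun z => (pdf c.2 (u - previous x c)%R)%:E * G z)%E (upd x c u)).
  by rewrite iterintZ// ?lee_fin ?pdf_ge0// muleC.
apply: iterint_ext => z zx; rewrite /G /increment_density big_cons prev_upd//.
by rewrite EFinM muleCA.
Qed.

(** All increments below level [N] are resampled in the order of the levels and
    then changed into positions. *)
Lemma cesaro_density N s F z0 :
  uniq s -> (forall c, (c \in s) = (c.1 < N)%N) ->
  measurable_fun setT F -> (forall x, 0 <= F x)%E -> depends_below N F ->
  (\int[B]_x F x = iterint s (fun z => F z * (increment_density s z)%:E) z0)%E.
Proof.
move=> us smem mF F0 FN.
pose le_lev := (fun c c' : cell => (c.1 <= c'.1)%N).
pose s' := sort le_lev s.
have ss' : perm_eq s s' by rewrite perm_sym perm_sort.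
rewrite (integral_resampled s')//.
have memE c : (c \in s') = (c.1 < N)%N by rewrite mem_sort.
have H x : resampled s' F x =
    iterint s (fun z => F z * (increment_density s z)%:E)%E z0.
  rewrite (@resampled_iterint N)//.
  - rewrite (iterint_perm _ _ _ ss'); last 2 first.
    + exact: measurable_mul_density.
    + by move=> z; rewrite mule_ge0// lee_fin increment_density_ge0.
    apply: iterint_eq => z1 z2 _ _ h3.
    have zz k : (k < N)%N -> forall i, z1 k i = z2 k i by move=> kN i; rewrite h3 ?memE.
    rewrite (FN _ _ zz) /increment_density (perm_big _ ss')/=; congr (_ * _%:E)%E.
    by apply: (increment_density_below (N := N) (s := s')) => // c; rewrite memE.
  - by rewrite sort_uniq.
  - have tr : transitive le_lev by move=> c1 c2 c3; exact: leq_trans.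
    have -> : pairwise (fun c c' : cell => (c.1 <= c'.1)%N) s' = sorted le_lev s'.
      by rewrite sorted_pairwise.
    by apply: sort_sorted => c c'; exact: leq_total.
  - by move=> c; rewrite memE.
  - by move=> c k _ /andP[_ kN]; rewrite memE.
under eq_integral do rewrite H.
by rewrite integral_cst// [X in (_ * X)%E](@probability_setT _ _ _ B) mule1.
Qed.

End cesaro_density.

(** * Integration over nondecreasing paths with a given end *)

Lemma measurable_invr (R : realType) : measurable_fun setT (@GRing.inv R).
Proof.
(* both sides vanish at [0]; the power has a nonnegative base *)
have -> : @GRing.inv R = (fun x : R => x * ((x ^+ 2) `^ (-1))).
  apply/funext => x; rewrite powR_inv1 ?sqr_ge0// expr2 invfM mulrA.
  by have [->|x0] := eqVneq x 0; rewrite ?invr0 ?mulr0// mulfV// mul1r.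
apply: measurable_funM => //.
by apply: (measurableT_comp (measurable_powR _)); exact: measurable_funX.
Qed.

Lemma mule_injl (R : realType) (r : R) (a b : \bar R) :
  0 < r -> (r%:E * a = r%:E * b)%E -> a = b.
Proof.
move=> r0 rab; rewrite -[a]mul1e -[b]mul1e -(mulVf (lt0r_neq0 r0)) EFinM.
by rewrite -!muleA rab.
Qed.

Section gibbs.
Context {R : realType} {e : nat} (p : 'I_e -> R).
Local Notation cell := (nat * 'I_e)%type.
Local Notation VS := (vector_seq R e).
Variable B : probability VS R.
Hypothesis p_gt0 : forall i, 0 < p i.
Hypothesis Bp : exponential_increments p B.
Implicit Types (x z w : VS) (phi psi : VS -> \bar R) (n : nat).

Definition cells_at n : seq cell := [seq (n, i) | i <- enum 'I_e].
Definition cells_below n : seq cell :=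
  [seq (k, i) | k <- iota 0 n, i <- enum 'I_e].

Lemma mem_cells_at n c : (c \in cells_at n) = (c.1 == n).
Proof.
apply/mapP/idP => [[i _ ->]//|/eqP <-].
by exists c.2; rewrite ?mem_enum// -surjective_pairing.
Qed.

Lemma mem_cells_below n c : (c \in cells_below n) = (c.1 < n)%N.
Proof.
apply/allpairsP/idP => [[[k i] /= [+ _ ->]]|cn]; first by rewrite mem_iota.
by exists c; rewrite mem_iota mem_enum -surjective_pairing.
Qed.

Lemma uniq_cells_below n : uniq (cells_below n).
Proof.
apply: allpairs_uniq; rewrite ?iota_uniq ?enum_uniq//.
by move=> [? ?] [? ?] _ _ /=.
Qed.

Lemma uniq_cells n : uniq (cells_at n ++ cells_below n).
Proof.
rewrite cat_uniq uniq_cells_below andbT map_inj_uniq ?enum_uniq/=; last by move=> ? ? [].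
by apply/hasPn => c; rewrite mem_cells_below mem_cells_at => /ltn_eqF ->.
Qed.

Lemma mem_cells n c : (c \in cells_at n ++ cells_below n) = (c.1 < n.+1)%N.
Proof. by rewrite mem_cat mem_cells_at mem_cells_below ltnS [RHS]leq_eqVlt. Qed.

Definition nondecreasing_upto n : set VS :=
  [set z | forall k, (k <= n)%N -> forall i, 0 <= incr z k i].

Lemma measurable_nondecreasing_upto n : measurable (nondecreasing_upto n).
Proof.
have -> : nondecreasing_upto n = rect (fun k i x => incr x k i) n.+1 (fun _ _ => `[0, +oo[%classic).
  by apply/seteqP; split => z h k kn i; have := h k kn i; rewrite /= in_itv/= andbT.
apply: measurable_rect => k i; first exact: measurable_incr.
exact: measurable_itv.
Qed.

Lemma nondecreasing_upto_below n : depends_below n.+1 (nondecreasing_upto n).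
Proof.
move=> z z' zz'; apply/propext; split => h k kn i; have := h k kn i;
  by case: k kn => [|k] kn; rewrite /incr/= !zz'//; exact: ltnW.
Qed.

(** The density of the first [n + 1] vertices, on nondecreasing paths: the
    increments of a row up to level [n] add up to its last coordinate. *)
Definition last_factor n z : R :=
  \prod_i ((p i)^-1 ^+ n.+1 * expR (- (p i)^-1 * z n i)).

Lemma last_factor_ge0 n z : 0 <= last_factor n z.
Proof.
apply: prodr_ge0 => i _; apply: mulr_ge0; last exact: expR_ge0.
by rewrite exprn_ge0// invr_ge0 ltW.
Qed.

Lemma measurable_last_factor n : measurable_fun setT (last_factor n).
Proof.
apply: measurable_prod => i _; apply: measurable_funM => //.
apply: measurableT_comp => //; apply: measurable_funM => //.
exact: measurable_coord.
Qed.

(** The exponents telescope, so that on nondecreasing paths the density is a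
    function of the last vertex only. *)
Lemma increment_density_last n z :
  increment_density p (cells_at n ++ cells_below n) z =
  \1_(nondecreasing_upto n) z * last_factor n z.
Proof.
have pe : perm_eq (cells_at n ++ cells_below n) (cells_below n.+1).
  apply: uniq_perm => [||c]; [exact: uniq_cells|exact: uniq_cells_below|].
  by rewrite mem_cells mem_cells_below.
rewrite /increment_density (perm_big _ pe)/= big_allpairs -[iota 0 n.+1]/(index_iota 0 n.+1).
rewrite big_mkord exchange_big/= big_enum/=.
have [zn|zn] := pselect (nondecreasing_upto n z).
  rewrite indicE mem_set// mul1r; apply: eq_bigr => i _.
  under eq_bigr => k _.
    rewrite exponential_pdfE; last by apply: zn; rewrite -ltnS.
    over.
  rewrite big_split/= prodr_const card_ord; congr (_ * _).
  by rewrite -expR_sum -mulr_sumr sum_incr.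
rewrite indicE memNset// mul0r.
move/existsNP : zn => [k /not_implyP[kn /existsNP[i /negP]]]; rewrite -ltNge => zk.
rewrite (bigD1 i)//= (bigD1 (Ordinal (kn : (k < n.+1)%N)))//=.
by rewrite lt0_exponential_pdf// !mul0r.
Qed.

(** For a fixed vertex at level [n] each row of a nondecreasing path ranges over a
    simplex. *)
Definition simplex_integral n phi z : \bar R :=
  iterint (cells_below n) (fun z => phi z * (\1_(nondecreasing_upto n) z)%:E)%E z.

Lemma measurable_mul_nondecreasing n phi : measurable_fun setT phi ->
  measurable_fun setT (fun z => phi z * (\1_(nondecreasing_upto n) z)%:E)%E.
Proof.
move=> mphi; apply: emeasurable_funM => //; apply/measurable_EFinP.
by apply: measurable_indic; exact: measurable_nondecreasing_upto.
Qed.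

Lemma mul_nondecreasing_ge0 n phi z : (forall z, 0 <= phi z)%E ->
  (0 <= phi z * (\1_(nondecreasing_upto n) z)%:E)%E.
Proof. by move=> phi0; rewrite mule_ge0// lee_fin. Qed.

Lemma measurable_simplex_integral n phi : measurable_fun setT phi ->
  (forall z, 0 <= phi z)%E -> measurable_fun setT (simplex_integral n phi).
Proof.
move=> mphi phi0; apply: measurable_iterint.
  exact: measurable_mul_nondecreasing.
by move=> z; exact: mul_nondecreasing_ge0.
Qed.

Lemma simplex_integral_ge0 n phi z : (forall z, 0 <= phi z)%E ->
  (0 <= simplex_integral n phi z)%E.
Proof. by move=> phi0; apply: iterint_ge0 => z'; exact: mul_nondecreasing_ge0. Qed.

Definition depends_at (T : Type) n (F : VS -> T) :=
  forall z z' : VS, (forall i, z n i = z' n i) -> F z = F z'.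

(** Integration over the initial segment first and over the vertex at level [n]
    last; the density depends on this vertex only. *)
Lemma integral_last_vertex n phi psi z0 :
  measurable_fun setT phi -> (forall z, 0 <= phi z)%E -> depends_below n.+1 phi ->
  measurable_fun setT psi -> (forall z, 0 <= psi z)%E -> depends_at n psi ->
  (\int[B]_x (phi x * psi x) = iterint (cells_at n)
     (fun z => psi z * (last_factor n z)%:E * simplex_integral n phi z) z0)%E.
Proof.
move=> mphi phi0 phin mpsi psi0 psin.
rewrite (cesaro_density p_gt0 Bp (N := n.+1) (s := cells_at n ++ cells_below n) z0); last first.
- move=> z z' zz'; rewrite (phin _ _ zz') (psin z z')// => i; exact: zz'.
- by move=> z; rewrite mule_ge0.
- exact: emeasurable_funM.
- by move=> c; rewrite mem_cells.
- exact: uniq_cells.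
rewrite iterint_cat; apply: iterint_ext => z _.
rewrite /simplex_integral -(@iterint_factor _ _ (cells_below n)
  (fun z => phi z * (\1_(nondecreasing_upto n) z)%:E)%E
  (fun z => psi z * (last_factor n z)%:E)%E z)//; last first.
- move=> z1 z2 z12; have zn i : z1 n i = z2 n i by apply: z12; rewrite mem_cells_below/= ltnn.
  rewrite (psin _ _ zn) /last_factor; congr (_ * EFin _)%E.
  by apply: eq_bigr => i _; rewrite zn.
- by move=> z1; rewrite mule_ge0// lee_fin last_factor_ge0.
- by move=> z1; exact: mul_nondecreasing_ge0.
- exact: measurable_mul_nondecreasing.
apply: iterint_ext => z' _; rewrite increment_density_last EFinM.
by rewrite [RHS]muleACA; congr (_ * _)%E; rewrite muleC.
Qed.

Definition all_ones : VS := fun _ _ => 1.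

(** Scaling row [i] by [z n i] maps the simplices below the vertex [all_ones] onto
    those below the vertex of [z]; each of the [n] levels contributes the Jacobian
    [\prod_i z n i]. *)
Lemma simplex_integral_scale n phi z : measurable_fun setT phi ->
  (forall z, 0 <= phi z)%E -> depends_below n.+1 phi -> (forall i, 0 < z n i) ->
  simplex_integral n phi z =
  (((\prod_i z n i) ^+ n)%:E *
   simplex_integral n (phi \o scale_seq (z n)) all_ones)%E.
Proof.
move=> mphi phi0 phin zn0.
transitivity (iterint (cells_below n)
    (fun z => phi z * (\1_(nondecreasing_upto n) z)%:E)%E (scale_seq (z n) all_ones)).
  apply: iterint_eq => z1 z2 h1 h2 h3.
  have zz k : (k < n.+1)%N -> forall i, z1 k i = z2 k i.
    rewrite ltnS leq_eqVlt => /orP[/eqP-> i|kn i]; last by apply: h3; rewrite mem_cells_below.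
    rewrite h1 ?h2 ?mem_cells_below ?ltnn// /scale_seq mulr1//.
  rewrite (phin _ _ zz) !indicE; congr (_ * (_%:R)%:E)%E; congr nat_of_bool.
  by apply/idP/idP; rewrite !inE (nondecreasing_upto_below zz).
rewrite iterint_scale//; last 2 first.
- exact: measurable_mul_nondecreasing.
- by move=> z'; exact: mul_nondecreasing_ge0.
congr (_ * _)%E.
  have iotaE : iota 0 n = index_iota 0 n by rewrite /index_iota subn0.
  congr EFin; rewrite big_allpairs iotaE big_mkord/=.
  by rewrite prodr_const card_ord big_enum.
apply: iterint_ext => z' _ /=; congr (_ * (_)%:E)%E; rewrite !indicE; congr (_%:R).
congr nat_of_bool; apply/idP/idP; rewrite !inE => h k kn i; have := h k kn i;
  by case: k {kn} => [|k]; rewrite /incr/= /scale_seq -?mulrBr pmulr_rge0.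
Qed.
End gibbs.

(** * Bridges and the Gibbs property *)

Section gibbs_property.
Context {R : realType} {e : nat} (p : 'I_e -> R).
Local Notation VS := (vector_seq R e).
Variable B : probability VS R.
Hypothesis p_gt0 : forall i, 0 < p i.
Hypothesis Bp : exponential_increments p B.
Implicit Types (x z w : VS) (phi psi : VS -> \bar R) (n : nat).

Lemma exponential_prob_gt0 (r : R) : 0 < r ->
  exponential_prob r `]0, +oo[%classic = 1%E.
Proof.
move=> r0; rewrite /exponential_prob.
have mE : measurable_fun setT (EFin \o exponential_pdf r).
  by apply/measurable_EFinP; exact: measurable_exponential_pdf.
rewrite (@integral_itv_obnd_cbnd R 0 +oo%O (EFin \o exponential_pdf r)).
  rewrite -(integral_exponential_pdf r0) [LHS]integral_mkcond.
  apply: eq_integral => t _; rewrite patchE; case: ifPn => //.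
  rewrite notin_setE/= in_itv/= andbT => /negP; rewrite -ltNge => t0.
  by rewrite lt0_exponential_pdf.
exact: measurable_funS mE.
Qed.

Lemma prode_ones (I : finType) (F : I -> \bar R) :
  (forall i, F i = 1%E) -> (\prod_i F i = 1)%E.
Proof. by move=> F1; rewrite big1. Qed.

Definition increasing_upto n : set VS :=
  rect (fun k i x => incr x k i) n.+1 (fun _ _ => `]0, +oo[%classic).

Lemma measurable_increasing_upto n : measurable (increasing_upto n).
Proof.
apply: measurable_rect => k i; first exact: measurable_incr.
exact: measurable_itv.
Qed.

Lemma increasing_upto_ae n : B (~` increasing_upto n) = 0%E.
Proof.
rewrite probability_setC; last exact: measurable_increasing_upto.
rewrite /increasing_upto Bp; last by move=> k i; exact: measurable_itv.
rewrite prode_ones ?subee// => k; rewrite prode_ones// => i.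
by rewrite exponential_prob_gt0// invr_gt0.
Qed.

Lemma increasing_upto_gt0 n x k i : increasing_upto n x -> (k <= n)%N -> 0 < x k i.
Proof.
move=> xn kn; rewrite -sum_incr (bigD1 ord0)//= ltr_wpDr//.
  by apply: sumr_ge0 => j _; have := xn j (leq_trans (leq_ord j) kn) i;
    rewrite /= in_itv/= andbT => /ltW.
by have := xn 0%N (ltn0Sn _) i; rewrite /= in_itv/= andbT.
Qed.

Definition positive_at n : set VS := [set x | forall i, 0 < x n i].

Lemma measurable_positive_at n : measurable (positive_at n).
Proof.
have -> : positive_at n = \bigcap_(i in [set: 'I_e]) ((fun x : VS => x n i) @^-1` `]0, +oo[).
  by apply/seteqP; split => x h i; [move=> _ /=|]; have := h i; rewrite /= in_itv/= andbT => //; exact.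
apply: fin_bigcap_measurable => [|i _]; first exact: finite_finset.
rewrite -[X in measurable X]setTI; apply: measurable_coord => //; exact: measurable_itv.
Qed.

Lemma integral_positive_at n (f : VS -> \bar R) : (forall x, 0 <= f x)%E ->
  (\int[B]_x (f x * (\1_(positive_at n) x)%:E) = \int[B]_x f x)%E.
Proof.
move=> f0; apply: (@ge0_integral_ae_eq _ _ _ B (~` increasing_upto n)) => //.
- by apply: measurableC; exact: measurable_increasing_upto.
- exact: increasing_upto_ae.
- by move=> x; rewrite mule_ge0.
move=> x /contrapT xn; rewrite indicE mem_set ?mule1// => i.
exact: increasing_upto_gt0 xn (leqnn n).
Qed.

Definition simplex_volume n : \bar R := simplex_integral n (cst 1%E) (@all_ones R e).

(** The simplex integral divided by the Jacobian of the scaling; by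
    [simplex_meanE] it is an integral over the simplices below [all_ones]. *)
Definition simplex_mean n phi z : \bar R :=
  (simplex_integral n phi z * (((\prod_i z n i) ^+ n)^-1)%:E)%E.

Lemma prod_positive_at n z : positive_at n z -> 0 < (\prod_i z n i) ^+ n.
Proof. by move=> zn; apply: exprn_gt0; apply: prodr_gt0. Qed.

Lemma simplex_meanE n phi z : measurable_fun setT phi ->
  (forall z, 0 <= phi z)%E -> depends_below n.+1 phi -> positive_at n z ->
  simplex_mean n phi z = simplex_integral n (phi \o scale_seq (z n)) (@all_ones R e).
Proof.
move=> mphi phi0 phin zn; rewrite /simplex_mean simplex_integral_scale//.
rewrite muleAC -EFinM mulfV ?mul1e//.
by rewrite gt_eqF// prod_positive_at.
Qed.

Lemma simplex_mean_integral n phi z : positive_at n z ->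
  simplex_integral n phi z =
  (((\prod_i z n i) ^+ n)%:E * simplex_mean n phi z)%E.
Proof.
move=> zn; rewrite /simplex_mean muleCA -EFinM mulfV ?mule1//.
by rewrite gt_eqF// prod_positive_at.
Qed.

Lemma measurable_indic_positive_at n :
  measurable_fun setT (fun x : VS => (\1_(positive_at n) x)%:E : \bar R).
Proof. by apply/measurable_EFinP; apply: measurable_indic; exact: measurable_positive_at. Qed.

Lemma depends_at_positive_at n : depends_at n (\1_(positive_at n) : VS -> R).
Proof.
move=> z z' zz'; rewrite !indicE; congr (_%:R); congr nat_of_bool.
by apply/idP/idP; rewrite !inE => h i; have := h i; rewrite zz'.
Qed.

Let last_integral n (h : VS -> \bar R) : \bar R :=
  iterint (@cells_at e n) (fun z => ((\prod_i z n i) ^+ n * last_factor p n z)%:E *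
    (\1_(positive_at n) z)%:E * h z)%E (@all_ones R e).

Let integral_last n phi psi :
  measurable_fun setT phi -> (forall z, 0 <= phi z)%E -> depends_below n.+1 phi ->
  measurable_fun setT psi -> (forall z, 0 <= psi z)%E -> depends_at n psi ->
  (\int[B]_x (phi x * psi x) =
   last_integral n (fun z => simplex_mean n phi z * psi z))%E.
Proof.
move=> mphi phi0 phin mpsi psi0 psin.
rewrite -(@integral_positive_at n); last by move=> x; rewrite mule_ge0.
under eq_integral do rewrite -muleA.
rewrite (integral_last_vertex p_gt0 Bp (@all_ones R e) mphi phi0 phin); last 3 first.
- by apply: emeasurable_funM => //; exact: measurable_indic_positive_at.
- by move=> z; rewrite mule_ge0.
- by move=> z z' zz'; rewrite (psin _ _ zz') (depends_at_positive_at zz').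
apply: iterint_ext => z _; rewrite indicE; have [zn|zn] := pselect (positive_at n z).
  rewrite mem_set//= !mule1 simplex_mean_integral// EFinM -!muleA.
  by rewrite [LHS]muleC -!muleA muleCA.
by rewrite memNset//= ?mule0 ?mul0e.
Qed.

Let measurable_last n (h : VS -> \bar R) : measurable_fun setT h ->
  measurable_fun setT (fun z : VS => ((\prod_i z n i) ^+ n * last_factor p n z)%:E *
    (\1_(positive_at n) z)%:E * h z)%E.
Proof.
move=> mh; apply: emeasurable_funM => //; apply: emeasurable_funM.
  apply/measurable_EFinP; apply: measurable_funM; last exact: measurable_last_factor.
  by apply: measurable_funX; apply: measurable_prod => i _; exact: measurable_coord.
exact: measurable_indic_positive_at.
Qed.

Let last_ge0 n z : (0 <= ((\prod_i z n i) ^+ n * last_factor p n z)%:E *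
    (\1_(positive_at n) z)%:E)%E.
Proof.
rewrite indicE; have [zn|zn] := pselect (positive_at n z).
  by rewrite mem_set// mule1 lee_fin mulr_ge0 ?last_factor_ge0 ?ltW ?prod_positive_at.
by rewrite memNset// mule0.
Qed.

Let mean1 n z : positive_at n z -> simplex_mean n (cst 1%E) z = simplex_volume n.
Proof. by move=> zn; rewrite simplex_meanE. Qed.

Let last1 n psi : measurable_fun setT psi -> (forall z, 0 <= psi z)%E ->
  depends_at n psi ->
  (\int[B]_x psi x = simplex_volume n * last_integral n psi)%E.
Proof.
move=> mpsi psi0 psin; under eq_integral do rewrite -(mul1e (psi _)).
rewrite (@integral_last n (cst 1%E))// -iterintZ; last 3 first.
- exact: measurable_last.
- by move=> z; rewrite mule_ge0.
- exact: simplex_integral_ge0.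
apply: iterint_ext => z _; rewrite indicE; have [zn|zn] := pselect (positive_at n z).
  by rewrite mean1// muleCA.
by rewrite memNset// ?mule0 ?mul0e ?mule0.
Qed.

(** The volume is neither [0] nor infinite, since its product with an integral over
    the last vertex is the total mass [1]. *)
Lemma simplex_volume_gt0_fin n : exists2 c : R, 0 < c & simplex_volume n = c%:E.
Proof.
have V0 : (0 <= simplex_volume n)%E by exact: simplex_integral_ge0.
have := @last1 n (cst 1%E) (measurable_cst _) (fun _ => lee01) (fun _ _ _ => erefl).
rewrite integral_cst// mul1e [X in X = _ -> _](@probability_setT _ _ _ B).
set I := last_integral _ _; have I0 : (0 <= I)%E.
  by apply: iterint_ge0 => z; rewrite mule1.
move: V0; case: (simplex_volume n) => [c|_|//].
  rewrite lee_fin le_eqVlt => /predU1P[<-|c0 _]; last by exists c.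
  by rewrite mul0e => /eqP; rewrite onee_eq0.
move: I0; rewrite le_eqVlt => /predU1P[<-|I0].
  by rewrite mule0 => /eqP; rewrite onee_eq0.
by rewrite gt0_mulye.
Qed.

Let volume_integral n phi psi :
  measurable_fun setT phi -> (forall z, 0 <= phi z)%E -> depends_below n.+1 phi ->
  measurable_fun setT psi -> (forall z, 0 <= psi z)%E -> depends_at n psi ->
  (simplex_volume n * \int[B]_x (phi x * psi x) =
   \int[B]_x (simplex_mean n phi x * psi x * (\1_(positive_at n) x)%:E))%E.
Proof.
move=> mphi phi0 phin mpsi psi0 psin.
have mmean : measurable_fun setT (simplex_mean n phi).
  apply: emeasurable_funM; first exact: measurable_simplex_integral.
  apply/measurable_EFinP; apply: (measurableT_comp (@measurable_invr R)).
  by apply: measurable_funX; apply: measurable_prod => i _; exact: measurable_coord.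
rewrite (@integral_last n)// [RHS](@last1 n)//; last first.
- move=> z z' zz'; rewrite (psin _ _ zz') (depends_at_positive_at zz').
  rewrite indicE; have [zn|zn] := pselect (positive_at n z'); last by rewrite memNset// !mule0.
  have zn' : positive_at n z by move=> i; rewrite zz'; exact: zn.
  rewrite !simplex_meanE//; congr (simplex_integral n (phi \o scale_seq _) _ * _ * _)%E.
  exact/funext.
- move=> z; rewrite indicE; have [zn|zn] := pselect (positive_at n z); last by rewrite memNset// mule0.
  rewrite mem_set// mule1 mule_ge0// mule_ge0 ?simplex_integral_ge0//.
  by rewrite lee_fin invr_ge0 ltW// prod_positive_at.
- by apply: emeasurable_funM; [exact: emeasurable_funM|exact: measurable_indic_positive_at].
congr (_ * _)%E; apply: iterint_ext => z _.
rewrite indicE; case: (_ \in _); last by rewrite !mule0 !mul0e.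
by rewrite !mule1.
Qed.

(** The rows of [w], rescaled so as to pass through the vertex of [x] at level
    [n]. *)
Definition bridge n x w : VS := fun k i => x n i * (w k i / w n i).

Lemma measurable_bridge n :
  measurable_fun setT (fun z : VS * VS => bridge n z.1 z.2).
Proof.
apply: measurable_to_vector_seq => k i; apply: measurable_funM.
  exact: (measurableT_comp (measurable_coord n i) measurable_fst).
apply: measurable_funM.
  exact: (measurableT_comp (measurable_coord k i) measurable_snd).
apply: (measurableT_comp (@measurable_invr R)).
exact: (measurableT_comp (measurable_coord n i) measurable_snd).
Qed.

Definition bridge_mean n phi x : \bar R := (\int[B]_w phi (bridge n x w))%E.

Lemma bridge_mean_ge0 n phi x : (forall z, 0 <= phi z)%E -> (0 <= bridge_mean n phi x)%E.
Proof. by move=> phi0; apply: integral_ge0. Qed.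

Lemma measurable_bridge_mean n phi : measurable_fun setT phi ->
  (forall z, 0 <= phi z)%E -> measurable_fun setT (bridge_mean n phi).
Proof.
move=> mphi phi0.
have := measurable_fun_fubini_tonelli_F (m2 := B) (fun z : VS * VS => phi (bridge n z.1 z.2)).
apply => //; exact: (measurableT_comp mphi (measurable_bridge n)).
Qed.

Lemma depends_at_bridge_mean n phi : depends_at n (bridge_mean n phi).
Proof.
move=> z z' zz'; apply: eq_integral => w _; congr phi.
by apply/funext => k; apply/funext => i; rewrite /bridge zz'.
Qed.

(** Rescaled to end at [all_ones], a Cesaro path has its initial segment uniformly
    distributed on the simplices below [all_ones], whatever its last vertex was. *)
Lemma bridge_mean_volume n phi x : measurable_fun setT phi ->
  (forall z, 0 <= phi z)%E -> depends_below n.+1 phi ->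
  (simplex_volume n * bridge_mean n phi x =
   simplex_integral n (phi \o scale_seq (x n)) (@all_ones R e))%E.
Proof.
move=> mphi phi0 phin; pose phi' w := phi (bridge n x w).
have mphi' : measurable_fun setT phi'.
  apply: (measurableT_comp mphi).
  exact: (measurableT_comp (measurable_bridge n) (measurable_pair1 x)).
have phi'n : depends_below n.+1 phi'.
  by move=> w w' ww'; apply: phin => k kn i; rewrite /bridge !ww'.
have := @volume_integral n phi' (cst 1%E) mphi' (fun w => phi0 _) phi'n
  (measurable_cst _) (fun _ => lee01) (fun _ _ _ => erefl).
under eq_integral do rewrite mule1.
rewrite -/(bridge_mean n phi x) => ->.
set C := simplex_integral _ _ _.
transitivity (\int[B]_x0 (C * (\1_(positive_at n) x0)%:E))%E; last first.
  rewrite integral_positive_at ?integral_cst//.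
    by rewrite [X in (_ * X)%E](@probability_setT _ _ _ B) mule1.
  by move=> _; apply: simplex_integral_ge0 => z; exact: phi0.
apply: eq_integral => w _; rewrite mule1 indicE.
have [wn|wn] := pselect (positive_at n w); last by rewrite memNset// !mule0.
congr (_ * _)%E; rewrite simplex_meanE//; last by move=> z; exact: phi0.
apply: iterint_ext => u un /=; congr (_ * _)%E; congr phi.
apply/funext => k; apply/funext => i; rewrite /bridge /scale_seq.
rewrite (un n i) ?mem_cells_below ?ltnn// /all_ones mulr1.
by congr (_ * _); rewrite mulrAC mulfV ?mul1r// gt_eqF.
Qed.

Lemma simplex_integral_bridge n phi z : measurable_fun setT phi ->
  (forall z, 0 <= phi z)%E -> depends_below n.+1 phi -> positive_at n z ->
  simplex_integral n phi z =
  (((\prod_i z n i) ^+ n)%:E * simplex_volume n * bridge_mean n phi z)%E.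
Proof.
by move=> mphi phi0 phin zn; rewrite simplex_integral_scale// -bridge_mean_volume// muleA.
Qed.

Let gibbs_vertex n phi psi :
  measurable_fun setT phi -> (forall z, 0 <= phi z)%E -> depends_below n.+1 phi ->
  measurable_fun setT psi -> (forall z, 0 <= psi z)%E -> depends_at n psi ->
  (\int[B]_x (phi x * psi x) = \int[B]_x (bridge_mean n phi x * psi x))%E.
Proof.
move=> mphi phi0 phin mpsi psi0 psin.
have [c c0 cE] := simplex_volume_gt0_fin n.
apply: (mule_injl c0); rewrite -cE volume_integral//.
have mK := measurable_bridge_mean n mphi phi0.
rewrite -ge0_integralZl//; last 3 first.
- exact: emeasurable_funM.
- by move=> x _; apply: mule_ge0 => //; exact: bridge_mean_ge0.
- by rewrite cE lee_fin ltW.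
rewrite -[RHS](@integral_positive_at n); last first.
  move=> x; apply: mule_ge0; first by rewrite cE lee_fin ltW.
  by apply: mule_ge0 => //; exact: bridge_mean_ge0.
apply: eq_integral => x _; rewrite indicE.
have [xn|xn] := pselect (positive_at n x); last by rewrite memNset// !mule0.
by rewrite muleA bridge_mean_volume// simplex_meanE.
Qed.

(** The Gibbs property: given the vertex at level [n], the initial segment has a
    constant density on nondecreasing paths, which by scaling is the law of the
    bridge, and the later increments are independent of both. *)
Lemma gibbs n phi psi :
  measurable_fun setT phi -> (forall z, 0 <= phi z)%E -> depends_below n.+1 phi ->
  measurable_fun setT psi -> (forall z, 0 <= psi z)%E ->
  (\int[B]_x (phi x * psi (path_tail n x)) =
   \int[B]_x (bridge_mean n phi x * psi (path_tail n x)))%E.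
Proof.
move=> mphi phi0 phin mpsi psi0.
pose D k (i : 'I_e) := (n < k)%N.
(* the tail of [x] may be replaced by the vertex of [x] at level [n] followed
   by the increments of an independent path [w] *)
pose T w x : VS := fun m i => x n i + (w (n + m)%N i - w n i).
have mixE x w k i : (k <= n)%N -> mix D x w k i = x k i.
  move=> kn; rewrite -[RHS]sum_incr; apply: eq_bigr => j _.
  by rewrite /D ltnNge (leq_trans _ kn)//= -ltnS.
have mixT x w : path_tail n (mix D x w) = T w x.
  apply/funext => m; apply/funext => i; rewrite /path_tail /T.
  elim: m => [|m IH]; first by rewrite addn0 mixE// subrr addr0.
  rewrite addnS /mix big_ord_recr/= -/(mix D x w (n + m)%N i) IH /D.
  by rewrite ltnS leq_addr /incr/=; ring.
have mT : measurable_fun setT (fun z : VS * VS => T z.2 z.1).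
  apply: measurable_to_vector_seq => m i; apply: measurable_funD.
    exact: (measurableT_comp (measurable_coord n i) measurable_fst).
  by apply: measurable_funB;
    exact: (measurableT_comp (measurable_coord _ i) measurable_snd).
have mtail : measurable_fun setT (fun x => psi (path_tail n x)).
  by apply: (measurableT_comp mpsi); exact: measurable_path_tail.
have mK := measurable_bridge_mean n mphi phi0.
have swap (h : VS -> \bar R) : measurable_fun setT h -> (forall x, 0 <= h x)%E ->
    depends_below n.+1 h ->
    (\int[B]_x (h x * psi (path_tail n x)) =
     \int[B]_w \int[B]_x (h x * psi (T w x)))%E.
  move=> mh h0 hn; rewrite (integral_mix p_gt0 Bp D); last 2 first.
  - exact: emeasurable_funM.
  - by move=> x; rewrite mule_ge0.
  under eq_integral => x _.
    under eq_integral => w _.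
      rewrite mixT (hn _ x) => [|k kn i]; last exact: mixE.
      over.
    over.
  rewrite (fubini_tonelli (fun z : VS * VS => h z.1 * psi (T z.2 z.1))%E)//.
  - apply: emeasurable_funM; first exact: (measurableT_comp mh measurable_fst).
    exact: measurableT_comp.
  - by move=> z; rewrite mule_ge0.
rewrite !swap//; last 2 first.
- by move=> x; exact: bridge_mean_ge0.
- by move=> z z' zz'; apply: depends_at_bridge_mean => i; exact: zz'.
apply: eq_integral => w _; apply: gibbs_vertex => //.
- apply: (measurableT_comp mpsi).
  exact: (measurableT_comp mT (measurable_pair2 w)).
- by move=> z z' zz'; congr psi; apply/funext => m; apply/funext => i; rewrite /T zz'.
Qed.

End gibbs_property.

(** * Chernoff bounds *)

Definition almost_surely d (T : measurableType d) (R : realType)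
    (m : set T -> \bar R) (P : T -> Prop) : Prop :=
  exists N, [/\ measurable N, m N = 0%E & forall x, ~ N x -> P x].

Section almost_surely_lemmas.
Context d (T : measurableType d) (R : realType).
Variable m : {measure set T -> \bar R}.
Implicit Types P Q : T -> Prop.

Lemma almost_surely_imp P Q : (forall x, P x -> Q x) ->
  almost_surely m P -> almost_surely m Q.
Proof. by move=> PQ [N [mN mN0 NP]]; exists N; split => // x /NP /PQ. Qed.

Lemma almost_surely_forall_nat (P : nat -> T -> Prop) :
  (forall n, almost_surely m (P n)) -> almost_surely m (fun x => forall n, P n x).
Proof.
move=> /choice[N HN]; have mN : measurable (\bigcup_n N n).
  by apply: bigcupT_measurable => n; have [] := HN n.
exists (\bigcup_n N n); split => //.
- apply/negligibleP => //; apply: negligible_bigcup => n.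
  by have [mNn Nn0 _] := HN n; apply/negligibleP.
- move=> x Nx n; have [_ _] := HN n; apply; apply: contra_not Nx => Nnx.
  by exists n.
Qed.

Lemma almost_surely_forall (J : countType) (P : J -> T -> Prop) :
  (forall j, almost_surely m (P j)) -> almost_surely m (fun x => forall j, P j x).
Proof.
move=> h; pose Q n x := if unpickle n is Some j then P j x else True.
have HQ n : almost_surely m (Q n).
  rewrite /Q; case: (unpickle n) => [j|]; first exact: h.
  by exists set0; split.
apply: almost_surely_imp (almost_surely_forall_nat HQ) => x Hx j.
by have := Hx (pickle j); rewrite /Q pickleK.
Qed.

Lemma almost_surely_and P Q : almost_surely m P -> almost_surely m Q ->
  almost_surely m (fun x => P x /\ Q x).
Proof.
move=> aP aQ; have H (b : bool) : almost_surely m (if b then P else Q) by case: b.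
apply: almost_surely_imp (almost_surely_forall H) => x Hx.
by split; [exact: (Hx true)|exact: (Hx false)].
Qed.

Lemma almost_surely_null (A : set T) : measurable A -> m A = 0%E ->
  almost_surely m (fun x => ~ A x).
Proof. by move=> mA A0; exists A. Qed.

End almost_surely_lemmas.

Section law_of_large_numbers.
Context {R : realType} {e : nat} (p : 'I_e -> R).
Local Notation VS := (vector_seq R e).
Variable B : probability VS R.
Hypothesis p_gt0 : forall i, 0 < p i.
Hypothesis Bp : exponential_increments p B.

Definition with_frequency (i0 : 'I_e) (a : R) : 'I_e -> R :=
  fun j => if j == i0 then a else p j.

Section chernoff.
Variables (i0 : 'I_e) (a : R) (B' : probability VS R).
Hypothesis a_gt0 : 0 < a.
Hypothesis B'p' : exponential_increments (with_frequency i0 a) B'.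
Let p'_gt0 j : 0 < with_frequency i0 a j.
Proof. by rewrite /with_frequency; case: eqP. Qed.
Let s := (p i0)^-1 - a^-1.

Let measurable_exp n (b : R) :
  measurable_fun setT (fun x : VS => expR (s * (x n i0 - b))).
Proof.
apply: measurableT_comp => //; apply: measurable_funM => //.
by apply: measurable_funB => //; exact: measurable_coord.
Qed.

(** Multiplying the density of the Cesaro measure by [exp (s * x n i0)] only
    changes the frequency of the coordinate [i0] into [a]. *)
Lemma exponential_tilt n :
  (\int[B]_x (expR (s * (x n i0 - 0)))%:E = ((a / p i0) ^+ n.+1)%:E)%E.
Proof.
have E z : last_factor p n z * expR (s * (z n i0 - 0)) =
    (a / p i0) ^+ n.+1 * last_factor (with_frequency i0 a) n z.
  rewrite /last_factor (bigD1 i0)//= [in RHS](bigD1 i0)//= /with_frequency eqxx.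
  rewrite [in RHS](eq_bigr (fun i => (p i)^-1 ^+ n.+1 * expR (- (p i)^-1 * z n i))); last first.
    by move=> i /negbTE ->.
  rewrite subr0 mulrAC -[_ * _ * expR _]mulrA -expRD.
  have -> : - (p i0)^-1 * z n i0 + s * z n i0 = - a^-1 * z n i0 by rewrite /s; ring.
  rewrite !mulrA; congr (_ * _ * _); rewrite -exprMn mulrAC mulfV ?mul1r//.
  by rewrite gt_eqF.
rewrite (cesaro_density p_gt0 Bp (N := n.+1) (s := cells_at n ++ cells_below n) (@all_ones R e)); last first.
- by move=> z z' zz'; rewrite zz'.
- by move=> z; rewrite lee_fin expR_ge0.
- by apply/measurable_EFinP; exact: measurable_exp.
- by move=> c; rewrite mem_cells.
- exact: uniq_cells.
transitivity (iterint (cells_at n ++ cells_below n) (fun z => ((a / p i0) ^+ n.+1)%:E *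
  (cst 1 z * (increment_density (with_frequency i0 a) (cells_at n ++ cells_below n) z)%:E))%E (@all_ones R e)).
  apply: iterint_ext => z _; rewrite /cst mul1e -!EFinM !increment_density_last; congr EFin.
  by rewrite mulrCA [RHS]mulrCA -E (mulrC (expR _)).
rewrite iterintZ; last 3 first.
- exact: measurable_mul_density.
- move=> z; rewrite /cst mul1e lee_fin; exact: increment_density_ge0.
- by rewrite lee_fin exprn_ge0// divr_ge0// ltW.
rewrite -(cesaro_density p'_gt0 B'p' (N := n.+1))//.
- by rewrite integral_cst// mul1e [X in (_ * X)%E](@probability_setT _ _ _ B') mule1.
- exact: uniq_cells.
- by move=> c; rewrite mem_cells.
Qed.

Let r := a / p i0 * expR (1 - a / p i0).

(** The exponential Markov inequality.  The slope [s] is the one for which the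
    tilted coordinate has mean increment [a], which makes the bound smallest. *)
Lemma chernoff n :
  (B [set x | (0 <= s * (x n i0 - a * n.+1%:R))%R] <= (r ^+ n.+1)%:E)%E.
Proof.
have mA : measurable [set x : VS | (0 <= s * (x n i0 - a * n.+1%:R))%R].
  have -> : [set x : VS | (0 <= s * (x n i0 - a * n.+1%:R))%R] =
     (fun x : VS => s * (x n i0 - a * n.+1%:R)) @^-1` `[0, +oo[.
    by apply/seteqP; split => x /=; rewrite in_itv/= andbT.
  rewrite -[X in measurable X]setTI.
  have : measurable_fun setT (fun x : VS => s * (x n i0 - a * n.+1%:R)).
    by apply: measurable_funM => //; apply: measurable_funB => //; exact: measurable_coord.
  by apply => //; exact: measurable_itv.
rewrite -[X in B X](setIT [set x : VS | _]) -integral_indic//.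
apply: (@le_trans _ _ (\int[B]_x (expR (s * (x n i0 - a * n.+1%:R)))%:E)%E).
  apply: ge0_le_integral => //.
  - by apply/measurable_EFinP; exact: measurable_indic.
  - by apply/measurable_EFinP; exact: measurable_exp.
  move=> x _; rewrite lee_fin indicE; have [xA|xA] := boolP (_ \in _).
    by apply: le_trans (expR_ge1Dx _); rewrite lerDl; move: xA; rewrite inE.
  exact: expR_ge0.
under eq_integral => x _.
  have -> : s * (x n i0 - a * n.+1%:R) = - (s * (a * n.+1%:R)) + s * (x n i0 - 0) by ring.
  rewrite expRD EFinM; over.
rewrite ge0_integralZl//; last by apply/measurable_EFinP; exact: measurable_exp.
rewrite exponential_tilt -EFinM lee_fin /r [leRHS]exprMn mulrC.
have -> : - (s * (a * n.+1%:R)) = (1 - a / p i0) * n.+1%:R.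
  rewrite /s mulrA -mulNr; congr (_ * _); field.
  by rewrite !gt_eqF.
by rewrite expRM_natr.
Qed.

(** The bounds are summable, as [u * exp (1 - u) < 1] for [u != 1], and the
    Borel-Cantelli lemma applies.  Since [s] has the sign of [a - p i0], this covers
    the deviations of both signs. *)
Lemma chernoff_ae : a != p i0 ->
  almost_surely B (fun x => \forall n \near \oo, s * (x n i0 - a * n.+1%:R) < 0).
Proof.
move=> ap; pose A n := [set x : VS | (0 <= s * (x n i0 - a * n.+1%:R))%R].
have mA n : measurable (A n).
  have -> : A n = (fun x : VS => s * (x n i0 - a * n.+1%:R)) @^-1` `[0, +oo[.
    by apply/seteqP; split => x /=; rewrite in_itv/= andbT.
  rewrite -[X in measurable X]setTI.
  have : measurable_fun setT (fun x : VS => s * (x n i0 - a * n.+1%:R)).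
    by apply: measurable_funM => //; apply: measurable_funB => //; exact: measurable_coord.
  by apply => //; exact: measurable_itv.
have r0 : 0 <= r by rewrite mulr_ge0 ?expR_ge0// divr_ge0// ltW.
have r1 : r < 1.
  rewrite /r -[X in expR X]opprB expRN ltr_pdivrMr ?expR_gt0// mul1r.
  apply: le_lt_trans (expR_gt1Dx _); first by rewrite addrC subrK.
  by rewrite subr_eq0; apply: contra ap => /eqP/divr1_eq ->.
have sA : (\sum_(n <oo) B (A n) < +oo)%E.
  apply: (@le_lt_trans _ _ (r / (1 - r))%:E); last exact: ltry.
  apply: lime_le; first exact: is_cvg_nneseries.
  apply: nearW => n; apply: (@le_trans _ _ (\sum_(0 <= k < n) (r ^+ k.+1)%:E)%E).
    by apply: lee_sum => k _; exact: chernoff.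
  rewrite sumEFin lee_fin; have := @geometric_le_lim R n r r r0.
  rewrite /series/= /geometric/= => H.
  under eq_bigr do rewrite exprS.
  by apply: H => //; rewrite ?ger0_norm// mulr_gt0 ?expR_gt0// divr_gt0.
have := lim_sup_set_cvg0 mA sA => L0.
have mL : measurable (lim_sup_set A).
  by apply: bigcapT_measurable => n; apply: bigcup_measurable => k _; exact: mA.
apply: almost_surely_imp (almost_surely_null mL L0) => x; rewrite /lim_sup_set.
move=> /existsNP[N /not_implyP[_ HN]]; exists N => // n /= Nn.
by rewrite ltNge; apply/negP => xn; apply: HN; exists n.
Qed.

End chernoff.
End law_of_large_numbers.

(** * Two independent uniform variables from one *)

Section half_lines.
Context {R : realType}.

Lemma measurable_half_lines :
  @measurable _ (measurableTypeR R) = <<s [set `]-oo, x]%classic | x in [set: R]] >>.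
Proof.
rewrite RGenOInfty.measurableE; apply/seteqP; split; last first.
  apply: smallest_sub; first exact: smallest_sigma_algebra.
  move=> _ [x _ <-]; rewrite -RGenOInfty.measurableE.
  exact: (@measurable_itv R).
apply: smallest_sub; first exact: smallest_sigma_algebra.
move=> _ [x ->]; rewrite -setCitvl.
have [_ + _] := @smallest_sigma_algebra R setT [set `]-oo, x]%classic | x in [set: R]].
by move/(_ _ (@sub_sigma_algebra _ _ _ _ (ex_intro2 _ _ x I erefl))); rewrite setTD.
Qed.

Lemma half_lines_setI : setI_closed [set (`]-oo, x]%classic : set R) | x in [set: R]].
Proof.
move=> _ _ [x _ <-] [y _ <-]; exists (Num.min x y) => //.
by apply/seteqP; split => t /=; rewrite !in_itv/= le_min => /andP.
Qed.

Lemma measure_unique_half_lines (m1 m2 : {measure set (measurableTypeR R) -> \bar R}) :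
  (m1 setT < +oo)%E ->
  (forall x, m1 `]-oo, x]%classic = m2 `]-oo, x]%classic) ->
  forall A, measurable A -> m1 A = m2 A.
Proof.
move=> m1oo m12.
move=> A mA; apply: (@measure_unique _ R (measurableTypeR R)
  [set `]-oo, x]%classic | x in [set: R]] (fun n => `]-oo, n%:R]%classic)) => //.
- exact: measurable_half_lines.
- exact: half_lines_setI.
- apply/seteqP; split => // x _; exists (Num.truncn `|x|).+1 => //=.
  rewrite in_itv/= (le_trans (ler_norm x))// ltW//.
  by have /andP[] := Num.Theory.truncn_itv (normr_ge0 x).
- by move=> _ [x _ <-]; exact: m12.
- move=> n; apply: le_lt_trans m1oo; apply: le_measure => //; rewrite inE//.
Qed.

End half_lines.

Section binary_digits.
Context {R : realType}.

Let D : set (measurableTypeR R) := `[0, 1[%classic.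
Let mD : measurable D. Proof. exact: measurable_itv. Qed.

Definition unit_lebesgue : set (measurableTypeR R) -> \bar R :=
  mrestr lebesgue_measure mD.

HB.instance Definition _ := Measure.on unit_lebesgue.

Let P1 : unit_lebesgue setT = 1%E.
Proof.
rewrite /unit_lebesgue /mrestr setTI lebesgue_measure_itv/= lte_fin ltr01.
by rewrite oppr0 adde0.
Qed.

HB.instance Definition _ :=
  @Measure_isProbability.Build _ _ R unit_lebesgue P1.

Local Notation P := unit_lebesgue.

(** The first binary digit; it is the first of the digits of even position. *)
Definition first_digit (t : R) : R := if 2^-1 <= t then 1 else 0.

Definition digit_shift (t : measurableTypeR R) : measurableTypeR R :=
  2 * t - first_digit t.

Lemma measurable_first_digit : measurable_fun setT (first_digit : measurableTypeR R -> _).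
Proof.
apply: measurable_fun_ifT => //.
exact: measurable_fun_ler.
Qed.

Lemma measurable_digit_shift : measurable_fun setT digit_shift.
Proof.
apply: measurable_funB; last exact: measurable_first_digit.
exact: measurable_funM.
Qed.

Lemma first_digit_bool t : first_digit t = 0 \/ first_digit t = 1.
Proof. by rewrite /first_digit; case: ifP; [right|left]. Qed.

Lemma digit_law (al : R) (A : set R) : al = 0 \/ al = 1 -> measurable A ->
  (P [set t | first_digit t = al /\ A (digit_shift t)] = 2^-1%:E * P A)%E.
Proof.
move=> al01 mA; rewrite /unit_lebesgue /mrestr.
have mAD : measurable (A `&` D) by exact: measurableI.
rewrite (@lebesgue_measure_affine R 2 (- al) (A `&` D))// muleA -EFinM mulVf// mul1e.
congr lebesgue_measure; apply/seteqP; split => t /=; rewrite /D/= !in_itv/=.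
  by move=> [[<- At] /andP[t0 t1]]; split=> //; rewrite /first_digit; case: ifPn => h; apply/andP; split; lra.
move=> [At /andP[t0 t1]].
have da : first_digit t = al.
  by rewrite /first_digit; case: al01 t0 t1 {At} => -> t0 t1; case: ifPn => h //; exfalso; lra.
split; first by rewrite /digit_shift da.
by case: al01 t0 t1 => -> t0 t1; apply/andP; split; lra.
Qed.

Let fN N t : R := \sum_(n < N) first_digit (iter n.*2 digit_shift t) / 2 ^+ n.+1.

Let fNS N t : fN N.+1 t = (first_digit t + fN N (digit_shift (digit_shift t))) / 2.
Proof.
rewrite /fN big_ord_recl/= expr1 mulrDl; congr (_ + _).
rewrite mulr_suml; apply: eq_bigr => n _ /=.
rewrite -!iterS !iterSr -mulrA; congr (_ * _).
by rewrite [in LHS]exprS invfM mulrC.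
Qed.

Let fN_bound N t : 0 <= fN N t <= 1.
Proof.
elim: N t => [|N IH] t; first by rewrite /fN big_ord0 lexx ler01.
rewrite fNS; have /andP[] := IH (digit_shift (digit_shift t)).
by have [->|->] := first_digit_bool t => *; apply/andP; split; lra.
Qed.

Let fN_cvg t : cvgn (fN ^~ t).
Proof.
apply: nondecreasing_is_cvgn.
  apply/nondecreasing_seqP => n; rewrite /fN big_ord_recr/= lerDl.
  by apply: divr_ge0 => //; have [->|->] := first_digit_bool (iter n.*2 digit_shift t).
by exists 1 => _ [N _ <-]; have /andP[] := fN_bound N t.
Qed.

Definition even_digits t : R := limn (fN ^~ t).

Lemma even_digits_bound t : 0 <= even_digits t <= 1.
Proof.
apply/andP; split.
  by apply: limr_ge; [exact: fN_cvg|apply: nearW => N; have /andP[] := fN_bound N t].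
by apply: limr_le; [exact: fN_cvg|apply: nearW => N; have /andP[] := fN_bound N t].
Qed.

Lemma even_digitsE t : even_digits t =
  (first_digit t + even_digits (digit_shift (digit_shift t))) / 2.
Proof.
apply/cvg_lim => //; rewrite -cvg_shiftS.
rewrite (_ : [sequence _]_n = (fun N => (first_digit t + fN N (digit_shift (digit_shift t))) / 2)); last first.
  by apply/funext => N /=; rewrite fNS.
apply: cvgM; last exact: cvg_cst.
by apply: cvgD; [exact: cvg_cst|exact: fN_cvg].
Qed.

Lemma measurable_even_digits :
  measurable_fun setT (even_digits : measurableTypeR R -> measurableTypeR R).
Proof.
apply: (@measurable_fun_cvg _ _ _ _ fN) => [N|t _]; last exact: fN_cvg.
apply: measurable_sum => n; apply: measurable_funM => //.
apply: (measurableT_comp measurable_first_digit).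
elim: n.*2 => [|k IH]; first exact: measurable_id.
exact: (measurableT_comp measurable_digit_shift IH).
Qed.

Definition odd_digits t : measurableTypeR R := even_digits (digit_shift t).

Lemma measurable_odd_digits : measurable_fun setT odd_digits.
Proof. exact: (measurableT_comp measurable_even_digits measurable_digit_shift). Qed.

Let E x y : set (measurableTypeR R) := [set t | even_digits t <= x /\ odd_digits t <= y].

Let mE x y : measurable (E x y).
Proof.
have -> : E x y = (even_digits @^-1` `]-oo, x]) `&` (odd_digits @^-1` `]-oo, y]).
  by apply/seteqP; split => t /=; rewrite !in_itv.
apply: measurableI; rewrite -[X in measurable X]setTI.
  by apply: measurable_even_digits => //; exact: measurable_itv.
by apply: measurable_odd_digits => //; exact: measurable_itv.
Qed.

Let Phi x y := fine (P (E x y)).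

Let PhiE x y : P (E x y) = (Phi x y)%:E.
Proof. by rewrite /Phi fineK// fin_num_measure. Qed.

(** The first digit is an even digit, and the shift exchanges the even and the odd
    digits. *)
Let Phi_rec x y : Phi x y = (Phi y (2 * x) + Phi y (2 * x - 1)) / 2.
Proof.
apply: EFin_inj; rewrite -PhiE.
have part al : [set t | first_digit t = al /\ E y (2 * x - al) (digit_shift t)] =
    [set t | first_digit t = al] `&` E x y.
  apply/seteqP; split => t /=; rewrite /E/= /odd_digits.
    by move=> [ta [ty tx]]; split=> //; split => //; rewrite even_digitsE ta; lra.
  by move=> [ta [tx ty]]; split=> //; split => //; move: tx; rewrite even_digitsE ta; lra.
have split2 : E x y = ([set t | first_digit t = 0] `&` E x y) `|`
    ([set t | first_digit t = 1] `&` E x y).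
  apply/seteqP; split => t; last by move=> [[]|[]].
  by move=> Et; have [h|h] := first_digit_bool t; [left|right].
have md (al : R) : measurable [set t : measurableTypeR R | first_digit t = al].
  have := measurable_first_digit; move=> /(_ measurableT [set al] (measurable_set1 al)).
  by rewrite setTI.
have -> : P (E x y) =
   (P [set t | first_digit t = 0%R /\ E y (2 * x - 0)%R (digit_shift t)] +
    P [set t | first_digit t = 1%R /\ E y (2 * x - 1)%R (digit_shift t)])%E.
  rewrite !part [in LHS]split2 measureU//.
  - by apply: measurableI; [exact: md|exact: mE].
  - by apply: measurableI; [exact: md|exact: mE].
  - by apply/seteqP; split => // t /= [[-> _] [/eqP + _]]; rewrite eq_sym oner_eq0.
rewrite !digit_law; [|by right|exact: mE|by left|exact: mE].
by rewrite !PhiE subr0 -!EFinM -EFinD; congr EFin; lra.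
Qed.

(** The distribution function of the uniform law on the unit interval. *)
Let cl (x : R) := Num.max 0 (Num.min 1 x).

Let cl_rec x : cl x = (cl (2 * x) + cl (2 * x - 1)) / 2.
Proof.
rewrite /cl /Num.max /Num.min /Order.max /Order.min.
by repeat case: ifPn; rewrite -?leNgt => *; lra.
Qed.

Let cl0 x : x < 0 -> cl x = 0.
Proof. by move=> x0; apply/eqP; rewrite eq_le /cl ge_max lexx le_max lexx/= ge_min (ltW x0) orbT. Qed.
Let cl1 x : 1 <= x -> cl x = 1.
Proof. by move=> x1; rewrite /cl (min_idPl x1); apply/max_idPr. Qed.

Let Del x y := Phi x y - cl x * cl y.

Let Del_rec x y : Del x y =
  (Del (2 * x) (2 * y) + Del (2 * x) (2 * y - 1)
   + Del (2 * x - 1) (2 * y) + Del (2 * x - 1) (2 * y - 1)) / 4.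
Proof.
rewrite /Del Phi_rec (Phi_rec y) (Phi_rec y) (cl_rec x) (cl_rec y); lra.
Qed.

Let Del_neg x y : x < 0 \/ y < 0 -> Del x y = 0.
Proof.
move=> xy; rewrite /Del; have -> : Phi x y = 0.
  rewrite /Phi (_ : E x y = set0) ?measure0//; apply/seteqP; split => // t [].
  have /andP[t0 _] := even_digits_bound t.
  have /andP[t1 _] := even_digits_bound (digit_shift t).
  by rewrite /odd_digits => *; case: xy => ?; exfalso; lra.
by case: xy => /cl0 ->; rewrite ?mulr0 ?mul0r subrr.
Qed.

Let Del_big x y : 1 <= x -> 1 <= y -> Del x y = 0.
Proof.
move=> x1 y1; rewrite /Del !cl1// mulr1; have -> : Phi x y = 1; last by rewrite subrr.
rewrite /Phi (_ : E x y = setT); first by rewrite [P _]probability_setT.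
apply/seteqP; split => // t _.
have /andP[_ t0] := even_digits_bound t.
have /andP[_ t1] := even_digits_bound (digit_shift t).
by split; [exact: le_trans t0 x1|exact: le_trans t1 y1].
Qed.

(** One of the four terms of the recursion vanishes: the last one if [x] or [y] is
    below one half, the first one otherwise.  So the recursion contracts the
    supremum norm by the factor [3 / 4]. *)
Let Del_bound N x y : `|Del x y| <= (3 / 4) ^+ N.
Proof.
elim: N x y => [|N IH] x y.
  rewrite expr0 /Del.
  have c01 z : 0 <= cl z <= 1.
    by rewrite /cl le_max lexx/= ge_max ler01 ge_min lexx.
  have cc : 0 <= cl x * cl y <= 1.
    have /andP[? ?] := c01 x; have /andP[? ?] := c01 y.
    by rewrite mulr_ge0//= mulr_ile1.
  have : 0 <= Phi x y <= 1.
    by rewrite -!lee_fin -PhiE measure_ge0/= probability_le1.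
  by move: cc => /andP[? ?] /andP[? ?]; rewrite ler_norml; apply/andP; split; lra.
rewrite Del_rec exprS.
have := IH (2 * x) (2 * y); have := IH (2 * x) (2 * y - 1).
have := IH (2 * x - 1) (2 * y); have := IH (2 * x - 1) (2 * y - 1).
rewrite !ler_norml => /andP[? ?] /andP[? ?] /andP[? ?] /andP[? ?].
have [xy|] := boolP ((x < 2^-1) || (y < 2^-1)).
  have -> : Del (2 * x - 1) (2 * y - 1) = 0.
    by apply: Del_neg; case/orP: xy => h; [left|right]; lra.
  by apply/andP; split; lra.
rewrite negb_or -!leNgt => /andP[hx hy].
have -> : Del (2 * x) (2 * y) = 0 by apply: Del_big; lra.
by apply/andP; split; lra.
Qed.

Let Del0 x y : Del x y = 0.
Proof.
apply/eqP; rewrite -normr_eq0 eq_le normr_ge0 andbT.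
apply/ler_addgt0Pr => eps eps0; rewrite add0r.
have : (3 / 4 : R) ^+ n @[n --> \oo] --> 0.
  by apply: cvg_expr; rewrite ger0_norm; lra.
move=> /cvgrPdist_lt /(_ _ eps0)[N _ /(_ N (leqnn N))] /=.
rewrite sub0r normrN ger0_norm; last by rewrite exprn_ge0//; lra.
by move=> h; apply: le_trans (Del_bound N x y) (ltW h).
Qed.

Lemma digits_joint_cdf x y :
  P [set t | even_digits t <= x /\ odd_digits t <= y] = (cl x * cl y)%:E.
Proof. by rewrite PhiE; congr EFin; apply/eqP; rewrite -subr_eq0; apply/eqP/Del0. Qed.

Lemma unit_lebesgue_cdf x : P `]-oo, x]%classic = (cl x)%:E.
Proof.
rewrite /unit_lebesgue /mrestr; have [x0|x0] := ltP x 0.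
  rewrite cl0// (_ : _ `&` _ = set0) ?measure0//; apply/seteqP; split => // t [] /=.
  by rewrite /D/= !in_itv/= => tx /andP[t0 _]; have := le_trans t0 tx; rewrite leNgt x0.
have [x1|x1] := leP 1 x.
  rewrite cl1// (_ : _ `&` _ = D) ?lebesgue_measure_itv/= ?lte_fin ?ltr01 ?oppr0 ?adde0//.
  apply/seteqP; split => t /=; first by case.
  by rewrite /D/= !in_itv/= => /andP[t0 t1]; split; rewrite ?t0// (le_trans (ltW t1)).
rewrite (_ : _ `&` _ = `[0, x]%classic).
  rewrite lebesgue_measure_itv/= lte_fin /cl (min_idPr (ltW x1)) (max_idPr x0).
  have [x00|] := ltP 0 x; first by rewrite oppr0 adde0.
  by move=> x00; congr EFin; apply/eqP; rewrite eq_le x0 x00.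
apply/seteqP; split => t /=; rewrite /D/= !in_itv/=.
  by move=> [tx /andP[-> _]].
by move=> /andP[t0 tx]; rewrite tx t0 (le_lt_trans tx x1).
Qed.

(** The joint distribution function is a product by [Del_bound]; the two
    half-lines are replaced by measurable sets one after the other. *)
Lemma digits_independent (A B : set (measurableTypeR R)) :
  measurable A -> measurable B ->
  (P [set t | A (even_digits t) /\ B (odd_digits t)] = P A * P B)%E.
Proof.
move=> mA mB.
have mpre S (phi : measurableTypeR R -> measurableTypeR R) :
    measurable_fun setT phi -> measurable S -> measurable (phi @^-1` S).
  by move=> mphi mS; rewrite -[X in measurable X]setTI; exact: mphi.
have me := measurable_even_digits; have mo := measurable_odd_digits.
have uniq (S : set (measurableTypeR R)) (mS : measurable S) (c : R) (c0 : 0 <= c)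
    (phi : measurableTypeR R -> measurableTypeR R) (mphi : measurable_fun setT phi) :
    (forall x, P (phi @^-1` `]-oo, x] `&` S) = (c%:E * P `]-oo, x]%classic)%E) ->
    forall T, measurable T -> P (phi @^-1` T `&` S) = (c%:E * P T)%E.
  move=> h2 T mT.
  have h1 : (P (phi @^-1` setT `&` S) < +oo)%E.
    rewrite (le_lt_trans (probability_le1 P _)) ?ltry//.
    by apply: measurableI => //; exact: mpre.
  exact: (@measure_unique_half_lines R (push_measure (mrestr P mS) mphi)
    (mscale (NngNum c0) P) h1 h2 T mT).
have step1 y : P [set t | A (even_digits t) /\ odd_digits t <= y] = (P A * (cl y)%:E)%E.
  have mS := mpre _ _ mo (@measurable_itv R `]-oo, y]).
  have cl0' : 0 <= cl y by rewrite /cl le_max lexx.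
  have -> : [set t | A (even_digits t) /\ odd_digits t <= y] =
      even_digits @^-1` A `&` (odd_digits @^-1` `]-oo, y]).
    by apply/seteqP; split => t /=; rewrite in_itv.
  rewrite muleC; apply: uniq => // x.
  rewrite unit_lebesgue_cdf -EFinM mulrC -digits_joint_cdf.
  by congr (P _); apply/seteqP; split => t /=; rewrite !in_itv.
have PA : P A = (fine (P A))%:E by rewrite fineK// fin_num_measure.
have -> : [set t | A (even_digits t) /\ B (odd_digits t)] =
    odd_digits @^-1` B `&` (even_digits @^-1` A).
  by apply/seteqP; split => t /= [].
rewrite PA; apply: uniq => //; first exact: mpre.
  by rewrite fine_ge0.
move=> x; rewrite -PA unit_lebesgue_cdf -step1.
by congr (P _); apply/seteqP; split => t /=; rewrite in_itv/= => -[].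
Qed.

End binary_digits.

(** * Existence of the Cesaro measure *)

Section iid_uniform.
Context {R : realType}.
Local Notation P := (@unit_lebesgue R).

(** The even digits of what remains after splitting off the even digits [j]
    times. *)
Definition uniform_seq (j : nat) (t : measurableTypeR R) : measurableTypeR R :=
  even_digits (iter j odd_digits t).

Lemma measurable_uniform_seq j : measurable_fun setT (uniform_seq j).
Proof.
apply: (measurableT_comp measurable_even_digits).
elim: j => [|j IH]; first exact: measurable_id.
exact: (measurableT_comp measurable_odd_digits IH).
Qed.

Lemma uniform_seq_iid J (A : nat -> set (measurableTypeR R)) :
  (forall j, measurable (A j)) ->
  P [set t | forall j, (j < J)%N -> A j (uniform_seq j t)] = (\prod_(j < J) P (A j))%E.
Proof.
elim: J A => [|J IH] A mA.
  rewrite big_ord0 (_ : [set t | _] = setT) ?[P _]probability_setT//.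
  by apply/seteqP; split.
rewrite big_ord_recl/= -(IH (fun j => A j.+1))// -digits_independent//; last first.
  rewrite (_ : [set t | _] = \bigcap_(j in `I_J) (uniform_seq j @^-1` A j.+1)).
    apply: bigcap_measurableType => j _; rewrite -[X in measurable X]setTI.
    by apply: measurable_uniform_seq.
  by apply/seteqP; split => t /= h j jJ; exact: h.
congr (P _); apply/seteqP; split => t /= h.
  split; first exact: (h 0%N).
  by move=> j jJ; have := h j.+1 jJ; rewrite /uniform_seq iterSr.
move=> [|j] jJ; first by case: h.
by case: h => _ /(_ j jJ); rewrite /uniform_seq iterSr.
Qed.

Definition exponential_quantile (a : R) (u : measurableTypeR R) : measurableTypeR R :=
  - a * ln (1 - u).

Lemma measurable_exponential_quantile a : measurable_fun setT (exponential_quantile a).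
Proof.
apply: measurable_funM => //; apply: (measurableT_comp (@measurable_ln R)).
exact: measurable_funB.
Qed.

Lemma exponential_prob_half_line (r x : R) : 0 < r ->
  exponential_prob r `]-oo, x]%classic =
  (if 0 <= x then 1 - expR (- r * x) else 0)%:E.
Proof.
move=> r0; have mE : measurable_fun setT (EFin \o exponential_pdf r).
  by apply/measurable_EFinP; exact: measurable_exponential_pdf.
have neg y : (\int[lebesgue_measure]_(t in `]-oo, y[%classic) (exponential_pdf r t)%:E =
    \int[lebesgue_measure]_(t in `]-oo, y[%classic `&` `[0%R, +oo[) (exponential_pdf r t)%:E)%E.
  rewrite [RHS]integral_mkcondr; apply: eq_integral => t _; rewrite patchE.
  case: ifPn => //; rewrite notin_setE/= in_itv/= andbT => /negP; rewrite -ltNge => t0.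
  by rewrite lt0_exponential_pdf.
have -> : exponential_prob r `]-oo, x]%classic =
    (\int[lebesgue_measure]_(t in `]-oo, x[%classic) (exponential_pdf r t)%:E)%E.
  rewrite /exponential_prob.
  rewrite -(@integral_itv_bndo_bndc R -oo%O x (EFin \o exponential_pdf r))//.
  exact: measurable_funS mE.
rewrite neg; case: ifPn => x0; last first.
  rewrite (_ : _ `&` _ = set0) ?integral_set0//.
  apply/seteqP; split => // t [] /=; rewrite !in_itv/= andbT => tx t0.
  by move: x0; rewrite (ltW (le_lt_trans t0 tx)).
rewrite (_ : _ `&` _ = `[0, x[%classic); last first.
  apply/seteqP; split => t /=; rewrite !in_itv/= ?andbT; first by move=> [-> ->].
  by move=> /andP[-> ->].
rewrite (@integral_itv_bndo_bndc R (BLeft 0) x (EFin \o exponential_pdf r)); last exact: measurable_funS mE.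
move: x0; rewrite le_eqVlt => /predU1P[<-|x0]; last exact: (exponential_prob_itv0c r x0).
by rewrite set_itv1 integral_set1 mulr0 expR0 subrr.
Qed.

Lemma exponential_quantile_law (a : R) (A : set R) : 0 < a -> measurable A ->
  P (exponential_quantile a @^-1` A) = exponential_prob a^-1 A.
Proof.
move=> a0 mA; have r0 : 0 < a^-1 by rewrite invr_gt0.
have mq := measurable_exponential_quantile a.
apply: (@measure_unique_half_lines R (push_measure P mq)
  (@exponential_distribution_exponential_prob__canonical__measure_function_Measure R a^-1 r0) _ _ A mA).
  by rewrite (le_lt_trans (probability_le1 P _)) ?ltry//; rewrite preimage_setT.
move=> x; rewrite -[RHS]/(exponential_prob a^-1 `]-oo, x]%classic) exponential_prob_half_line//.
rewrite -[LHS]/(P (exponential_quantile a @^-1` `]-oo, x]%classic)).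
have quant (u : R) : 0 <= u < 1 -> (exponential_quantile a u <= x) = (u <= 1 - expR (- a^-1 * x)).
  move=> /andP[u0 u1]; rewrite /exponential_quantile.
  have -> : (- a * ln (1 - u) <= x) = (- a^-1 * x <= ln (1 - u)).
    by rewrite !mulNr lerNl -ler_pdivrMl// mulrN; congr (- _ <= _).
  by rewrite -[LHS]ler_expR lnK ?posrE ?subr_gt0// lerBrDl -lerBrDr.
transitivity (P `]-oo, (1 - expR (- a^-1 * x))]%classic).
  rewrite /unit_lebesgue /mrestr; congr lebesgue_measure; apply/seteqP; split => u /=;
    rewrite !in_itv/= => -[h1 h2]; split => //; move: h1; by rewrite quant.
rewrite unit_lebesgue_cdf; congr EFin; case: ifPn => x0.
  rewrite (min_idPr _) ?gerBl ?expR_ge0//; apply/max_idPr.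
  by rewrite subr_ge0 -[leRHS]expR0 ler_expR mulNr oppr_le0 mulr_ge0// ltW.
apply/max_idPl; rewrite ge_min; apply/orP; right; rewrite subr_le0 -[leLHS]expR0 ler_expR.
by rewrite mulNr oppr_ge0 pmulr_rle0// ltW// ltNge.
Qed.

End iid_uniform.

Section cesaro_existence.
Context {R : realType} {e' : nat}.
Local Notation e := e'.+1.
Local Notation VS := (vector_seq R e).
Local Notation P := (@unit_lebesgue R).
Variable p : 'I_e -> R.
Hypothesis p_gt0 : forall i, 0 < p i.

Let increment_at k (i : 'I_e) t := exponential_quantile (p i) (uniform_seq (k * e + i) t).

Let random_path (t : measurableTypeR R) : VS :=
  fun k i => \sum_(j < k.+1) increment_at j i t.

Let measurable_increment_at k i : measurable_fun setT (increment_at k i).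
Proof.
exact: (measurableT_comp (measurable_exponential_quantile _) (measurable_uniform_seq _)).
Qed.

Let measurable_random_path : measurable_fun setT random_path.
Proof.
apply: measurable_to_vector_seq => k i; apply: measurable_sum => j.
exact: measurable_increment_at.
Qed.

Let incr_random_path t k i : incr (random_path t) k i = increment_at k i t.
Proof.
case: k => [|k]; first by rewrite /incr/= /random_path big_ord1.
by rewrite {1}/incr/= /random_path big_ord_recr/= addrAC subrr add0r.
Qed.

Let cesaro_law := push_measure P measurable_random_path.

Let cesaro_law_setT : cesaro_law setT = 1%E.
Proof. exact: (@probability_setT _ _ _ P). Qed.

HB.instance Definition _ := Measure.on cesaro_law.
HB.instance Definition _ :=
  @Measure_isProbability.Build _ _ R cesaro_law cesaro_law_setT.

Let cesaro_law_increments : exponential_increments p cesaro_law.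
Proof.
move=> K A mA.
pose A' j : set (measurableTypeR R) :=
  exponential_quantile (p (inord (j %% e)%N)) @^-1` A (j %/ e)%N (inord (j %% e)%N).
have mA' j : measurable (A' j).
  rewrite -[X in measurable X]setTI; apply: measurable_exponential_quantile => //.
  exact: mA.
have dvE k (i : 'I_e) : ((k * e + i) %/ e = k)%N.
  by rewrite divnMDl// divn_small// addn0.
have mdE k (i : 'I_e) : inord ((k * e + i) %% e)%N = i.
  by apply/val_inj; rewrite modnMDl modn_small//= inordK.
transitivity (P [set t | forall j, (j < K * e)%N -> A' j (uniform_seq j t)]).
  congr (P _); apply/seteqP; split => t /= h.
    move=> j jK; have kK : (j %/ e < K)%N by rewrite ltn_divLR.
    have := h _ kK (inord (j %% e)%N); rewrite /= incr_random_path /increment_at /A'.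
    by rewrite inordK ?ltn_pmod// -divn_eq.
  move=> k kK i; rewrite /= incr_random_path /increment_at.
  have kj : (k * e + i < K * e)%N.
    by rewrite (@leq_trans (k.+1 * e))// ?leq_mul2r ?kK ?orbT// mulSn addnC ltn_add2r.
  by have := h _ kj; rewrite /A' dvE mdE.
rewrite uniform_seq_iid// -(big_mkord xpredT (fun j => P (A' j))) big_nat_mul.
rewrite big_mkord; apply: eq_bigr => k _.
rewrite -[X in \big[_/_]_(X <= _ < _) _]add0n big_addn mulSn addnK.
rewrite big_mkord; apply: eq_bigr => i _; rewrite addnC.
by rewrite /A' dvE mdE exponential_quantile_law.
Qed.

Lemma exponential_increments_exists :
  exists B : probability VS R, exponential_increments p B.
Proof. by exists cesaro_law; exact: cesaro_law_increments. Qed.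

End cesaro_existence.

Section cesaro_product_of_increments.
Context {R : realType} {e : nat} (p : 'I_e -> R).
Local Notation VS := (vector_seq R e).
Variable B : probability VS R.
Hypothesis p_gt0 : forall i, 0 < p i.
Hypothesis Bp : exponential_increments p B.

Let coord (i : 'I_e) (x : VS) : borel (nat -> R) := fun n => x n i.

Let measurable_coord_seq i : measurable_fun setT (coord i).
Proof. by apply: measurable_to_scalar_seq => k; exact: measurable_coord. Qed.

Let is_cesaro_coord i : is_cesaro (p i) (pushforward B (coord i)).
Proof.
move=> K A mA; pose A' k (j : 'I_e) := if j == i then A k else setT.
have mA' k j : measurable (A' k j) by rewrite /A'; case: ifP.
transitivity (B (rect (fun k i x => incr x k i) K A')).
  congr (B _); apply/seteqP; split => x /= h.
    by move=> k kK j; rewrite /A'; case: eqP => // ->; exact: h.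
  by move=> k kK; have := h k kK i; rewrite /A' eqxx.
rewrite Bp//; apply: eq_bigr => k _; rewrite (bigD1 i)//= /A' eqxx big1 ?mule1//.
by move=> j /negbTE ->; rewrite exponential_prob_setT// invr_gt0.
Qed.

(** Row [i] may be replaced by that of an independent path, so that the rows can be
    split off one by one. *)
Let independent_coords (s : seq 'I_e) (A : 'I_e -> set (borel (nat -> R))) :
  uniq s -> (forall i, measurable (A i)) ->
  B [set x | forall i, i \in s -> A i (coord i x)] =
  (\prod_(i <- s) pushforward B (coord i) (A i))%E.
Proof.
move=> + mA; have mpre i : measurable (coord i @^-1` A i).
  by rewrite -[X in measurable X]setTI; exact: measurable_coord_seq.
elim: s => [_|i s IH /= /andP[is_ us]].
  rewrite big_nil (_ : [set x | _] = setT) ?probability_setT//.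
  by apply/seteqP; split.
have mS : measurable [set x : VS | forall j, j \in s -> A j (coord j x)].
  rewrite (_ : [set x | _] = \bigcap_(j in [set j | j \in s]) (coord j @^-1` A j)); last first.
    by apply/seteqP; split => x /= h j js; exact: h.
  by apply: fin_bigcap_measurable => [|j _]; [exact: finite_finset|exact: mpre].
rewrite big_cons -IH// [LHS](mix_law p_gt0 Bp (fun _ j => j == i)); last first.
  rewrite (_ : [set x : VS | forall j, j \in i :: s -> A j (coord j x)] =
    (coord i @^-1` A i) `&` [set x : VS | forall j, j \in s -> A j (coord j x)]).
    by apply: measurableI => //; exact: mpre.
  apply/seteqP; split => x /= h.
    by split => [|j js]; [apply: (h i); exact: mem_head|apply: h; rewrite in_cons js orbT].
  by move=> j; rewrite in_cons => /predU1P[->|]; case: h => // _; exact.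
have mixw x w : coord i (mix (fun _ j => j == i) x w) = coord i w.
  apply/funext => k; rewrite /coord -[RHS]sum_incr; apply: eq_bigr => j _.
  by rewrite eqxx.
have mixx x w j : j != i -> coord j (mix (fun _ j => j == i) x w) = coord j x.
  move=> ji; apply/funext => k; rewrite /coord -[RHS]sum_incr; apply: eq_bigr => l _.
  by rewrite (negbTE ji).
transitivity ((B \x B)%E ([set x : VS | forall j, j \in s -> A j (coord j x)] `*`
   (coord i @^-1` A i))).
  congr ((B \x B)%E _); apply/seteqP; split => -[x w] /= h.
    split; last by have := h i (mem_head _ _); rewrite mixw.
    move=> j js; have := h j; rewrite in_cons js orbT mixx; first exact.
    by apply: contraNneq is_ => <-.
  case: h => hx hw j; rewrite in_cons => /predU1P[->|js]; first by rewrite mixw.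
  by rewrite mixx; [exact: hx|apply: contraNneq is_ => <-].
by rewrite product_measure1E// muleC.
Qed.

Lemma exponential_increments_cesaro_product : cesaro_product p B.
Proof.
split; first exact: is_cesaro_coord.
move=> A mA; have := independent_coords (enum_uniq 'I_e) mA.
rewrite big_enum/= => <-; congr (B _); apply/seteqP; split => x /= h i; first by [].
exact: h (mem_enum _ _).
Qed.

End cesaro_product_of_increments.

(** * The inequalities that define paths *)

Section measurable_predicates.
Context d (T : measurableType d).

Lemma measurable_forall (J : countType) (P : J -> T -> Prop) :
  (forall i, measurable [set x | P i x]) -> measurable [set x | forall i, P i x].
Proof.
move=> mP; rewrite (_ : [set x | _] = ~` (\bigcup_i ~` [set x | P i x])); last first.
  rewrite setC_bigcup; apply/seteqP; split => x /= h i; first by move=> _; rewrite setCK.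
  by have := h i I; rewrite setCK.
apply: measurableC; apply: countable_bigcupT_measurable => // i.
exact: measurableC.
Qed.

Lemma measurable_imp (Q : Prop) (P : T -> Prop) :
  (Q -> measurable [set x | P x]) -> measurable [set x | Q -> P x].
Proof.
move=> mP; have [q|nq] := pselect Q.
  have -> : [set x | Q -> P x] = [set x | P x]; last exact: mP.
  by apply/seteqP; split => x /= h //; exact: h.
have -> : [set x | Q -> P x] = setT by apply/seteqP; split => x // _ /nq.
exact: measurableT.
Qed.

Lemma measurable_and (P Q : T -> Prop) :
  measurable [set x | P x] -> measurable [set x | Q x] -> measurable [set x | P x /\ Q x].
Proof. exact: measurableI. Qed.

Lemma measurable_le (R : realType) (f g : T -> R) : measurable_fun setT f ->
  measurable_fun setT g -> measurable [set x | f x <= g x].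
Proof.
move=> mf mg; have := measurable_fun_ler mf mg.
move=> /(_ measurableT [set true]); rewrite setTI; apply.
exact: I.
Qed.

End measurable_predicates.

Section exponential_interval.
Context {R : realType}.

Lemma exponential_prob_itv_gt0 (r a b : R) : 0 < r -> 0 <= a -> a < b ->
  (0 < exponential_prob r `]a, b]%classic)%E.
Proof.
move=> r0 a0 ab.
pose nu := @exponential_distribution_exponential_prob__canonical__measure_function_Measure R r r0.
have E : nu `]-oo, b]%classic = (nu `]-oo, a]%classic + nu `]a, b]%classic)%E.
  rewrite -measureU; [|exact: measurable_itv|exact: measurable_itv|].
    congr (nu _); apply/seteqP; split => t /=; rewrite !in_itv/=.
      by move=> tb; have [ta|ta] := leP t a; [left|right].
    by move=> [ta|/andP[]//]; rewrite (le_trans ta)// ltW.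
  apply/seteqP; split => // t [] /=; rewrite !in_itv/= => ta /andP[+ _].
  by rewrite ltNge ta.
move: E; rewrite -[nu `]a, b]%classic]/(exponential_prob r `]a, b]%classic).
rewrite -[nu _]/(exponential_prob r `]-oo, b]%classic).
rewrite -[nu _]/(exponential_prob r `]-oo, a]%classic).
rewrite !exponential_prob_half_line// a0 (ltW (le_lt_trans a0 ab)).
have : (0 <= exponential_prob r `]a, b]%classic)%E by exact: (measure_ge0 nu).
rewrite le_eqVlt => /predU1P[<-|//].
rewrite adde0 => -[] /eqP; rewrite (inj_eq (addrI _)) (inj_eq oppr_inj).
by move=> /eqP/expR_inj/eqP; rewrite !mulNr eqr_opp (inj_eq (mulfI (lt0r_neq0 r0))) gt_eqF.
Qed.

End exponential_interval.

Section gaps.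
Context {R : realType} {d : nat} (g : branching_graph).
Local Notation VS := (vector_seq R d).
Implicit Types (x : VS).

(** The inequality between row [i] at level [k + b] and row [j] at level [k].  For
    nondecreasing rows these inequalities define the paths of the graph; those
    with [b = 1] occur between consecutive rows of the Gelfand-Tsetlin graph. *)
Definition crossing (i j : 'I_d) (b : bool) : bool :=
  (i < j)%N && (~~ b || ((if g is GelfandTsetlin then true else false) && (j == i.+1 :> nat))).

Definition path_upto n : set VS :=
  [set x | (forall k, (k <= n)%N -> chamber (x k)) /\
           (forall k, (k < n)%N -> edge g (x k) (x k.+1))].

Lemma path_upto_gaps n x : (forall k i, 0 <= incr x k i) ->
  path_upto n x <->
  forall i j b k, crossing i j b -> (k + b <= n)%N -> x (k + b)%N i <= x k j.
Proof.
move=> xi0; have x0 k i : 0 <= x k i.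
  by rewrite -sum_incr; apply: sumr_ge0 => j _; exact: xi0.
have xS k i : x k i <= x k.+1 i by have := xi0 k.+1 i; rewrite /incr/= subr_ge0.
split => [[xc xe] i j b k /andP[ij] |h].
  case: b => /=; last by move=> _; rewrite addn0 => kn; apply: (xc k kn).2; exact: ltnW.
  move=> /andP[gT /eqP ji]; rewrite addn1 => kn; have := xe k kn.
  by rewrite /edge; case: g gT => //= _ [_]; exact.
split => [k kn|k kn].
  split=> // i j; rewrite leq_eqVlt => /predU1P[ij|ij]; first by rewrite (val_inj ij).
  by have := h i j false k; rewrite /crossing ij/= addn0; exact.
rewrite /edge; case gE : g => //; split=> // i j ji.
by have := h i j true k; rewrite /crossing gE/= ji ltnSn eqxx/= addn1; exact.
Qed.

Lemma path_space_upto x : path_space g x <-> forall n, path_upto n x.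
Proof.
split => [[xc xe] n|h]; first by split => k _.
by split => n; [have [+ _] := h n; exact|have [_ +] := h n.+1; exact].
Qed.

Lemma path_space_gaps x : (forall k i, 0 <= incr x k i) ->
  path_space g x <-> forall i j b k, crossing i j b -> x (k + b)%N i <= x k j.
Proof.
move=> xi0; rewrite path_space_upto; split => [h i j b k c|h n].
  by have /(path_upto_gaps _ xi0) := h (k + b)%N; exact.
by apply/(path_upto_gaps _ xi0) => i j b k c _; exact: h.
Qed.

Lemma measurable_path_upto n : measurable (path_upto n).
Proof.
apply: measurable_and.
  apply: measurable_forall => k; apply: measurable_imp => _; apply: measurable_and.
    by apply: measurable_forall => i; apply: measurable_le => //; exact: measurable_coord.
  do 2 apply: measurable_forall => ?; apply: measurable_imp => _.
  by apply: measurable_le; exact: measurable_coord.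
apply: measurable_forall => k; apply: measurable_imp => _; rewrite /edge; case: g.
  apply: measurable_and.
    by apply: measurable_forall => i; apply: measurable_le; exact: measurable_coord.
  do 2 apply: measurable_forall => ?; apply: measurable_imp => _.
  by apply: measurable_le; exact: measurable_coord.
by apply: measurable_forall => i; apply: measurable_le; exact: measurable_coord.
Qed.

Lemma measurable_path_space : measurable (path_space g : set VS).
Proof.
rewrite (_ : path_space g = [set x : VS | forall n, path_upto n x]); last first.
  by apply/seteqP; split => x /path_space_upto.
by apply: measurable_forall => n; exact: measurable_path_upto.
Qed.

End gaps.

(** * Almost sure properties of Cesaro paths *)

Section generic_paths.
Context {R : realType} {d : nat} (p : 'I_d -> R).
Local Notation VS := (vector_seq R d).
Variable B : probability VS R.
Hypothesis d_gt0 : (0 < d)%N.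
Hypothesis p_gt0 : forall i, 0 < p i.
Hypothesis Bp : exponential_increments p B.
Implicit Types (x : VS).

Lemma cesaro_exists (q : 'I_d -> R) : (forall i, 0 < q i) ->
  exists B' : probability VS R, exponential_increments q B'.
Proof. by case: d d_gt0 q => // e _ q q0; exact: exponential_increments_exists. Qed.

Lemma ae_increasing : almost_surely B (fun x => forall k i, 0 < incr x k i).
Proof.
have H n : almost_surely B (fun x => increasing_upto n x).
  have mA := measurableC (@measurable_increasing_upto R d n).
  have := almost_surely_null mA (increasing_upto_ae p_gt0 Bp n).
  by apply: almost_surely_imp => x /contrapT.
apply: almost_surely_imp (almost_surely_forall_nat H) => x Hx k i.
by have := Hx k k (ltnSn k) i; rewrite /= in_itv/= andbT.
Qed.

(** Given all increments but that of the cell [c], the coordinate [c] has a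
    density, so it avoids any value determined by the other increments. *)
Lemma ae_neq (c : nat * 'I_d) (h : VS -> R) : measurable_fun setT h ->
  (forall x t, h (resample c x t) = h x) -> almost_surely B (fun x => x c.1 c.2 != h x).
Proof.
move=> mh hc; pose A := [set x : VS | x c.1 c.2 = h x].
have mA : measurable A.
  rewrite (_ : A = [set x : VS | x c.1 c.2 <= h x /\ h x <= x c.1 c.2]).
    have mc := @measurable_coord R d c.1 c.2.
    exact: (measurableI _ _ (measurable_le mc mh) (measurable_le mh mc)).
  apply/seteqP; split => x /=; rewrite /A/=; first by move=> ->.
  by move=> [h1 h2]; apply/eqP; rewrite eq_le h1 h2.
have A0 : B A = 0%E.
  rewrite -(setIT A) -integral_indic// (integral_resample p_gt0 Bp c); last 2 first.
  - by apply/measurable_EFinP; exact: measurable_indic.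
  - by move=> x; rewrite lee_fin.
  apply: integral0_eq => x _.
  rewrite -(@ge0_integral_ae_eq _ _ _ lebesgue_measure [set h x - previous x c] (cst 0%E)).
  - by rewrite integral0.
  - by [].
  - exact: lebesgue_measure_set1.
  - by [].
  - by move=> t; rewrite mule_ge0// lee_fin ?pdf_ge0.
  move=> t /= tx; rewrite indicE memNset ?mul0e//= => rA; apply: tx.
  by move: rA; rewrite /A/= hc resample_in => <-; rewrite addrAC subrr add0r.
by apply: almost_surely_imp (almost_surely_null mA A0) => x; apply: contra_notN => /eqP.
Qed.

Lemma ae_coord_neq_cst k i (a : R) : almost_surely B (fun x => x k i != a).
Proof. exact: (@ae_neq (k, i) (cst a)). Qed.

Lemma ae_coord_neq k i l j : i != j -> almost_surely B (fun x => x k i != x l j).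
Proof.
move=> ij; apply: (@ae_neq (k, i) (fun x => x l j)).
  exact: measurable_coord.
by move=> x t; rewrite resample_out//= eq_sym (negbTE ij).
Qed.

Lemma ae_eventually_lt i (a : R) : p i < a ->
  almost_surely B (fun x => \forall n \near \oo, x n i < a * n.+1%:R).
Proof.
move=> pa; have a0 := lt_trans (p_gt0 i) pa.
have [|B' HB'] := @cesaro_exists (with_frequency p i a).
  by move=> j; rewrite /with_frequency; case: eqP.
have := chernoff_ae p_gt0 Bp a0 HB'; rewrite gt_eqF// => /(_ isT).
apply: almost_surely_imp => x; apply: filterS => n.
by rewrite pmulr_rlt0 ?subr_lt0// subr_gt0 ltf_pV2 ?posrE.
Qed.

Lemma ae_eventually_gt i (a : R) : 0 < a -> a < p i ->
  almost_surely B (fun x => \forall n \near \oo, a * n.+1%:R < x n i).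
Proof.
move=> a0 pa.
have [|B' HB'] := @cesaro_exists (with_frequency p i a).
  by move=> j; rewrite /with_frequency; case: eqP.
have := chernoff_ae p_gt0 Bp a0 HB'; rewrite lt_eqF// => /(_ isT).
apply: almost_surely_imp => x; apply: filterS => n.
by rewrite nmulr_rlt0 ?subr_gt0// subr_lt0 ltf_pV2 ?posrE.
Qed.

(** Chernoff bounds on both sides, for a sequence of frequencies that tends to
    [p i]. *)
Lemma law_of_large_numbers :
  almost_surely B (fun x => forall i, x n i / n.+1%:R @[n --> \oo] --> p i).
Proof.
apply: almost_surely_forall => i.
have H m : almost_surely B (fun x => \forall n \near \oo,
    p i * (1 - m.+2%:R^-1) * n.+1%:R < x n i < p i * (1 + m.+2%:R^-1) * n.+1%:R).
  have m0 : 0 < m.+2%:R^-1 :> R by rewrite invr_gt0 ltr0n.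
  have m1 : m.+2%:R^-1 < 1 :> R by rewrite invf_lt1 ?ltr1n ?ltr0n.
  have := @ae_eventually_lt i (p i * (1 + m.+2%:R^-1)).
  rewrite ltr_pMr// ltrDl m0 => /(_ isT) H1.
  have := @ae_eventually_gt i (p i * (1 - m.+2%:R^-1)).
  rewrite mulr_gt0 ?subr_gt0// gtr_pMr// gtrBl m0 => /(_ isT isT) H2.
  have := almost_surely_and H2 H1; apply: almost_surely_imp => x [].
  by apply: filterS2 => n -> ->.
apply: almost_surely_imp (almost_surely_forall_nat H) => x Hx; apply/cvgrPdist_lt => eps eps0.
have [m Hm] : exists m : nat, p i * m.+2%:R^-1 < eps.
  exists (Num.truncn (eps^-1 * p i)); rewrite ltr_pdivrMr ?ltr0n// -ltr_pdivrMl//.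
  have pe : 0 <= eps^-1 * p i by rewrite mulr_ge0 ?invr_ge0 ?ltW.
  by have /andP[_ /lt_trans] := Num.Theory.truncn_itv pe; apply; rewrite ltr_nat.
apply: filterS (Hx m) => n /andP[h1 h2].
have n0 : 0 < n.+1%:R :> R by rewrite ltr0n.
have {}h1 : p i * (1 - m.+2%:R^-1) < x n i / n.+1%:R by rewrite ltr_pdivlMr.
have {}h2 : x n i / n.+1%:R < p i * (1 + m.+2%:R^-1) by rewrite ltr_pdivrMr.
have key (u y c : R) : p i - u < y -> y < p i + u -> u < c -> - c < p i - y < c.
  by move=> *; apply/andP; split; lra.
by rewrite ltr_norml; apply: key Hm; move: h1 h2; rewrite mulrBr mulrDr mulr1.
Qed.

End generic_paths.

Section eventual_gaps.
Context {R : realType} {d : nat} (p : 'I_d -> R) (g : branching_graph).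
Local Notation VS := (vector_seq R d).
Hypothesis p_gt0 : forall i, 0 < p i.
Hypothesis p_incr : forall i j : 'I_d, (i < j)%N -> p i < p j.
Variable x : VS.
Hypothesis x_lln : forall i, x n i / n.+1%:R @[n --> \oo] --> p i.

(** By the law of large numbers the lower row grows at a smaller rate; a shift by
    one level does not matter in the long run. *)
Lemma eventual_gap i j b : crossing g i j b -> exists c1 c2 : R,
  [/\ 0 < c1, c1 < c2 & \forall k \near \oo,
      x (k + nat_of_bool b)%N i <= c1 * k.+1%:R /\ c2 * k.+1%:R <= x k j].
Proof.
move=> /andP[ij _]; have pij := p_incr ij; have pi0 := p_gt0 i.
(* the rates [a < c1 < c2] divide the interval from [p i] to [p j] evenly; the
   room between [a] and [c1] absorbs the shift by one level *)
pose a := (3 * p i + p j) / 4; pose c1 := (p i + p j) / 2; pose c2 := (p i + 3 * p j) / 4.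
exists c1, c2; split; [rewrite /c1; lra|rewrite /c1 /c2; lra|].
have lo : \forall k \near \oo, c2 * k.+1%:R <= x k j.
  have c2j : c2 < p j by rewrite /c2; lra.
  have H : \forall k \near \oo, c2 <= x k j / k.+1%:R.
    exact: (cvgr_ge _ (@x_lln j) c2 c2j).
  by apply: (filterS _ H) => k; rewrite ler_pdivlMr ?ltr0n.
have : \forall k \near \oo, x k i <= a * k.+1%:R.
  have ai : p i < a by rewrite /a; lra.
  have H : \forall k \near \oo, x k i / k.+1%:R <= a.
    exact: (cvgr_le _ (@x_lln i) a ai).
  by apply: (filterS _ H) => k; rewrite ler_pdivrMr ?ltr0n.
move=> [N _ HN]; apply: filterS2 lo _ => [k klo khi|]; first by split; [exact: khi|].
exists (maxn N (Num.truncn (a / (c1 - a))).+1) => // k /=; rewrite geq_max => /andP[Nk ak].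
apply: le_trans (HN (k + b)%N _) _; first by rewrite /= (leq_trans Nk)// leq_addr.
have ca : 0 < c1 - a by rewrite /c1 /a; lra.
have a0 : 0 < a by rewrite /a; lra.
have : a / (c1 - a) < k.+1%:R.
  have /andP[_ /lt_le_trans] := Num.Theory.truncn_itv (ltW (divr_gt0 a0 ca)); apply.
  by rewrite ler_nat (leq_trans ak).
rewrite ltr_pdivrMr// => h.
have : (k + b).+1%:R <= k.+1%:R + 1 :> R by rewrite natr1 ler_nat -addnS -[k.+2]addn2 leq_add2l; case: b.
by move=> /(ler_wpM2l (ltW a0)); rewrite mulrDr mulr1 => /le_trans; apply; lra.
Qed.

End eventual_gaps.

(** * Positivity of the path space, and limits of bridges *)

Section positivity.
Context {R : realType} {d : nat} (p : 'I_d -> R) (g : branching_graph).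
Local Notation VS := (vector_seq R d).
Variable B : probability VS R.
Hypothesis d_gt0 : (0 < d)%N.
Hypothesis p_gt0 : forall i, 0 < p i.
Hypothesis p_incr : forall i j : 'I_d, (i < j)%N -> p i < p j.
Hypothesis Bp : exponential_increments p B.

Definition gap_bound (C : R) (x : VS) := forall i j b k, crossing g i j b ->
  x (k + nat_of_bool b)%N i - x 0%N i <= x k j - x 0%N j + C.

(** All but finitely many of the inequalities hold by [eventual_gap]. *)
Lemma gap_bound_exists (x : VS) :
  (forall i, x n i / n.+1%:R @[n --> \oo] --> p i) -> exists C : nat, gap_bound C%:R x.
Proof.
move=> xl.
pose u (t : 'I_d * 'I_d * bool) k :=
  x (k + nat_of_bool t.2)%N t.1.1 - x 0%N t.1.1 - (x k t.1.2 - x 0%N t.1.2).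
have H t : exists M : R, 0 <= M /\ (crossing g t.1.1 t.1.2 t.2 -> forall k, u t k <= M).
  case: t => -[i j] b /=; have [c|] := boolP (crossing g i j b); last by exists 0.
  have [c1 [c2 [c10 c12 [K _ HK]]]] := eventual_gap p_gt0 p_incr xl c.
  exists (`|x 0%N j| + `|x 0%N i| + \sum_(k < K) `|u (i, j, b) k|); split.
    by rewrite !addr_ge0// sumr_ge0.
  move=> _ k; have [kK|Kk] := ltnP k K.
    rewrite (bigD1 (Ordinal kK))//= addrCA; apply: le_trans (ler_norm _) _.
    by rewrite lerDl !addr_ge0// sumr_ge0.
  have [h1 h2] := HK k Kk.
  have hh : x (k + b)%N i <= x k j.
    by apply: le_trans h1 (le_trans _ h2); rewrite ler_wpM2r// ltW.
  have s0 : 0 <= \sum_(k < K) `|u (i, j, b) k| by rewrite sumr_ge0.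
  rewrite /u/=; have := ler_norm (x 0%N j); have := lerNnormlW (lexx `|x 0%N i|).
  by lra.
have [M HM] := choice H.
have M0 t : 0 <= M t by have [] := HM t.
exists (Num.truncn (\sum_t M t)).+1 => i j b k c.
have [_ /(_ c k)] := HM (i, j, b); rewrite /u/= => h.
have MS : M (i, j, b) <= \sum_t M t.
  by rewrite (bigD1 (i, j, b))//= lerDl sumr_ge0.
have S0 : 0 <= \sum_t M t by rewrite sumr_ge0.
have /andP[_ h2] := Num.Theory.truncn_itv S0.
by lra.
Qed.

Lemma measurable_gap_bound C : measurable (gap_bound C : set VS).
Proof.
do 4 apply: measurable_forall => ?; apply: measurable_imp => _; apply: measurable_le.
  by apply: measurable_funB; exact: measurable_coord.
by apply: measurable_funD => //; apply: measurable_funB; exact: measurable_coord.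
Qed.

Lemma prode_gt0 (I : Type) (s : seq I) (F : I -> \bar R) :
  (forall i, 0 < F i)%E -> (0 < \prod_(i <- s) F i)%E.
Proof. by move=> F0; elim/big_rec : _ => // i y _ y0; exact: mule_gt0. Qed.

(** With positive probability the coordinates, started at [0], never violate
    the constraints by more than a constant [C]; independently of this, the
    initial vertex is spread out by more than [C] with positive probability. *)
Lemma path_space_gt0 : (0 < B (path_space g))%E.
Proof.
have aslln := law_of_large_numbers d_gt0 p_gt0 Bp.
have [N [mN N0 HN]] := almost_surely_and aslln (ae_increasing p_gt0 Bp).
have [C BC] : exists C : nat, (0 < B (gap_bound C%:R `\` N))%E.
  apply: contrapT => /forallNP h.
  have : B (\bigcup_C (gap_bound C%:R `\` N)) = 0%E.
    apply/negligibleP; first by apply: bigcupT_measurable => C; apply: measurableD => //; exact: measurable_gap_bound.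
    apply: negligible_bigcup => C; apply/negligibleP.
      by apply: measurableD => //; exact: measurable_gap_bound.
    by apply/eqP; rewrite eq_le measure_ge0 andbT leNgt; apply/negP/h.
  have -> : \bigcup_C (gap_bound C%:R `\` N) = ~` N.
    apply/seteqP; split => x; first by move=> [C _ []].
    move=> /= Nx; have [/gap_bound_exists[C HC] _] := HN _ Nx.
    by exists C.
  by rewrite probability_setC// N0 sube0 => /eqP; rewrite onee_eq0.
(* boxes of length [1] at distance [C] from each other *)
pose box (k : nat) (i : 'I_d) : set R :=
  `](C.+1 * i)%N%:R, (C.+1 * i)%N%:R + 1]%classic.
pose A2 := rect (fun k i (x : VS) => incr x k i) 1 box.
have mA2 : measurable A2.
  by apply: measurable_rect => k i; [exact: measurable_incr|exact: measurable_itv].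
have BA2 : (0 < B A2)%E.
  rewrite Bp; last by move=> k i; exact: measurable_itv.
  apply: prode_gt0 => k; apply: prode_gt0 => i.
  by apply: exponential_prob_itv_gt0; rewrite ?invr_gt0 ?ler0n// ltrDl.
have mA1 : measurable (gap_bound C%:R `\` N).
  by apply: measurableD => //; exact: measurable_gap_bound.
have mG := @measurable_path_space R d g.
pose D (k : nat) (i : 'I_d) := k == 0%N.
rewrite (mix_law p_gt0 Bp D)//; apply: (@lt_le_trans _ _ ((B \x B)%E ((gap_bound C%:R `\` N) `*` A2))).
  by rewrite product_measure1E// mule_gt0.
apply: le_measure; rewrite ?inE.
- exact: measurableX.
- by rewrite -[X in measurable X]setTI; exact: measurable_mix.
move=> [x w] /= [[Cx Nx] Aw]; have [_ x0] := HN _ Nx.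
have yE k i : mix D x w k i = x k i - x 0%N i + w 0%N i.
  rewrite /mix big_ord_recl/= addrC; congr (_ + _).
  by rewrite -[in RHS](sum_incr x k) big_ord_recl/= addrAC subrr add0r.
have wb (i : 'I_d) : (C.+1 * i)%N%:R < w 0%N i <= (C.+1 * i)%N%:R + 1.
  by have := Aw 0%N isT i; rewrite /box/= in_itv.
apply/path_space_gaps => [k i|i j b k c].
  rewrite incr_mix /D; case: eqP => [->|_]; last exact: ltW.
  by have /andP[/ltW + _] := wb i; apply: le_trans.
rewrite !yE; have := Cx i j b k c.
have /andP[_ w1] := wb i; have /andP[w2 _] := wb j.
have ij : (C.+1 * i)%N%:R + C.+1%:R <= (C.+1 * j)%N%:R :> R.
  by rewrite -natrD ler_nat addnC -mulnS leq_mul2l/=; move: c => /andP[].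
by move: ij; rewrite -[C.+1%:R]natr1; lra.
Qed.

End positivity.

Section bridge_limit.
Context {R : realType} {d : nat} (p : 'I_d -> R) (g : branching_graph).
Local Notation VS := (vector_seq R d).
Hypothesis p_gt0 : forall i, 0 < p i.
Hypothesis p_incr : forall i j : 'I_d, (i < j)%N -> p i < p j.
Variables (x : VS) (N : nat -> nat) (v : nat -> 'I_d -> R).
Hypothesis x_lln : forall i, x n i / n.+1%:R @[n --> \oo] --> p i.
Hypothesis x_inc : forall k i, 0 < incr x k i.
Hypothesis x_neq : forall k l (i j : 'I_d), i != j -> x k i != x l j.
Hypothesis N_incr : forall m n : nat, (m < n)%N -> (N m < N n)%N.
Hypothesis v_freq : forall i, v m i / (N m)%:R @[m --> \oo] --> p i.

Let Y m : VS := bridge (N m) (fun _ => v m) x.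
Let r m i := v m i / x (N m) i.

Let YE m k i : Y m k i = r m i * x k i.
Proof. by rewrite /Y /bridge /r mulrAC mulrA. Qed.

Let N_ge m : (m <= N m)%N.
Proof. by elim: m => // m IH; apply: leq_ltn_trans IH (N_incr (ltnSn m)). Qed.

Let N_oo : N m @[m --> \oo] --> \oo.
Proof. by move=> A [n _ An]; exists n => // m /= nm; apply: An; exact: leq_trans (N_ge m). Qed.

Let x_gt0 k i : 0 < x k i.
Proof.
rewrite -sum_incr big_ord_recl ltr_wpDr//; apply: sumr_ge0 => j _; exact: ltW.
Qed.

Let r_cvg i : r m i @[m --> \oo] --> (1 : R).
Proof.
have h1 : x (N m) i / (N m).+1%:R @[m --> \oo] --> p i.
  exact: (cvg_comp _ _ N_oo (@x_lln i)).
have h2 : (N m)%:R / (N m).+1%:R @[m --> \oo] --> (1 : R).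
  have h : (1 - (n.+1%:R)^-1 : R) @[n --> \oo] --> (1 - 0 : R).
    by apply: cvgB; [exact: cvg_cst|exact: cvg_harmonic].
  have -> : (fun m => (N m)%:R / (N m).+1%:R) = (fun m => 1 - (N m).+1%:R^-1 : R).
    apply/funext => m /=.
    by rewrite -[(N m)%:R](addrK 1) natr1 mulrBl mulfV ?pnatr_eq0// mul1r.
  by rewrite subr0 in h; exact: (cvg_comp _ _ N_oo h).
have h3 : (v m i / (N m)%:R) * ((N m)%:R / (N m).+1%:R) * (x (N m) i / (N m).+1%:R)^-1
    @[m --> \oo] --> p i * 1 * (p i)^-1.
  by apply: cvgM; [apply: cvgM; [exact: v_freq|exact: h2]|apply: cvgV; rewrite ?gt_eqF].
rewrite mulr1 mulfV ?gt_eqF// in h3.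
apply: cvg_trans h3; apply: near_eq_cvg; exists 1%N => // m /= m1.
have Nm : (N m)%:R != 0 :> R by rewrite pnatr_eq0 -lt0n (leq_trans m1 (N_ge m)).
by rewrite /r; field; rewrite Nm gt_eqF ?x_gt0//= nat1r pnatr_eq0.
Qed.

Lemma bridge_cvg k i : (Y m k i : R) @[m --> \oo] --> (x k i : R).
Proof.
have -> : (fun m => Y m k i : R) = (fun m => r m i * x k i) by apply/funext => m; exact: YE.
have h : (r m i * x k i) @[m --> \oo] --> (1 * x k i : R).
  by apply: cvgM; [exact: r_cvg|exact: cvg_cst].
by rewrite mul1r in h; exact: h.
Qed.

Let eventually_crossing i j b : crossing g i j b ->
  \forall m \near \oo, forall k,
    (Y m (k + nat_of_bool b)%N i <= Y m k j) = (x (k + nat_of_bool b)%N i <= x k j).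
Proof.
move=> c; have [c1 [c2 [c10 c12 [K _ HK]]]] := eventual_gap p_gt0 p_incr x_lln c.
have ij : i != j by apply: contraTneq c => ->; rewrite /crossing ltnn.
have small : \forall m \near \oo, forall k : 'I_K,
    (Y m (k + nat_of_bool b)%N i <= Y m k j) = (x (k + nat_of_bool b)%N i <= x k j).
  apply: filter_forall => k.
  have := x_neq (k + b)%N k ij; rewrite neq_lt => /orP[lt|lt].
    have : Y m k j - Y m (k + b)%N i @[m --> \oo] --> x k j - x (k + b)%N i.
      by apply: cvgB; exact: bridge_cvg.
    move=> H; have H0 : 0 < x k j - x (k + b)%N i by rewrite subr_gt0.
    have K0 : \forall m \near \oo, 0 < Y m k j - Y m (k + b)%N i by exact: (cvgr_gt _ H 0 H0).
    by apply: filterS K0 => m; rewrite subr_gt0 => /ltW ->; rewrite (ltW lt).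
  have : Y m (k + b)%N i - Y m k j @[m --> \oo] --> x (k + b)%N i - x k j.
    by apply: cvgB; exact: bridge_cvg.
  move=> H; have H0 : 0 < x (k + b)%N i - x k j by rewrite subr_gt0.
  have K0 : \forall m \near \oo, 0 < Y m (k + b)%N i - Y m k j by exact: (cvgr_gt _ H 0 H0).
  by apply: filterS K0 => m; rewrite subr_gt0 => Yl; rewrite !leNgt Yl lt.
have ri : \forall m \near \oo, 0 < r m i by exact: (cvgr_gt _ (@r_cvg i) 0 ltr01).
have rj : \forall m \near \oo, 0 < r m j by exact: (cvgr_gt _ (@r_cvg j) 0 ltr01).
have rc : \forall m \near \oo, 0 < r m j * c2 - r m i * c1.
  have H : r m j * c2 - r m i * c1 @[m --> \oo] --> 1 * c2 - 1 * c1.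
    by apply: cvgB; apply: cvgM; [exact: r_cvg|exact: cvg_cst|exact: r_cvg|exact: cvg_cst].
  by apply: (cvgr_gt _ H 0); rewrite !mul1r subr_gt0.
near=> m => k; have [kK|Kk] := ltnP k K.
  by have := near small m => /(_ ltac:(by []) (Ordinal kK)).
have [h1 h2] := HK k Kk.
have ri0 : 0 < r m i by near: m.
have rj0 : 0 < r m j by near: m.
have rc0 : 0 < r m j * c2 - r m i * c1 by near: m.
have -> : x (k + b)%N i <= x k j.
  by apply: le_trans h1 (le_trans _ h2); rewrite ler_wpM2r// ltW.
rewrite !YE; apply: (@le_trans _ _ (r m i * (c1 * k.+1%:R))); first by rewrite ler_pM2l.
apply: (@le_trans _ _ (r m j * (c2 * k.+1%:R))); last by rewrite ler_pM2l.
by rewrite !mulrA ler_wpM2r// ltW// -subr_gt0.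
Unshelve. all: by end_near. Qed.

(** Only finitely many of the constraints are close to being violated, and none
    of them is an equality; hence the rescaled path satisfies its constraints if
    and only if the limit path does. *)
Lemma bridge_path_upto :
  \forall m \near \oo, path_upto g (N m) (Y m) <-> path_space g x.
Proof.
have ev : \forall m \near \oo, forall t : 'I_d * 'I_d * bool,
    crossing g t.1.1 t.1.2 t.2 -> forall k,
    (Y m (k + nat_of_bool t.2)%N t.1.1 <= Y m k t.1.2) = (x (k + nat_of_bool t.2)%N t.1.1 <= x k t.1.2).
  apply: filter_forall => -[[i j] b] /=.
  have [c|_] := boolP (crossing g i j b); last by apply: nearW.
  by apply: filterS (eventually_crossing c).
have rpos : \forall m \near \oo, forall i, 0 < r m i.
  by apply: filter_forall => i; exact: (cvgr_gt _ (@r_cvg i) 0 ltr01).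
have Yinc m : (forall i, 0 < r m i) -> forall k i, 0 <= incr (Y m) k i.
  move=> rm [|k] i; rewrite /incr/= !YE; first by rewrite mulr_ge0// ltW.
  by rewrite -mulrBr mulr_ge0 ?ltW//; have := x_inc k.+1 i.
have x_inc0 k i : 0 <= incr x k i by exact: ltW.
have [gx|gx] := pselect (path_space g x).
  apply: filterS2 ev rpos => m em rm; split => // _.
  apply/(path_upto_gaps _ _ (Yinc m rm)) => i j b k c _.
  by rewrite (em (i, j, b) c); have /(path_space_gaps _ x_inc0) := gx; exact.
have [i [j [b [k [c xk]]]]] : exists i j b k, crossing g i j b /\ ~~ (x (k + nat_of_bool b)%N i <= x k j).
  apply: contrapT => h; apply: gx; apply/(path_space_gaps _ x_inc0) => i j b k c.
  by apply: contrapT => /negP xk; apply: h; exists i, j, b, k.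
have big : \forall m \near \oo, (k + nat_of_bool b <= N m)%N.
  by exists (k + nat_of_bool b)%N => // m /= km; exact: leq_trans (N_ge m).
near=> m; have em : forall t : 'I_d * 'I_d * bool,
    crossing g t.1.1 t.1.2 t.2 -> forall k,
    (Y m (k + nat_of_bool t.2)%N t.1.1 <= Y m k t.1.2) = (x (k + nat_of_bool t.2)%N t.1.1 <= x k t.1.2) by near: m.
have rm : forall i, 0 < r m i by near: m.
have bm : (k + nat_of_bool b <= N m)%N by near: m.
split => // /(path_upto_gaps _ _ (Yinc m rm)) /(_ i j b k c bm).
by rewrite (em (i, j, b) c) (negbTE xk).
Unshelve. all: by end_near. Qed.

End bridge_limit.

(** * Conditioned bridges *)

Section probability_lemmas.
Context dT (T : measurableType dT) (R : realType).
Variable P : probability T R.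
Implicit Types f : T -> R.

Lemma probability_integral_cst (c : R) : (\int[P]_x c%:E = c%:E)%E.
Proof. by rewrite integral_cst// [X in (_ * X)%E](@probability_setT _ _ _ P) mule1. Qed.

Lemma bounded_integral f M : measurable_fun setT f ->
  (forall x, 0 <= f x <= M) ->
  (\int[P]_x (f x)%:E = (fine (\int[P]_x (f x)%:E))%:E)%E.
Proof.
move=> mf fM; rewrite fineK// ge0_fin_numE; last first.
  by apply: integral_ge0 => x _; rewrite lee_fin; have /andP[] := fM x.
apply: (@le_lt_trans _ _ (\int[P]_x M%:E)%E); last by rewrite probability_integral_cst ltry.
apply: ge0_le_integral => //.
- by move=> x _; rewrite lee_fin; have /andP[] := fM x.
- exact/measurable_EFinP.
- by move=> x _; rewrite lee_fin; have /andP[] := fM x.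
Qed.

Lemma bounded_convergence (f_ : nat -> T -> R) f M :
  (forall n, measurable_fun setT (f_ n)) -> measurable_fun setT f ->
  (forall n x, 0 <= f_ n x <= M) ->
  almost_surely P (fun x => f_ n x @[n --> \oo] --> f x) ->
  (\int[P]_x (f_ n x)%:E @[n --> \oo] --> \int[P]_x (f x)%:E)%E.
Proof.
move=> mf_ mf fM [N [mN N0 HN]].
have [|||||//] := @dominated_convergence _ _ _ P setT measurableT
  (fun n x => (f_ n x)%:E) (EFin \o f) (cst M%:E).
- by move=> n; exact/measurable_EFinP.
- exact/measurable_EFinP.
- exists N; split => // x /= /not_implyP[_ fx]; apply: contrapT => /HN xf; apply: fx.
  by apply: cvg_EFin => //; exact: nearW.
- exact: finite_measure_integrable_cst.
- apply: aeW => x n _ /=; rewrite lee_fin ger0_norm; by have /andP[] := fM n x.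
Qed.

Lemma conditional_exists (G : set T) : measurable G -> (0 < P G)%E ->
  exists Q : probability T R, forall A, measurable A -> Q A = (P (A `&` G) / P G)%E.
Proof.
move=> mG G0; exists (mnormalize (mrestr P mG) P) => A mA.
transitivity (mnormalize (mrestr P mG) P A) => //.
have PT : mrestr P mG setT = P G by rewrite /mrestr setTI.
have Poo : (P G == +oo)%E = false.
  by rewrite lt_eqF// (le_lt_trans (probability_le1 P mG)) ?ltry.
rewrite /mnormalize; case: ifPn => [|_].
  by move=> /orP[|] /eqP E; have := etrans (esym PT) E => /eqP; rewrite ?Poo// gt_eqF.
rewrite -[X in (fine X)^-1]/(mrestr P mG setT) PT -[X in (X * _)%E]/(P (A `&` G)).
have : (P G <= 1)%E by exact: probability_le1.
case: (P G) G0 => [r| |]//=; rewrite lte_fin => r0 _.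
by rewrite inver gt_eqF.
Qed.

Lemma integral_conditional (G : set T) (Q : {measure set T -> \bar R}) (f : T -> \bar R) :
  measurable G -> (0 < P G)%E ->
  (forall A, measurable A -> Q A = (P (A `&` G) / P G)%E) ->
  measurable_fun setT f -> (forall x, 0 <= f x)%E ->
  (\int[Q]_x f x = (\int[P]_x (f x * (\1_G x)%:E)) / P G)%E.
Proof.
move=> mG G0 QP mf f0; have PG : P G \is a fin_num by exact: fin_num_measure.
pose c := fine (P G); have PGE : P G = c%:E by rewrite fineK.
have c0 : 0 < c by rewrite -lte_fin -PGE.
have cV : ((P G)^-1 = (c^-1)%:E)%E by rewrite PGE inver gt_eqF.
have m1 : measurable_fun setT (\1_G : T -> R) by exact: measurable_indic.
rewrite (@ge0_integral_density _ _ _ P Q (fun x => \1_G x * c^-1) f)//.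
- under eq_integral do rewrite EFinM muleA.
  rewrite ge0_integralZr//.
  + by rewrite cV.
  + by apply: emeasurable_funM => //; exact/measurable_EFinP.
  + by move=> x _; rewrite mule_ge0// lee_fin.
  + by rewrite lee_fin invr_ge0 ltW.
- exact: measurable_funM.
- by move=> x; rewrite mulr_ge0// ?invr_ge0 ?ltW.
- move=> A mA; rewrite QP// cV.
  under eq_integral do rewrite EFinM.
  rewrite ge0_integralZr//.
  + by rewrite integral_indic// setIC.
  + by apply/measurable_EFinP; exact: measurable_funTS.
  + by rewrite lee_fin invr_ge0 ltW.
Qed.

End probability_lemmas.

Section conditional_bridge.
Context {R : realType} {d : nat} (g : branching_graph).
Local Notation VS := (vector_seq R d).
Variable B : probability VS R.
Implicit Types (h : VS -> R) (z : VS).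

Definition graph_bridge_mean n h z : R :=
  fine (bridge_mean B n (fun x => (h x * \1_(path_upto g n) x)%:E) z).

(** The mean of [h] under the bridge to the vertex of [z] at level [n],
    conditioned to be a path of the graph up to that level. *)
Definition conditional_bridge_mean n h z : R :=
  graph_bridge_mean n h z / graph_bridge_mean n (cst 1) z.

(** Continuity at almost every path, with respect to convergence of all
    coordinates; it holds for indicators of sets with a null boundary. *)
Definition ae_continuous h := almost_surely B (fun x => forall y : nat -> VS,
  (forall k i, (y m k i : R) @[m --> \oo] --> (x k i : R)) ->
  h (y m) @[m --> \oo] --> h x).

Lemma ae_continuous_cst (c : R) : ae_continuous (cst c).
Proof. by exists set0; split => // x _ y _; exact: cvg_cst. Qed.

Lemma indic_bound h M : (forall x, 0 <= h x <= M) -> forall (A : set VS) x,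
  0 <= h x * \1_A x <= M.
Proof.
move=> hM A x; have /andP[h0 h1] := hM x; rewrite indicE; case: (_ \in _).
  by rewrite mulr1 h0.
by rewrite mulr0 lexx (le_trans h0).
Qed.

Lemma measurable_mul_indic h (A : set VS) : measurable_fun setT h -> measurable A ->
  measurable_fun setT (fun x => h x * \1_A x).
Proof. by move=> mh mA; apply: measurable_funM => //; exact: measurable_indic. Qed.

Lemma measurable_bridge_to n z : measurable_fun setT (bridge n z : VS -> VS).
Proof. exact: (measurableT_comp (@measurable_bridge R d n) (measurable_pair1 z)). Qed.

Lemma graph_bridge_meanE n h M z : measurable_fun setT h -> (forall x, 0 <= h x <= M) ->
  bridge_mean B n (fun x => (h x * \1_(path_upto g n) x)%:E) z = (graph_bridge_mean n h z)%:E.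
Proof.
move=> mh hM; rewrite /graph_bridge_mean.
apply: (@bounded_integral _ _ _ B (fun w => h (bridge n z w) * \1_(path_upto g n) (bridge n z w)) M).
  have mY := measurable_bridge_to n z.
  exact: (measurableT_comp (measurable_mul_indic mh (measurable_path_upto g n)) mY).
by move=> w; exact: indic_bound.
Qed.

Lemma graph_bridge_mean_le n h z : measurable_fun setT h -> (forall x, 0 <= h x <= 1) ->
  0 <= graph_bridge_mean n h z <= graph_bridge_mean n (cst 1) z.
Proof.
move=> mh h1; have c1 (x : VS) : 0 <= cst (1 : R) x <= 1 by rewrite /= ler01 lexx.
have mc : measurable_fun setT (cst (1 : R) : VS -> R) by exact: measurable_cst.
have mY := measurable_bridge_to n z.
rewrite -!lee_fin -(graph_bridge_meanE _ _ mh h1) -(graph_bridge_meanE _ _ mc c1).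
have pos x : 0 <= h x * \1_(path_upto g n) x by have /andP[] := indic_bound h1 (path_upto g n) x.
apply/andP; split; first by apply: integral_ge0 => x _; rewrite lee_fin.
apply: ge0_le_integral => //.
- by move=> w _; rewrite lee_fin.
- apply/measurable_EFinP.
  exact: (measurableT_comp (measurable_mul_indic mh (measurable_path_upto g n)) mY).
- apply/measurable_EFinP.
  exact: (measurableT_comp (measurable_mul_indic mc (measurable_path_upto g n)) mY).
- by move=> w _; rewrite lee_fin ler_wpM2r//; have /andP[] := h1 (bridge n z w).
Qed.

Variable (p : 'I_d -> R).
Hypothesis d_gt0 : (0 < d)%N.
Hypothesis p_gt0 : forall i, 0 < p i.
Hypothesis p_incr : forall i j : 'I_d, (i < j)%N -> p i < p j.
Hypothesis Bp : exponential_increments p B.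
Variables (N : nat -> nat) (v : nat -> 'I_d -> R).
Hypothesis N_incr : forall m n : nat, (m < n)%N -> (N m < N n)%N.
Hypothesis v_freq : forall i, v m i / (N m)%:R @[m --> \oo] --> p i.

(** Dominated convergence: almost surely the bridges converge in every coordinate
    and eventually obey the inequalities if and only if their limit does. *)
Lemma graph_bridge_mean_cvg h M : measurable_fun setT h -> (forall x, 0 <= h x <= M) ->
  ae_continuous h ->
  graph_bridge_mean (N m) h (fun=> v m) @[m --> \oo] -->
  fine (\int[B]_x (h x * \1_(path_space g) x)%:E)%E.
Proof.
move=> mh hM hc; have mG := @measurable_path_space R d g.
apply: fine_cvg; rewrite -(@bounded_integral _ _ _ B (fun x => h x * \1_(path_space g) x) M); last 2 first.
- exact: measurable_mul_indic.
- by move=> x; exact: indic_bound.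
apply: (@bounded_convergence _ _ _ B (fun m w => h (bridge (N m) (fun=> v m) w) *
  \1_(path_upto g (N m)) (bridge (N m) (fun=> v m) w)) _ M).
- move=> m.
  have mY := measurable_bridge_to (N m) (fun=> v m).
  exact: (measurableT_comp (measurable_mul_indic mh (measurable_path_upto g (N m))) mY).
- exact: measurable_mul_indic.
- by move=> m x; exact: indic_bound.
have neq : almost_surely B (fun x => forall k l (i j : 'I_d), i != j -> x k i != x l j).
  apply: almost_surely_forall => k; apply: almost_surely_forall => l.
  apply: almost_surely_forall => i; apply: almost_surely_forall => j.
  have [->|ij] := eqVneq i j; first by exists set0; split.
  by apply: almost_surely_imp (ae_coord_neq p_gt0 Bp k l ij).
have := almost_surely_and (almost_surely_and hc neq)
  (almost_surely_and (law_of_large_numbers d_gt0 p_gt0 Bp) (ae_increasing p_gt0 Bp)).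
apply: almost_surely_imp => x [[xc xneq] [xlln xinc]].
have h1 := xc _ (bridge_cvg p_gt0 xlln xinc N_incr v_freq).
have h2 := bridge_path_upto g p_gt0 p_incr xlln xinc xneq N_incr v_freq.
apply: cvgM => //; apply: cvg_near_cst; apply: filterS h2 => m hm.
by rewrite !indicE; congr (_ %:R); congr nat_of_bool; apply/idP/idP; rewrite !inE => /hm.
Qed.

Lemma conditional_bridge_mean_cvg (mu : {measure set VS -> \bar R}) h M :
  (forall A, measurable A -> mu A = (B (A `&` path_space g) / B (path_space g))%E) ->
  measurable_fun setT h -> (forall x, 0 <= h x <= M) -> ae_continuous h ->
  (conditional_bridge_mean (N m) h (fun=> v m))%:E @[m --> \oo] -->
  (\int[mu]_x (h x)%:E)%E.
Proof.
move=> muE mh hM hc; have mG := @measurable_path_space R d g.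
have G0 := path_space_gt0 g d_gt0 p_gt0 p_incr Bp.
rewrite (integral_conditional mG G0 muE)//; last 2 first.
- exact/measurable_EFinP.
- by move=> x; rewrite lee_fin; have /andP[] := hM x.
under [X in _ --> (X / _)%E]eq_integral do rewrite -EFinM.
rewrite (@bounded_integral _ _ _ B (fun x => h x * \1_(path_space g) x) M); last 2 first.
- exact: measurable_mul_indic.
- by move=> x; exact: indic_bound.
have c1 (x : VS) : 0 <= cst (1 : R) x <= 1 by rewrite /= ler01 lexx.
have mc : measurable_fun setT (cst (1 : R) : VS -> R) by exact: measurable_cst.
have BE : B (path_space g) = (fine (\int[B]_x (cst 1 x * \1_(path_space g) x)%:E)%E)%:E.
  rewrite -(@bounded_integral _ _ _ B (fun x => cst 1 x * \1_(path_space g) x) 1).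
  - by under eq_integral do rewrite mul1r; rewrite integral_indic// setIT.
  - exact: measurable_mul_indic.
  - by move=> x; exact: indic_bound.
rewrite BE lte_fin in G0 *; rewrite inver gt_eqF// -EFinM.
apply: cvg_EFin; first exact: nearW.
apply: cvgM; first exact: graph_bridge_mean_cvg hM hc.
apply: cvgV; first by rewrite gt_eqF.
exact: graph_bridge_mean_cvg c1 (ae_continuous_cst 1).
Qed.

End conditional_bridge.

(** * Lebesgue measure on the polytope of finite paths *)

Section vertices.
Context {R : realType} {d : nat} (g : branching_graph).
Local Notation VS := (vector_seq R d).
Implicit Types v : 'I_d -> R.

Definition interior_vertex v :=
  (forall i, 0 < v i) /\ (forall i j : 'I_d, (i < j)%N -> v i < v j).

(** A path obeys the inequalities between different rows as soon as each row [i]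
    stays between [row_floor v i] and [v i]. *)
Definition row_floor v (i : 'I_d) : R := \big[Order.max/0]_(j < d | (j < i)%N) v j.

Lemma row_floor_ge0 v i : 0 <= row_floor v i.
Proof. exact: bigmax_ge_id. Qed.

Lemma row_floor_lt v i : interior_vertex v -> row_floor v i < v i.
Proof. by move=> [v0 vi]; apply: bigmax_lt => // j ji; exact: vi. Qed.

Lemma row_floor_above v (i j : 'I_d) : (i < j)%N -> v i <= row_floor v j.
Proof. by move=> ij; exact: (le_bigmax_cond 0 (P := fun i : 'I_d => (i < j)%N)). Qed.

(** Arrays whose rows move inside disjoint intervals satisfy every inequality
    between different rows. *)
Lemma separated_finite_path n v (y : 'I_n.+1 -> 'I_d -> R) :
  (forall k i, row_floor v i <= y k i <= v i) ->
  (forall (k l : 'I_n.+1) i, (k <= l)%N -> y k i <= y l i) ->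
  y ord_max = v -> finite_paths g v y.
Proof.
move=> yv ymon yn; have ylt k l (i j : 'I_d) : (i < j)%N -> y k i <= y l j.
  move=> ij; have /andP[_ h1] := yv k i; have /andP[h2 _] := yv l j.
  by apply: le_trans h1 (le_trans (row_floor_above _ ij) h2).
split=> [k|k l lk|//].
  split=> [i|i j]; first by have /andP[+ _] := yv k i; apply: le_trans; exact: row_floor_ge0.
  by rewrite leq_eqVlt => /predU1P[/val_inj ->//|]; exact: ylt.
have kl i : y k i <= y l i by apply: ymon; rewrite lk.
rewrite /edge; case: g => //; split=> // i j ji.
by apply: ylt; rewrite ji.
Qed.

Lemma path_upto_nondecreasing n (x : VS) : path_upto g n x -> nondecreasing_upto n x.
Proof.
move=> [xc xe] [|k] kn i; first by have [+ _] := xc 0%N kn; exact.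
rewrite /incr /= subr_ge0; have := xe k kn; rewrite /edge.
by case: g => [[+ _]|]; exact.
Qed.

Lemma depends_below_segment n (A : set (segments R d n)) : depends_below n.+1
  (fun x : VS => (\1_(initial_segment n @^-1` A) x * \1_(path_upto g n) x)%:E : \bar R).
Proof.
move=> x y xy; have {}xy k : (k <= n)%N -> x k = y k.
  by move=> kn; apply/funext => i; exact: xy.
have segE : initial_segment n x = initial_segment n y.
  by apply/funext => k; rewrite /initial_segment xy// -ltnS.
have gE : path_upto g n x = path_upto g n y.
  apply/propext; split => -[h1 h2]; split => k kn.
  - by rewrite -xy//; exact: h1.
  - by rewrite -!xy//; [exact: h2|exact: ltnW].
  - by rewrite xy//; exact: h1.
  - by rewrite !xy//; [exact: h2|exact: ltnW].
have -> : \1_(initial_segment n @^-1` A) x = \1_(initial_segment n @^-1` A) y :> R.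
  by rewrite !indicE; congr ((nat_of_bool _)%:R); apply/idP/idP; rewrite !inE /= segE.
have -> // : \1_(path_upto g n) x = \1_(path_upto g n) y :> R.
by rewrite !indicE; congr ((nat_of_bool _)%:R); apply/idP/idP; rewrite !inE gE.
Qed.

Section hull.
Variables (n : nat) (v : 'I_d -> R).
Hypothesis v_int : interior_vertex v.
Local Notation cell := ('I_n.+1 * 'I_d)%type.

Definition flatten_segment (y : 'I_n.+1 -> 'I_d -> R) (c : cell) := y c.1 c.2.

Let gap i := (v i - row_floor v i) / n.+1%:R.

Let gap_gt0 i : 0 < gap i.
Proof. by rewrite divr_gt0 ?ltr0n// subr_gt0 row_floor_lt. Qed.

(** Row [i] moves from [row_floor v i] to [v i] at constant speed. *)
Let base (k : nat) i := row_floor v i + gap i * k.+1%:R.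

Let base_ge k i : row_floor v i <= base k i.
Proof. by rewrite lerDl mulr_ge0// ltW. Qed.

Let base_last i : base n i = v i.
Proof. by rewrite /base /gap divfK ?pnatr_eq0// addrC subrK. Qed.

Let base_le k l i : (k <= l)%N -> base k i <= base l i.
Proof. by move=> kl; rewrite lerD2l ler_wpM2l ?ler_nat// ltW. Qed.

(** The path [base], with the position in the cell [b] moved to the position in
    the next cell of the same row. *)
Let bumped (b : option cell) (k : 'I_n.+1) i : R :=
  base (k + (if b is Some c then (c.1 != ord_max) && (c == (k, i)) else false))%N i.

Let bumped_path b : finite_paths g v (bumped b).
Proof.
have kS (k : 'I_n.+1) i : (k + (if b is Some c then (c.1 != ord_max) && (c == (k, i)) else false) <= n)%N.
  case: b => [c|]; last by rewrite addn0 -ltnS.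
  case: andP => [[c1 /eqP ck]|_]; last by rewrite addn0 -ltnS.
  rewrite addn1 ltn_neqAle -ltnS ltn_ord andbT; apply: contraNneq c1 => kn.
  by rewrite ck; apply/eqP/val_inj.
apply: separated_finite_path => [k i|k l i kl|].
- by rewrite base_ge/= -[leRHS]base_last; exact: base_le.
- apply: base_le; move: kl; rewrite leq_eqVlt => /predU1P[/val_inj ->//|kl].
  apply: leq_trans (leq_addr _ _); rewrite -addn1 in kl; apply: leq_trans kl.
  by rewrite leq_add2l; case: (b) => // c; case: andP.
- apply/funext => i; rewrite /bumped; case: b kS => [c|] _; last by rewrite addn0 base_last.
  case: andP => [[c1 /eqP cn]|_]; last by rewrite addn0 base_last.
  by rewrite cn eqxx in c1.
Qed.

(** The polytope contains [base] and, for every cell below level [n], a translate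
    of [base] in the direction of this cell.  Their affine combinations reach
    every point with the given last vertex. *)
Lemma affine_hull_paths :
  affine_hull (flatten_segment @` finite_paths g v) =
  [set z | forall i, z (ord_max, i) = v i].
Proof.
apply/seteqP; split => [z [m [a [y [a1 yK zE]]]] i|z zv].
  rewrite zE; transitivity (\sum_l a l * v i); last by rewrite -mulr_suml a1 mul1r.
  by apply: eq_bigr => l _; have [w [_ _ wv] <-] := yK l; rewrite /flatten_segment/= wv.
pose t c := (z c - base c.1 c.2) / gap c.2.
pose F (l : 'I_#|{: option cell}|) := enum_val l.
pose a b := if b is Some c then t c else 1 - \sum_c t c.
have sumO (G : option cell -> R) : \sum_l G (F l) = G None + \sum_c G (Some c).
  transitivity (\sum_(b in {: option cell}) G b); first by rewrite (big_enum_val G).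
  rewrite (bigD1 None)//=; congr (_ + _).
  rewrite (@reindex_omap _ _ _ _ _ Some id); last by case.
  by apply: eq_bigl => c; rewrite /= eqxx.
exists _, (fun l => a (F l)), (fun l => flatten_segment (bumped (F l))); split.
- by rewrite (sumO a)/= subrK.
- by move=> l; exists (bumped (F l)).
move=> [k i]; rewrite (sumO (fun b => a b * flatten_segment (bumped b) (k, i)))/=.
have bE b : flatten_segment (bumped b) (k, i) =
    base k i + (if b is Some c then if (c.1 != ord_max) && (c == (k, i)) then gap i else 0 else 0).
  rewrite /flatten_segment /bumped /base/=; case: b => [c|]; last by rewrite addn0 addr0.
  case: ifP => _; last by rewrite addn0 addr0.
  by rewrite addn1 -[k.+2%:R]natr1 mulrDr mulr1 addrA.
under [X in _ = _ + X]eq_bigr do rewrite bE mulrDr.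
rewrite bE addr0 big_split/= -mulr_suml addrA -mulrDl subrK mul1r.
rewrite (bigD1 (k, i))//= [X in _ + (_ + X)]big1 ?addr0 => [|c ck]; last first.
  by rewrite (negbTE ck) andbF mulr0.
rewrite eqxx andbT; case: eqVneq => [->|_] /=.
  by rewrite mulr0 addr0 base_last zv.
by rewrite /t/= divfK ?gt_eqF// addrC subrK.
Qed.

Definition lower_cells : {set cell} := [set c | c.1 != ord_max]%SET.

(** On the affine hull the coordinates of level [n] are constant, and the others
    are free. *)
Lemma affine_chart_paths (S : {set cell}) :
  affine_chart (affine_hull (flatten_segment @` finite_paths g v)) S <-> S = lower_cells.
Proof.
rewrite /affine_chart affine_hull_paths; split => [[_ inj surj]|->].
  apply/setP => c; rewrite inE; case: (eqVneq c.1 ord_max) => [cn|cn] /=.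
    apply/negbTE/negP => cS.
    have [|z zv /(congr1 (fun f => f c))] := surj (fun c' => if c' == c then v c.2 + 1 else 0).
      by move=> c' c'S /=; case: eqP => // c'c; rewrite c'c cS in c'S.
    rewrite /coord_proj cS eqxx [c]surjective_pairing cn zv /= => /eqP.
    by rewrite eq_sym -subr_eq0 addrAC subrr add0r oner_eq0.
  apply: contraT => cS.
  have : (fun c' : cell => v c'.2) = (fun c' => if c' == c then v c'.2 + 1 else v c'.2).
    apply: inj; rewrite ?inE//=.
      by move=> i; case: eqP => // ci; rewrite -ci eqxx in cn.
    apply/funext => c'; rewrite /coord_proj; case: ifP => // c'S.
    by case: eqP => // c'c; rewrite c'c (negbTE cS) in c'S.
  move=> /(congr1 (fun f => f c)) /eqP; rewrite eqxx.
  by rewrite eq_sym -subr_eq0 addrAC subrr add0r oner_eq0.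
split.
- by move=> z _ c cS; rewrite /coord_proj (negbTE cS).
- move=> z z'; rewrite !inE => zv z'v zz'; apply/funext => -[k i].
  have [->|kn] := eqVneq k ord_max; first by rewrite zv z'v.
  by have := congr1 (fun f => f (k, i)) zz'; rewrite /coord_proj inE /= kn.
- move=> w w0; exists (fun c => if c \in lower_cells then w c else v c.2).
    by move=> i; rewrite inE eqxx.
  apply/funext => c; rewrite /coord_proj.
  by have [//|cS] := boolP (c \in lower_cells); have := w0 c cS => ->.
Qed.

Definition lower_array (x : VS) (c : cell) : R := x c.1 c.2.

Definition cell_index (c : cell) : nat * 'I_d := (val c.1, c.2).

Lemma iterated_lebesgue_iterint s (x : VS) (D : set (cell -> R)) :
  iterated_lebesgue s (lower_array x) D =
  iterint (map cell_index s) (fun x => (\1_D (lower_array x))%:E) x.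
Proof.
elim: s x => //= c s IH x; apply: eq_integral => t _; rewrite -IH.
by congr iterated_lebesgue; apply/funext => -[k i]; rewrite /lower_array /upd/=.
Qed.

Lemma perm_lower_cells : perm_eq (map cell_index (enum lower_cells)) (cells_below (e := d) n).
Proof.
apply: uniq_perm; last first.
- move=> [k i]; rewrite mem_cells_below /=; apply/mapP/idP => [[[l j]]|kn].
    rewrite mem_enum inE /= => ln [-> _].
    rewrite ltn_neqAle -ltnS ltn_ord andbT; apply: contraNneq ln => ln.
    exact/eqP/val_inj.
  have kn1 : (k < n.+1)%N by exact: ltnW.
  exists (inord k, i); last by rewrite /cell_index/= inordK.
  rewrite mem_enum inE /=; apply: contraTneq kn => /(congr1 val) /=.
  by rewrite inordK// => ->; rewrite ltnn.
- exact: uniq_cells_below.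
- by rewrite map_inj_uniq ?enum_uniq// => -[k i] [l j] [/val_inj -> ->].
Qed.

Lemma finite_paths_upto (x : VS) :
  finite_paths g v (initial_segment n x) <-> path_upto g n x /\ x n = v.
Proof.
split=> [[h1 h2 h3]|[[h1 h2] h3]]; last first.
  split=> [i|i j ji|//]; first by apply: h1; rewrite -ltnS.
  by rewrite /initial_segment ji; apply: h2; rewrite -ltnS -ji.
split; last exact: h3.
split=> k kn; first exact: (h1 (Ordinal (kn : (k < n.+1)%N))).
by have := h2 (Ordinal (ltnW kn : (k < n.+1)%N)) (Ordinal (kn : (k.+1 < n.+1)%N)); exact.
Qed.

Lemma lebesgue_coord_paths (A : set (segments R d n)) : measurable A ->
  lebesgue_coord lower_cells (coord_proj lower_cells @`
    ((flatten_segment @` finite_paths g v) `&` (flatten_segment @` A))) =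
  simplex_integral n (fun x => (\1_(initial_segment n @^-1` A) x * \1_(path_upto g n) x)%:E)
    (fun=> v).
Proof.
move=> mA; set D := _ @` _; pose h (x : VS) : R := \1_(initial_segment n @^-1` A) x.
have mh : measurable_fun setT (fun x => h x * \1_(path_upto g n) x).
  apply: measurable_mul_indic; last exact: measurable_path_upto.
  by apply: measurable_indic; rewrite -[X in measurable X]setTI; exact: measurable_initial_segment.
rewrite /simplex_integral -(iterint_perm _ _ _ perm_lower_cells); last 2 first.
- by apply: measurable_mul_nondecreasing; exact/measurable_EFinP.
- by move=> x; rewrite mule_ge0// lee_fin mulr_ge0.
rewrite /lebesgue_coord -[X in iterated_lebesgue _ X _]/(lower_array (fun _ _ => 0)).
rewrite iterated_lebesgue_iterint; apply: iterint_eq => x y x0 yv xy.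
have memc k i : ((k, i) \in map cell_index (enum lower_cells)) = (k < n)%N.
  by rewrite (perm_mem perm_lower_cells) mem_cells_below.
have yn : y n = v by apply/funext => i; rewrite yv// memc ltnn.
have segE (w : 'I_n.+1 -> 'I_d -> R) : w ord_max = v ->
    coord_proj lower_cells (flatten_segment w) = lower_array x <-> w = initial_segment n y.
  move=> wv; split => [wx|->].
    apply/funext => k; apply/funext => i; rewrite /initial_segment.
    have [->|kn] := eqVneq k ord_max; first by rewrite wv yn.
    have := congr1 (fun f => f (k, i)) wx; rewrite /coord_proj inE /= kn.
    rewrite /flatten_segment /lower_array /= => ->; apply: xy; rewrite memc.
    by rewrite ltn_neqAle -ltnS ltn_ord andbT.
  apply/funext => -[k i]; rewrite /coord_proj inE /lower_array /flatten_segment/=.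
  have [->|kn] /= := eqVneq k ord_max; first by rewrite x0// memc ltnn.
  by rewrite xy// memc ltn_neqAle -ltnS ltn_ord andbT.
have flat_inj : injective flatten_segment.
  move=> w w' ww'; apply/funext => k; apply/funext => i.
  exact: (congr1 (fun f => f (k, i)) ww').
have DE : D (lower_array x) <-> A (initial_segment n y) /\ path_upto g n y.
  split => [[_ [[w Kw <-] [w' Aw' /flat_inj ww']]]|[Ay gy]].
    have [_ _ wn] := Kw; move=> /(segE _ wn) wy; rewrite {}ww' in Aw'; rewrite -wy.
    split => //; have : finite_paths g v (initial_segment n y) by rewrite -wy.
    by move=> /finite_paths_upto[].
  exists (flatten_segment (initial_segment n y)).
    by split; exists (initial_segment n y) => //; apply/finite_paths_upto.
  by apply/segE.
rewrite !indicE; have [Dx|Dx] := pselect (D (lower_array x)); last first.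
  rewrite memNset//; have [Ay|Ay] := pselect (A (initial_segment n y)); last first.
    by rewrite (@memNset _ _ y Ay) mul0r mul0e.
  rewrite (@memNset _ (path_upto g n)) ?mulr0 ?mul0e// => gy.
  by apply: Dx; apply/DE.
have [Ay gy] := (DE.1 Dx); rewrite !mem_set// ?mulr1 ?mule1//.
exact: path_upto_nondecreasing gy.
Qed.

Variables (p : 'I_d -> R) (B : probability VS R).
Hypothesis p_gt0 : forall i, 0 < p i.
Hypothesis Bp : exponential_increments p B.

(** Both sides are uniform on the polytope: up to a factor that cancels, the
    simplex integral at the vertex [v] is the mean over the bridges to [v]. *)
Lemma path_measure_bridge (A : set (segments R d n)) : measurable A ->
  path_measure g v A =
  (conditional_bridge_mean g B n (\1_(initial_segment n @^-1` A)) (fun=> v))%:E.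
Proof.
move=> mA; rewrite /path_measure -/flatten_segment /normalized_lebesgue.
rewrite (@xget_unique _ _ _ lower_cells); last 2 first.
- by apply/affine_chart_paths.
- by move=> S /affine_chart_paths.
have bound (D : set VS) x : (0 : R) <= \1_D x <= 1.
  by rewrite indicE ler0n lern1 leq_b1.
have mseg (D : set (segments R d n)) : measurable D ->
    measurable_fun setT (\1_(initial_segment n @^-1` D) : VS -> R).
  move=> mD; apply: measurable_indic.
  by rewrite -[X in measurable X]setTI; exact: measurable_initial_segment.
have [c c0 cE] := simplex_volume_gt0_fin p_gt0 Bp n.
have w0 : 0 < \prod_i v i by apply: prodr_gt0 => i _; have [] := v_int.
pose w := (\prod_i v i) ^+ n * c.
have wgt0 : 0 < w by rewrite mulr_gt0// exprn_gt0.
have coordE (D : set (segments R d n)) : measurable D ->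
    lebesgue_coord lower_cells (coord_proj lower_cells @`
      ((flatten_segment @` finite_paths g v) `&` (flatten_segment @` D))) =
    (w * graph_bridge_mean g B n (\1_(initial_segment n @^-1` D)) (fun=> v))%:E.
  move=> mD; rewrite lebesgue_coord_paths//.
  have mphi := measurable_mul_indic (mseg _ mD) (measurable_path_upto g n).
  rewrite (simplex_integral_bridge p_gt0 Bp).
  - by rewrite (@graph_bridge_meanE _ _ g B n _ 1) ?cE//; [exact: mseg|exact: bound].
  - exact/measurable_EFinP.
  - by move=> x; rewrite lee_fin mulr_ge0.
  - exact: depends_below_segment.
  - by move=> i; have [] := v_int.
have KT : flatten_segment @` finite_paths g v =
    (flatten_segment @` finite_paths g v) `&` (flatten_segment @` setT).
  by apply/seteqP; split => [z Kz|z []//]; split => //; case: Kz => y _ <-; exists y.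
rewrite [X in (_ / lebesgue_coord _ (_ @` X))%E]KT !coordE//.
rewrite preimage_setT indicT /conditional_bridge_mean.
set a := graph_bridge_mean g B n _ _; set b := graph_bridge_mean g B n _ _.
have /andP[a0 ab] : 0 <= a <= b by apply: (@graph_bridge_mean_le _ _ g B n _ _); [exact: mseg|exact: bound].
(* if the denominator vanishes then so does the numerator, and the quotient of
   [0] by [0] is [0] in [R] and in the extended reals *)
rewrite inver; have [/eqP|wb] := eqVneq (w * b) 0; last first.
  by rewrite -EFinM -mulf_div mulfV ?mul1r// gt_eqF.
rewrite mulf_eq0 gt_eqF//= => /eqP b0; rewrite b0 in ab *.
have -> : a = 0 by apply/eqP; rewrite eq_le ab.
by rewrite mulr0 mul0r mul0e.
Qed.

End hull.
End vertices.

(** * Continuous functions determine a measure *)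

Section orthants.
Context {R : realType} {d : nat}.
Local Notation VS := (vector_seq R d).
Implicit Types (a : nat -> 'I_d -> option R) (x : VS).

(** [None] stands for the whole line, so that an orthant may leave coordinates
    free. *)
Definition half_line (b : option R) : set R :=
  [set t | if b is Some c then t <= c else True].

Lemma half_lineE c : half_line (Some c) = `]-oo, c]%classic.
Proof. by apply/seteqP; split => t; rewrite /half_line /= in_itv. Qed.

Lemma measurable_half_line b : @measurable _ (measurableTypeR R) (half_line b).
Proof.
case: b => [c|]; last exact: measurableT.
rewrite half_lineE; exact: (@measurable_itv R).
Qed.

Definition orthant K a : set VS :=
  rect (fun k i (x : VS) => x k i) K (fun k i => half_line (a k i)).

Lemma measurable_orthant K a : measurable (orthant K a).
Proof.
apply: measurable_rect => k i; first exact: measurable_coord.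
exact: measurable_half_line.
Qed.

Lemma measure_unique_orthants (m1 m2 : {measure set VS -> \bar R}) :
  (m1 setT < +oo)%E -> (forall K a, m1 (orthant K a) = m2 (orthant K a)) ->
  forall A, measurable A -> m1 A = m2 A.
Proof.
move=> m1oo m12; apply: (@measure_unique_rect _ _ (fun k i (x : VS) => x k i) (range half_line)) => //.
- by move=> k i; exact: measurable_coord.
- by move=> dS S f; exact: measurable_to_vector_seq.
- by exists None => //; apply/seteqP; split.
- move=> _ _ [[b|] _ <-] [[c|] _ <-].
  + exists (Some (Num.min b c)) => //.
    by apply/seteqP; split => t; rewrite /half_line/= le_min => /andP.
  + by exists (Some b) => //; apply/seteqP; split => t; [|case].
  + by exists (Some c) => //; apply/seteqP; split => t; [|case].
  + by exists None => //; apply/seteqP; split => t.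
- apply/seteqP; split; last first.
    apply: smallest_sub; first exact: sigma_algebra_measurable.
    by move=> _ [b _ <-]; exact: measurable_half_line.
  rewrite measurable_half_lines; apply: smallest_sub; first exact: smallest_sigma_algebra.
  move=> _ [c _ <-]; apply: sub_sigma_algebra; exists (Some c) => //.
- move=> K A AA; have H k : exists f : 'I_d -> option R, forall i, half_line (f i) = A k i.
    have Hk i : exists b, half_line b = A k i by have [b _ bE] := AA k i; exists b.
    by have [f fE] := choice Hk; exists f.
  have [a aE] := choice H.
  have -> : A = fun k i => half_line (a k i) by apply/funext => k; apply/funext => i.
  exact: m12.
Qed.

Definition excess (b : option R) (t : R) : R := if b is Some c then Num.max 0 (t - c) else 0.

Lemma excess_ge0 b t : 0 <= excess b t.
Proof. by case: b => // c; rewrite /excess le_max lexx. Qed.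

Lemma excess_eq0 b t : excess b t = 0 <-> half_line b t.
Proof.
case: b => [c|] //; rewrite /excess /half_line/=; split => [/eqP|tc].
  by rewrite eq_maxl subr_le0.
by apply/eqP; rewrite eq_maxl subr_le0.
Qed.

Lemma excess_continuous b : continuous (excess b).
Proof.
case: b => [c|] t; last exact: cvg_cst.
rewrite /excess; apply: (@continuous_max R R (cst 0) (fun t => t - c)); first exact: cvg_cst.
by apply: cvgB => //; exact: cvg_cst.
Qed.

(** The distance to the orthant in the sum norm; it is continuous and vanishes on
    the orthant only. *)
Definition total_excess K a (y : 'I_K.+1 -> 'I_d -> R) : R :=
  \sum_(k < K.+1) \sum_i (if (k < K)%N then excess (a k i) (y k i) else 0).

Lemma total_excess_ge0 K a y : 0 <= @total_excess K a y.
Proof. by do 2 apply: sumr_ge0 => ? _; case: ifP => // _; exact: excess_ge0. Qed.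

Lemma total_excess_eq0 K a (x : VS) :
  total_excess a (initial_segment K x) = 0 <-> orthant K a x.
Proof.
split => [/eqP|xa].
  rewrite psumr_eq0 => [/allP h k kK i|k _]; last first.
    by apply: sumr_ge0 => i _; case: ifP => // _; exact: excess_ge0.
  have := h (Ordinal (ltnW kK : (k < K.+1)%N)); rewrite mem_index_enum => /(_ isT)/=.
  rewrite psumr_eq0 => [/allP/(_ i)|j _]; last by case: ifP => // _; exact: excess_ge0.
  rewrite mem_index_enum kK => /(_ isT)/= /eqP; exact: (excess_eq0 _ _).1.
rewrite /total_excess big1// => k _; rewrite big1// => i _; case: ifP => // kK.
by apply/excess_eq0; exact: xa.
Qed.

Lemma continuous_sum (T : topologicalType) (I : Type) (s : seq I) (F : I -> T -> R) :
  (forall i, continuous (F i)) -> continuous (fun y => \sum_(i <- s) F i y).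
Proof.
move=> Fc; elim: s => [|i s IH] y.
  by under eq_fun do rewrite big_nil; exact: cvg_cst.
by under eq_fun do rewrite big_cons; apply: cvgD; [exact: Fc|exact: IH].
Qed.

Lemma total_excess_continuous K a : continuous (@total_excess K a).
Proof.
have H (k : 'I_K.+1) i : continuous
    (fun y : 'I_K.+1 -> 'I_d -> R => if (k < K)%N then excess (a k i) (y k i) else 0).
  case: (k < K)%N => y; last exact: (@cst_continuous _ R (0 : R) y).
  apply: (@continuous_comp ('I_K.+1 -> 'I_d -> R) R R (fun y => y k i) (excess (a k i))).
    exact: array_coord_continuous.
  exact: excess_continuous.
have H' (k : 'I_K.+1) : continuous (fun y : 'I_K.+1 -> 'I_d -> R =>
    \sum_i (if (k < K)%N then excess (a k i) (y k i) else 0)).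
  exact: (@continuous_sum ('I_K.+1 -> 'I_d -> R) _ _ _ (H k)).
exact: (@continuous_sum ('I_K.+1 -> 'I_d -> R) _ _ _ H').
Qed.

(** The indicator of an orthant is a limit of bounded continuous functions of
    finitely many vertices. *)
Lemma measure_unique_continuous (m1 m2 : probability VS R) :
  (forall k (f : ('I_k.+1 -> 'I_d -> R) -> R), continuous f ->
     (exists M : R, forall y, `|f y| <= M) ->
     (\int[m1]_x (f (initial_segment k x))%:E = \int[m2]_x (f (initial_segment k x))%:E)%E) ->
  forall A, measurable A -> m1 A = m2 A.
Proof.
move=> m12; apply: measure_unique_orthants; first by rewrite (le_lt_trans (probability_le1 m1 _)) ?ltry.
(* continuous functions decreasing to the indicator of the orthant *)
move=> K a; pose f (r : nat) y := Num.max 0 (1 - r%:R * @total_excess K a y).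
have f0 r y : 0 <= f r y by rewrite /f le_max lexx.
have f1 r y : f r y <= 1.
  by rewrite /f ge_max ler01 gerBl mulr_ge0// total_excess_ge0.
have fc r : continuous (f r).
  move=> y; apply: (@continuous_max R _ (cst 0) (fun y => 1 - r%:R * total_excess a y)).
    exact: (@cst_continuous _ R (0:R) y).
  have cst_c (c : R) := @cst_continuous ('I_K.+1 -> 'I_d -> R) R c y.
  apply: (@cvgB _ R _ _ _ _ _ _ _ (cst_c 1)).
  exact: (@cvgM R _ _ _ _ _ _ _ (cst_c r%:R) (@total_excess_continuous K a y)).
have lim (m : probability VS R) : (\int[m]_x (f r (initial_segment K x))%:E @[r --> \oo] --> m (orthant K a))%E.
  have -> : m (orthant K a) = (\int[m]_x (\1_(orthant K a) x)%:E)%E.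
    by rewrite integral_indic ?setIT//; exact: measurable_orthant.
  apply: (@bounded_convergence _ _ _ m (fun r x => f r (initial_segment K x)) _ 1).
  - move=> r; apply: (measurableT_comp (measurable_segments_continuous (fc r))).
    exact: measurable_initial_segment.
  - by apply: measurable_indic; exact: measurable_orthant.
  - by move=> r x; rewrite f0 f1.
  exists set0; split => // x _; apply: cvg_near_cst; rewrite /f indicE.
  have [/[dup] xa /total_excess_eq0 ->|xa] := pselect (orthant K a x).
    by apply: nearW => r; rewrite mulr0 subr0 mem_set// max_r.
  rewrite memNset//; have e0 : 0 < total_excess a (initial_segment K x).
    rewrite lt_neqAle total_excess_ge0 andbT eq_sym; apply/eqP => e.
    by apply: xa; apply/total_excess_eq0.
  exists (Num.truncn (total_excess a (initial_segment K x))^-1).+1 => // r /= Er.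
  rewrite max_l// subr_le0 -ler_pdivrMr// mul1r ltW//.
  have e1 : 0 <= (total_excess a (initial_segment K x))^-1 by rewrite invr_ge0 ltW.
  have /andP[_ /lt_le_trans] := Num.Theory.truncn_itv e1.
  by apply; rewrite ler_nat.
have H r : (\int[m1]_x (f r (initial_segment K x))%:E = \int[m2]_x (f r (initial_segment K x))%:E)%E.
  by apply: m12 => //; exists 1 => y; rewrite ger0_norm.
have := lim m1; under eq_fun do rewrite H.
move=> /cvg_unique; apply => //; exact: lim.
Qed.

End orthants.

(** * Centrality of the restricted measure *)

Section restricted_measure.
Context {R : realType} {d : nat} (p : 'I_d -> R) (g : branching_graph).
Local Notation VS := (vector_seq R d).
Variable B : probability VS R.
Hypothesis d_gt0 : (0 < d)%N.
Hypothesis p_gt0 : forall i, 0 < p i.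
Hypothesis p_incr : forall i j : 'I_d, (i < j)%N -> p i < p j.
Hypothesis Bp : exponential_increments p B.
Variable mu : probability VS R.
Hypothesis muE : forall A, measurable A ->
  mu A = (B (A `&` path_space g) / B (path_space g))%E.

Let mG := @measurable_path_space R d g.
Let G0 := path_space_gt0 g d_gt0 p_gt0 p_incr Bp.

Lemma restricted_path_space : mu (path_space g) = 1%E.
Proof.
rewrite muE// setIid; have := probability_le1 B mG; move: G0.
case: (B (path_space g)) => [r| |]//=; rewrite lte_fin => r0 _.
by rewrite inver gt_eqF// -EFinM mulfV// gt_eqF.
Qed.

Lemma almost_surely_restricted P : almost_surely B P -> almost_surely mu P.
Proof.
move=> [N [mN N0 NP]]; exists N; split => //; rewrite muE//.
rewrite (_ : B (N `&` path_space g) = 0%E) ?mul0e//.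
by apply: subset_measure0 N0 => //; exact: measurableI.
Qed.

Lemma almost_surely_measure1 (nu : probability VS R) (A : set VS) : measurable A ->
  nu A = 1%E -> almost_surely nu A.
Proof.
move=> mA A1; exists (~` A); split; first exact: measurableC.
  by rewrite probability_setC// A1 subee.
by move=> x /contrapT.
Qed.

Lemma ae_interior : almost_surely B (fun x => path_space g x -> forall n, interior_vertex (x n)).
Proof.
have neq : almost_surely B (fun x => forall k (i j : 'I_d), i != j -> x k i != x k j).
  apply: almost_surely_forall => k; apply: almost_surely_forall => i.
  apply: almost_surely_forall => j.
  have [->|ij] := eqVneq i j; first by exists set0; split.
  by apply: almost_surely_imp (ae_coord_neq p_gt0 Bp k k ij).
apply: almost_surely_imp (almost_surely_and neq (ae_increasing p_gt0 Bp)).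
move=> x [xn xinc] [xc _] n; split => [i|i j ij].
  by rewrite -sum_incr big_ord_recl ltr_wpDr//; apply: sumr_ge0 => j _; exact: ltW.
rewrite lt_neqAle; apply/andP; split; last by have [_] := xc n; apply; exact: ltnW.
by apply: xn; apply: contraTneq ij => ->; rewrite ltnn.
Qed.

Lemma path_space_split n (x : VS) :
  path_space g x <-> path_upto g n x /\ path_space g (path_tail n x).
Proof.
split => [[xc xe]|[[xc xe] [tc te]]].
  split; first by split.
  by split => m; [exact: xc|rewrite /path_tail addnS; exact: xe].
split => m.
  have [mn|nm] := leqP m n; first exact: xc.
  by rewrite -(subnKC (ltnW nm)); exact: tc.
have [mn|nm] := ltnP m n; first exact: xe.
by have := te (m - n)%N; rewrite /path_tail addnS subnKC.
Qed.

Lemma integral_restricted (f : VS -> \bar R) : measurable_fun setT f ->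
  (forall x, 0 <= f x)%E ->
  (\int[mu]_x f x = (\int[B]_x (f x * (\1_(path_space g) x)%:E)) / B (path_space g))%E.
Proof. exact: integral_conditional. Qed.

Lemma graph_bridge_mean_at n h (x z : VS) : (forall i, x n i = z n i) ->
  graph_bridge_mean g B n h x = graph_bridge_mean g B n h z.
Proof.
by move=> xz; congr fine; exact: depends_at_bridge_mean.
Qed.

(** A bridge to the vertex of [x] at level [n] does not depend on the rest of [x]. *)
Lemma conditional_bridge_mean_at n h (x z : VS) : (forall i, x n i = z n i) ->
  conditional_bridge_mean g B n h x = conditional_bridge_mean g B n h z.
Proof. by move=> xz; rewrite /conditional_bridge_mean !(graph_bridge_mean_at _ xz). Qed.

Lemma conditional_bridge_mean_bound n (h : VS -> R) (z : VS) : measurable_fun setT h ->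
  (forall x, 0 <= h x <= 1) -> 0 <= conditional_bridge_mean g B n h z <= 1.
Proof.
move=> mh h1; have /andP[a0 ab] := graph_bridge_mean_le g B n z mh h1.
have b0 := le_trans a0 ab; rewrite /conditional_bridge_mean.
rewrite divr_ge0//=; move: b0; rewrite le_eqVlt => /predU1P[<-|b0].
  by rewrite invr0 mulr0.
by rewrite ler_pdivrMr// mul1r.
Qed.

Lemma measurable_conditional_bridge_mean n (h : VS -> R) : measurable_fun setT h ->
  (forall x, 0 <= h x <= 1) ->
  measurable_fun setT (conditional_bridge_mean g B n h).
Proof.
move=> mh h1.
have mm (h' : VS -> R) : measurable_fun setT h' -> (forall x, 0 <= h' x <= 1) ->
    measurable_fun setT (graph_bridge_mean g B n h').
  move=> mh' h'1; apply: measurableT_comp => //.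
  apply: measurable_bridge_mean.
    apply/measurable_EFinP; apply: measurable_mul_indic => //.
    exact: measurable_path_upto.
  move=> z; rewrite lee_fin.
  by have /andP[] := indic_bound h'1 (path_upto g n) z.
apply: measurable_funM; first exact: mm.
apply: (measurableT_comp (@measurable_invr R)); apply: mm; first exact: measurable_cst.
by move=> x; rewrite /= ler01 lexx.
Qed.

(** Conditioning on the path space keeps the Gibbs property, since the indicator
    of the path space is the product of a function of the initial segment and a
    function of the tail. *)
Lemma restricted_gibbs n (h : VS -> R) (psi : VS -> \bar R) :
  measurable_fun setT h -> (forall x, 0 <= h x <= 1) ->
  depends_below n.+1 (fun x => (h x * \1_(path_upto g n) x)%:E : \bar R) ->
  measurable_fun setT psi -> (forall x, 0 <= psi x)%E ->
  (\int[mu]_x ((h x)%:E * psi (path_tail n x)) =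
   \int[mu]_x ((conditional_bridge_mean g B n h x)%:E * psi (path_tail n x)))%E.
Proof.
move=> mh h1 hbelow mpsi psi0.
pose u (h' : VS -> R) (x : VS) : \bar R := (h' x * \1_(path_upto g n) x : R)%:E.
pose psi' (x : VS) : \bar R := (psi x * (\1_(path_space g) x)%:E)%E.
have mtail := @measurable_path_tail R d n.
have mpt := measurableT_comp mpsi mtail.
have mpsi' : measurable_fun setT psi'.
  by apply: emeasurable_funM => //; apply/measurable_EFinP; exact: measurable_indic.
have psi'0 x : (0 <= psi' x)%E by rewrite mule_ge0// lee_fin.
have h0 x : 0 <= h x by have /andP[] := h1 x.
have splitE h' x : ((h' x)%:E * psi (path_tail n x) * (\1_(path_space g) x)%:E =
    u h' x * psi' (path_tail n x))%E.
  rewrite /u /psi' EFinM -!muleA; congr (_ * _)%E; rewrite muleCA; congr (_ * _)%E.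
  rewrite -EFinM; congr EFin; rewrite !indicE -natrM mulnb; congr (nat_of_bool _)%:R.
  by apply/idP/andP; rewrite !inE; [move/(path_space_split n)|move/(path_space_split n)].
(* both sides equal the bridge mean of [h] times the indicator of the
   inequalities up to level [n]: the Gibbs property gives this for [h] on the left
   and for the constant [1] on the right *)
pose q := conditional_bridge_mean g B n h.
have mq : measurable_fun setT q by exact: measurable_conditional_bridge_mean.
have q0 x : 0 <= q x by have /andP[] := conditional_bridge_mean_bound n x mh h1.
have one1 (x : VS) : 0 <= cst (1 : R) x <= 1 by rewrite /= ler01 lexx.
have m1 : measurable_fun setT (cst (1 : R) : VS -> R) by exact: measurable_cst.
have mu_ h' : measurable_fun setT h' -> measurable_fun setT (u h').
  by move=> mh'; apply/measurable_EFinP; apply: measurable_mul_indic => //; exact: measurable_path_upto.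
rewrite !integral_restricted; last 4 first.
- by apply: emeasurable_funM => //; exact/measurable_EFinP.
- by move=> x; rewrite mule_ge0// lee_fin.
- by apply: emeasurable_funM => //; exact/measurable_EFinP.
- by move=> x; rewrite mule_ge0// lee_fin.
congr (_ / _)%E; under eq_integral do rewrite splitE; under [RHS]eq_integral do rewrite splitE.
rewrite (gibbs p_gt0 Bp)//; last 2 first.
- exact: mu_.
- by move=> x; rewrite lee_fin mulr_ge0.
pose first_vertex (y : VS) : VS := fun=> y 0%N.
have mfirst : measurable_fun setT first_vertex.
  by apply: measurable_to_vector_seq => k i; exact: measurable_coord.
pose psi2 y := ((q (first_vertex y))%:E * psi' y)%E.
have mpsi2 : measurable_fun setT psi2.
  by apply: emeasurable_funM => //; apply/measurable_EFinP; exact: (measurableT_comp mq mfirst).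
have qfirst x : q (first_vertex (path_tail n x)) = q x.
  by apply: conditional_bridge_mean_at => i; rewrite /first_vertex /path_tail addn0.
transitivity (\int[B]_x (u (cst 1%R) x * psi2 (path_tail n x)))%E; last first.
  apply: eq_integral => x _; rewrite /psi2 qfirst muleA; congr (_ * _)%E.
  by rewrite /u -EFinM /= mul1r mulrC.
rewrite [in RHS](gibbs p_gt0 Bp)//; last 4 first.
- exact: mu_.
- by move=> x; rewrite lee_fin mulr_ge0.
- by have := @depends_below_segment R d g n setT; rewrite preimage_setT indicT.
- by move=> x; rewrite mule_ge0// lee_fin.
apply: eq_integral => x _; rewrite /psi2 qfirst [in RHS]muleA; congr (_ * _)%E.
rewrite (graph_bridge_meanE g B n x mh h1) (graph_bridge_meanE g B n x m1 one1) -EFinM; congr EFin.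
rewrite /q /conditional_bridge_mean mulrCA.
have /andP[a0 ab] := graph_bridge_mean_le g B n x mh h1.
have [b0|b0] := eqVneq (graph_bridge_mean g B n (cst 1%R) x) 0.
  by rewrite b0 mul0r mulr0; apply/eqP; rewrite eq_le a0 -[X in _ <= X]b0 ab.
by rewrite mulfV ?mulr1.
Qed.

Lemma iterated_lebesgue_ge0 (I : finType) (s : seq I) (z : I -> R) (D : set (I -> R)) :
  (0 <= iterated_lebesgue s z D)%E.
Proof.
elim: s z => [|c s IH] z /=; first by rewrite lee_fin.
by apply: integral_ge0 => t _; exact: IH.
Qed.

Lemma path_measure_ge0 n v (A : set (segments R d n)) : (0 <= path_measure g v A)%E.
Proof.
rewrite /path_measure /normalized_lebesgue /lebesgue_coord.
by rewrite mule_ge0 ?inve_ge0 ?iterated_lebesgue_ge0.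
Qed.

Definition segment_event n (A : set (segments R d n)) : VS -> R :=
  \1_(initial_segment n @^-1` A).

Lemma measurable_segment_event n (A : set (segments R d n)) : measurable A ->
  measurable_fun setT (segment_event A).
Proof.
move=> mA; apply: measurable_indic; rewrite -[X in measurable X]setTI.
exact: measurable_initial_segment.
Qed.

Lemma segment_event_bound n (A : set (segments R d n)) x : 0 <= segment_event A x <= 1.
Proof. by rewrite /segment_event indicE ler0n lern1 leq_b1. Qed.

(** For interior vertices [path_measure] is the conditioned bridge, which is a
    measurable function of the vertex; the other vertices form a null set, where
    measurability does not matter by [ge0_integral_ae_eq]. *)
Lemma integral_path_measure (nu : probability VS R) n (A : set (segments R d n)) (C : set VS) :
  almost_surely nu (fun x => forall n, interior_vertex (x n)) -> measurable A ->
  (\int[nu]_(x in [set x | C (path_tail n x)]) path_measure g (x n) A =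
   \int[nu]_x ((conditional_bridge_mean g B n (segment_event A) x)%:E *
     (\1_C (path_tail n x))%:E))%E.
Proof.
move=> [N [mN N0 HN]] mA; rewrite integral_mkcond.
have q0 x : 0 <= conditional_bridge_mean g B n (segment_event A) x.
  by have /andP[] := conditional_bridge_mean_bound n x (measurable_segment_event mA)
    (segment_event_bound A).
apply: (ge0_integral_ae_eq mN N0).
- by move=> x; apply: erestrict_ge0 => y _; exact: path_measure_ge0.
- by move=> x; rewrite mule_ge0 ?lee_fin.
move=> x Nx; rewrite patchE indicE.
have -> : (x \in [set x | C (path_tail n x)]) = (path_tail n x \in C).
  by apply/idP/idP; rewrite !inE.
case: (_ \in C); last by rewrite mule0.
by rewrite mule1 (path_measure_bridge g (HN _ Nx n) p_gt0 Bp mA).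
Qed.

Lemma restricted_interior : almost_surely mu (fun x => forall n, interior_vertex (x n)).
Proof.
have := almost_surely_and (almost_surely_restricted ae_interior)
  (almost_surely_measure1 mG restricted_path_space).
by apply: almost_surely_imp => x []; exact.
Qed.

Lemma restricted_central : central g mu.
Proof.
split; first exact: restricted_path_space.
move=> n _ A C mA mC; rewrite (integral_path_measure _ restricted_interior mA).
have mC1 : measurable_fun setT (fun x : VS => (\1_C x)%:E : \bar R).
  by apply/measurable_EFinP; exact: measurable_indic.
rewrite -(@restricted_gibbs n (segment_event A) (fun x => (\1_C x)%:E))//; last 3 first.
- exact: measurable_segment_event.
- exact: segment_event_bound.
- exact: depends_below_segment.
pose D := [set x : VS | A (initial_segment n x) /\ C (path_tail n x)].
have mD : measurable D.
  have h1 := @measurable_initial_segment R d n measurableT _ mA.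
  have h2 := @measurable_path_tail R d n measurableT _ mC.
  by rewrite !setTI in h1 h2; exact: measurableI.
transitivity (\int[mu]_x (\1_D x)%:E)%E; first by rewrite integral_indic// setIT.
apply: eq_integral => x _; rewrite -EFinM /segment_event !indicE -natrM mulnb.
congr ((nat_of_bool _)%:R%:E); apply/idP/andP; rewrite !inE /=; first by move=> [].
by move=> [].
Qed.

End restricted_measure.

(** * Weak convergence of the measures on finite paths *)

Section coordinatewise_convergence.

Lemma base_cvg (T : topologicalType) (J : countType) (b : J -> set T) (y : nat -> T) (x : T) :
  topological_base b -> (forall j, b j x -> \forall m \near \oo, b j (y m)) ->
  y m @[m --> \oo] --> x.
Proof. by move=> [_ bb] yx U /bb[j /yx bx bU]; apply: filterS bx => m; exact: bU. Qed.

Lemma cylinder_eventually (K : countType) (T : topologicalType) (J : countType) (b : J -> set T)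
    (y : nat -> K -> T) (x : K -> T) :
  (forall k j, b j (x k) -> \forall m \near \oo, b j (y m k)) ->
  forall s, cylinder b s x -> \forall m \near \oo, cylinder b s (y m).
Proof.
move=> yx; elim=> [|c s IH]; first by rewrite cylinder_nil => _; exact: nearW.
rewrite cylinder_cons => -[/yx h1 /IH h2].
by apply: filterS2 h1 h2 => m m1 m2; split.
Qed.

Lemma segment_cvg (R : realType) (d k : nat) (y : nat -> vector_seq R d) (x : vector_seq R d) :
  (forall k i, (y m k i : R) @[m --> \oo] --> (x k i : R)) ->
  (initial_segment k (y m) : 'I_k.+1 -> 'I_d -> R) @[m --> \oo] -->
  (initial_segment k x : 'I_k.+1 -> 'I_d -> R).
Proof.
move=> yx; have b1 := rational_interval_base R.
apply: (base_cvg (cylinder_base (K := 'I_k.+1) (cylinder_base (K := 'I_d) b1))).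
apply: cylinder_eventually => l; apply: cylinder_eventually => i j bx.
have [ob _] := b1; have : nbhs (x l i : R) (rational_interval j) by exact: open_nbhs_nbhs.
exact: yx.
Qed.

End coordinatewise_convergence.

Section weak_convergence.
Context {R : realType} {d : nat} (p : 'I_d -> R) (g : branching_graph).
Local Notation VS := (vector_seq R d).
Variable B : probability VS R.
Hypothesis d_gt0 : (0 < d)%N.
Hypothesis p_gt0 : forall i, 0 < p i.
Hypothesis p_incr : forall i j : 'I_d, (i < j)%N -> p i < p j.
Hypothesis Bp : exponential_increments p B.

(** The Cesaro measure is conditioned on the event that the bridge to [v] obeys
    the inequalities. *)
Lemma path_measure_law n v :
  interior_vertex v -> 0 < graph_bridge_mean g B n (cst 1) (fun=> v) ->
  exists Q : probability VS R,
    (forall A : set (segments R d n), measurable A ->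
      path_measure g v A = Q ((initial_segment n \o bridge n (fun=> v)) @^-1` A)) /\
    (forall (f : VS -> R) M, measurable_fun setT f -> (forall x, 0 <= f x <= M) ->
      (\int[Q]_w (f (bridge n (fun=> v) w))%:E =
       (conditional_bridge_mean g B n f (fun=> v))%:E)%E).
Proof.
move=> vint b0; have mupto := @measurable_path_upto R d g n.
pose Y := bridge n (fun=> v) : VS -> VS.
have mY : measurable_fun setT Y := measurable_bridge_to n (fun=> v).
pose G := Y @^-1` path_upto g n.
have mG : measurable G by rewrite -[X in measurable X]setTI; exact: mY.
have one1 (x : VS) : 0 <= cst (1 : R) x <= 1 by rewrite /= ler01 lexx.
have BG : B G = (graph_bridge_mean g B n (cst 1%R) (fun=> v))%:E.
  rewrite -(@graph_bridge_meanE _ _ g B n (cst 1%R) 1)//.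
  rewrite /bridge_mean; under eq_integral do rewrite mul1r.
  by rewrite (integral_indic B measurableT mG) setIT.
have G0 : (0 < B G)%E by rewrite BG lte_fin.
have [Q QE] := conditional_exists mG G0; exists Q.
have condE (f : VS -> R) M : measurable_fun setT f -> (forall x, 0 <= f x <= M) ->
    (\int[Q]_w (f (Y w))%:E = (conditional_bridge_mean g B n f (fun=> v))%:E)%E.
  move=> mf f1; rewrite (integral_conditional mG G0 QE).
  - rewrite BG inver gt_eqF// /conditional_bridge_mean EFinM; congr (_ * _)%E.
    rewrite -(graph_bridge_meanE g B n _ mf f1).
    by apply: eq_integral => w _; rewrite EFinM.
  - by apply/measurable_EFinP; exact: measurableT_comp.
  - by move=> w; rewrite lee_fin; have /andP[] := f1 (Y w).
split => // A mA; rewrite (path_measure_bridge g vint p_gt0 Bp mA).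
rewrite -(condE _ 1); last 2 first.
- exact: measurable_segment_event.
- exact: segment_event_bound.
have mpA : measurable ((initial_segment n \o Y) @^-1` A).
  have mphi := measurableT_comp (@measurable_initial_segment R d n) mY.
  by rewrite -[X in measurable X]setTI; exact: mphi.
by rewrite (integral_indic Q measurableT mpA) setIT.
Qed.

Let measurable_bridge_segment n v :
  measurable_fun setT (initial_segment n \o bridge n (fun=> v) : VS -> segments R d n).
Proof. exact: (measurableT_comp (@measurable_initial_segment R d n) (measurable_bridge_to n _)). Qed.

Lemma path_measure_integral n v k (h : ('I_k.+1 -> 'I_d -> R) -> R) M :
  interior_vertex v -> (k <= n)%N -> 0 < graph_bridge_mean g B n (cst 1) (fun=> v) ->
  continuous h -> (forall y, 0 <= h y <= M) ->
  (\int[@path_measure R d g n v]_y (h (fun i => y (inord i)))%:E =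
   (conditional_bridge_mean g B n (fun x => h (initial_segment k x)) (fun=> v))%:E)%E.
Proof.
move=> vint kn b0 hc hM; have [Q [QE condE]] := path_measure_law vint b0.
rewrite (ge0_integral_law (@measurable_bridge_segment n v) QE).
- rewrite -(condE _ M)//.
    apply: eq_integral => w _; congr ((h _)%:E).
    apply/funext => i; rewrite /initial_segment/= inordK//.
    by rewrite ltnS (leq_trans _ kn)// -ltnS.
  apply: (measurableT_comp (measurable_segments_continuous hc)).
  exact: measurable_initial_segment.
- apply/measurable_EFinP.
  apply: (@measurableT_comp _ _ _ _ (segments R d k) _ h).
    exact: measurable_segments_continuous.
  by apply: measurable_to_segments => l i; exact: measurable_segments_coord.
- by move=> y; rewrite lee_fin; have /andP[] := hM (fun i => y (inord i)).
Qed.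

(** On measurable sets [path_measure] agrees with a measure, so its integral has
    the usual decomposition although it is a mere set function. *)
Lemma path_measure_integralE n v (f : segments R d n -> \bar R) :
  interior_vertex v -> 0 < graph_bridge_mean g B n (cst 1) (fun=> v) ->
  (\int[@path_measure R d g n v]_y f y =
   \int[@path_measure R d g n v]_y f^\+ y - \int[@path_measure R d g n v]_y f^\- y)%E.
Proof.
move=> vint b0; have [Q [QE _]] := path_measure_law vint b0.
have mphi := @measurable_bridge_segment n v.
have E A : measurable A -> path_measure g v A = push_measure Q mphi A by exact: QE.
by rewrite !(eq_raw_measure_integral _ E) integralE.
Qed.

Variable mu : probability VS R.
Hypothesis muE : forall A, measurable A ->
  mu A = (B (A `&` path_space g) / B (path_space g))%E.
Variables (N : nat -> nat) (v : nat -> 'I_d -> R).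
Hypothesis N_incr : forall m n : nat, (m < n)%N -> (N m < N n)%N.
Hypothesis v_freq : forall i, v m i / (N m)%:R @[m --> \oo] --> p i.

Lemma eventually_interior : \forall m \near \oo, interior_vertex (v m).
Proof.
have pos : \forall m \near \oo, forall i, 0 < v m i.
  apply: filter_forall => i.
  have H : \forall m \near \oo, 0 < v m i / (N m)%:R by exact: (cvgr_gt _ (@v_freq i) 0).
  apply: filterS H => m; rewrite !ltNge; apply: contra => v0.
  by rewrite mulr_le0_ge0// invr_ge0.
have mon : \forall m \near \oo, forall c : 'I_d * 'I_d, (c.1 < c.2)%N -> v m c.1 < v m c.2.
  apply: filter_forall => -[i j] /=; have [ij|_] := boolP (i < j)%N; last exact: nearW.
  have h : v m j / (N m)%:R - v m i / (N m)%:R @[m --> \oo] --> p j - p i.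
    by apply: cvgB; exact: v_freq.
  have pij : 0 < p j - p i by rewrite subr_gt0; exact: p_incr.
  have H : \forall m \near \oo, 0 < v m j / (N m)%:R - v m i / (N m)%:R.
    exact: (cvgr_gt _ h 0 pij).
  apply: filterS H => m; rewrite -mulrBl => + _; rewrite !ltNge; apply: contra => v0.
  by rewrite mulr_le0_ge0 ?subr_le0// invr_ge0.
by apply: filterS2 pos mon => m h1 h2; split => // i j; exact: (h2 (i, j)).
Qed.

Lemma eventually_bridge_gt0 :
  \forall m \near \oo, 0 < graph_bridge_mean g B (N m) (cst 1) (fun=> v m).
Proof.
have one1 (x : VS) : 0 <= cst (1 : R) x <= 1 by rewrite /= ler01 lexx.
have m1 : measurable_fun setT (cst (1 : R) : VS -> R) by exact: measurable_cst.
have H := graph_bridge_mean_cvg (g := g) d_gt0 p_gt0 p_incr Bp N_incr v_freq m1 one1 (ae_continuous_cst B 1).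
apply: (cvgr_gt _ H 0); rewrite -lte_fin.
rewrite -(@bounded_integral _ _ _ B (fun x => cst 1 x * \1_(path_space g) x) 1); last 2 first.
- by apply: measurable_mul_indic => //; exact: measurable_path_space.
- by move=> x; exact: indic_bound.
under eq_integral do rewrite mul1r.
by rewrite integral_indic ?setIT//; [exact: path_space_gt0 Bp|exact: measurable_path_space].
Qed.

Lemma path_measures_cvg_ge0 k (h : ('I_k.+1 -> 'I_d -> R) -> R) M :
  continuous h -> (forall y, 0 <= h y <= M) ->
  (\int[@path_measure R d g (N m) (v m)]_y (h (fun i => y (inord i)))%:E @[m --> \oo] -->
   \int[mu]_x (h (initial_segment k x))%:E)%E.
Proof.
move=> hc hM.
have mhs : measurable_fun setT (fun x : VS => h (initial_segment k x)).
  apply: (measurableT_comp (measurable_segments_continuous hc)).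
  exact: measurable_initial_segment.
have hac : ae_continuous B (fun x => h (initial_segment k x)).
  exists set0; split => // x _ y yx.
  exact: (cvg_comp _ _ (segment_cvg (k := k) yx) (hc _)).
have := conditional_bridge_mean_cvg d_gt0 p_gt0 p_incr Bp N_incr v_freq muE mhs
  (fun x => hM _) hac.
apply: cvg_trans; apply: near_eq_cvg.
have N_ge : \forall m \near \oo, (k <= N m)%N.
  exists k => // m /= km; apply: leq_trans km _.
  by elim: m => // m IH; exact: leq_ltn_trans IH (N_incr (ltnSn m)).
apply: filterS3 eventually_interior eventually_bridge_gt0 N_ge => m h1 h2 h3.
by rewrite (path_measure_integral h1 h3 h2 hc hM).
Qed.

(** The convergence of conditioned bridges for the positive and the negative part
    of the test function. *)
Lemma restricted_path_measures_cvg : path_measures_cvg g N v mu.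
Proof.
move=> k f fc [M fM].
pose fp y : R := Num.max (f y) 0; pose fn y : R := Num.max (- f y) 0.
have cst_c y := @cst_continuous ('I_k.+1 -> 'I_d -> R) R 0 y.
have fpc : continuous fp.
  by move=> y; exact: (@continuous_max R _ f (cst 0) y (fc y) (cst_c y)).
have fnc : continuous fn.
  move=> y; apply: (@continuous_max R _ (fun y => - f y) (cst 0) y _ (cst_c y)).
  exact: (cvgN (fc y)).
have fpM y : 0 <= fp y <= M.
  rewrite /fp le_max lexx orbT/= ge_max (le_trans _ (fM y)) ?ler_norm//.
  by rewrite (le_trans _ (fM y)).
have fnM y : 0 <= fn y <= M.
  rewrite /fn le_max lexx orbT/= ge_max (le_trans _ (fM y)); last first.
    by rewrite -normrN ler_norm.
  by rewrite (le_trans _ (fM y)).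
have fpE T (s : T -> 'I_k.+1 -> 'I_d -> R) :
    ((fun y => (f (s y))%:E)^\+ = fun y => (fp (s y))%:E)%E.
  by apply/funext => y; rewrite funeposE /fp EFin_max.
have fnE T (s : T -> 'I_k.+1 -> 'I_d -> R) :
    ((fun y => (f (s y))%:E)^\- = fun y => (fn (s y))%:E)%E.
  by apply/funext => y; rewrite funenegE /fn EFin_max EFinN.
have mfin (h : ('I_k.+1 -> 'I_d -> R) -> R) : continuous h -> (forall y, 0 <= h y <= M) ->
    (\int[mu]_x (h (initial_segment k x))%:E)%E \is a fin_num.
  move=> hc hM; rewrite (@bounded_integral _ _ _ mu (fun x => h (initial_segment k x)) M)//.
  apply: (measurableT_comp (measurable_segments_continuous hc)).
  exact: measurable_initial_segment.
have lim := cvgeB (fin_num_adde_defr _ (mfin _ fpc fpM))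
  (path_measures_cvg_ge0 fpc fpM) (path_measures_cvg_ge0 fnc fnM).
have E : \forall m \near \oo,
    (\int[@path_measure R d g (N m) (v m)]_y (fp (fun i => y (inord i)))%:E -
     \int[@path_measure R d g (N m) (v m)]_y (fn (fun i => y (inord i)))%:E =
     \int[@path_measure R d g (N m) (v m)]_y (f (fun i => y (inord i)))%:E)%E.
  apply: filterS2 eventually_interior eventually_bridge_gt0 => m h1 h2.
  by rewrite [RHS](path_measure_integralE _ h1 h2) fpE fnE.
by rewrite integralE fpE fnE; exact: (cvg_trans (near_eq_cvg E) (lim _)).
Qed.

End weak_convergence.

(** * Ergodicity and uniqueness *)

Section ergodicity.
Context {R : realType} {d : nat} (p : 'I_d -> R) (g : branching_graph).
Local Notation VS := (vector_seq R d).
Variable B : probability VS R.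
Hypothesis d_gt0 : (0 < d)%N.
Hypothesis p_gt0 : forall i, 0 < p i.
Hypothesis p_incr : forall i j : 'I_d, (i < j)%N -> p i < p j.
Hypothesis Bp : exponential_increments p B.
Variable mu : probability VS R.
Hypothesis muE : forall A, measurable A ->
  mu A = (B (A `&` path_space g) / B (path_space g))%E.

Lemma ae_continuous_orthant K a : ae_continuous B (\1_(@orthant R d K a) : VS -> R).
Proof.
have neq : almost_surely B (fun x => forall k i, if a k i is Some c then x k i != c else true).
  apply: almost_surely_forall => k; apply: almost_surely_forall => i.
  case: (a k i) => [c|]; last by exists set0; split.
  exact: (ae_coord_neq_cst p_gt0 Bp).
apply: almost_surely_imp neq => x xa y yx; apply: cvg_near_cst.
have side k i : \forall m \near \oo, half_line (a k i) (y m k i) <-> half_line (a k i) (x k i).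
  have := xa k i; rewrite /half_line /=; case: (a k i) => [c|_]; last exact: nearW.
  rewrite neq_lt => /orP[xc|cx].
    have H : \forall m \near \oo, (y m k i : R) < c by exact: (cvgr_lt _ (yx k i) c xc).
    by apply: filterS H => m yc; rewrite !ltW.
  have H : \forall m \near \oo, c < (y m k i : R) by exact: (cvgr_gt _ (yx k i) c cx).
  by apply: filterS H => m cy; rewrite !leNgt cy cx.
have sides : \forall m \near \oo, forall c : 'I_K * 'I_d,
    half_line (a c.1 c.2) (y m c.1 c.2) <-> half_line (a c.1 c.2) (x c.1 c.2).
  by apply: filter_forall => c; exact: side.
apply: filterS sides => m h; rewrite !indicE; congr (nat_of_bool _)%:R.
by apply/idP/idP; rewrite !inE => ya k kK i; apply/(h (Ordinal kK, i)); exact: ya.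
Qed.

Let segment_orthant K a n : set (segments R d n) :=
  [set y | forall k, (k < K)%N -> forall i, half_line (a k i) (y (inord k) i)].

Let measurable_segment_orthant K a n : measurable (@segment_orthant K a n).
Proof.
apply: measurable_forall => k; apply: measurable_imp => _; apply: measurable_forall => i.
have := @measurable_segments_coord R d n (inord k) i measurableT _ (measurable_half_line (a k i)).
by rewrite setTI.
Qed.

(** By centrality, the mass that [nu] gives to an orthant is the mean of its
    mass under the measure on paths to the random vertex of level [n]; by the
    law of large numbers and the convergence of the conditioned bridges this
    tends to the mass that [mu] gives to the orthant. *)
Lemma central_dominated_eq (nu : probability VS R) : central g nu ->
  (forall A, measurable A -> mu A = 0%E -> nu A = 0%E) ->
  forall A, measurable A -> nu A = mu A.
Proof.
move=> [_ nuc] numu.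
have as_mu (P : VS -> Prop) : almost_surely mu P -> almost_surely nu P.
  by move=> [N [mN N0 NP]]; exists N; split => //; exact: numu.
have as_int := as_mu _ (restricted_interior d_gt0 p_gt0 p_incr Bp muE).
have as_lln := as_mu _ (almost_surely_restricted muE (law_of_large_numbers d_gt0 p_gt0 Bp)).
apply: measure_unique_orthants; first by rewrite (le_lt_trans (probability_le1 nu _)) ?ltry.
move=> K a; pose N m := (m + K).+1.
have N_incr m n : (m < n)%N -> (N m < N n)%N by rewrite /N ltnS ltn_add2r.
have N_oo : (m + K)%N @[m --> \oo] --> \oo.
  by move=> A [n _ An]; exists n => // m /= nm; apply: An; rewrite /= (leq_trans nm)// leq_addr.
have NS_oo : N m @[m --> \oo] --> \oo.
  move=> A [n _ An]; exists n => // m /= nm; apply: An.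
  by rewrite /= (leq_trans nm)// /N -addnS leq_addr.
have mE := @measurable_orthant R d K a.
pose h : VS -> R := \1_(orthant K a).
have mh : measurable_fun setT h by exact: measurable_indic.
have h1 x : 0 <= h x <= 1 by rewrite /h indicE ler0n lern1 leq_b1.
have preE m : initial_segment (N m) @^-1` @segment_orthant K a (N m) = orthant K a.
  have kN k : (k < K)%N -> (k < (N m).+1)%N.
    by move=> kK; rewrite /N !ltnS (leq_trans (ltnW kK))// leqW// leq_addl.
  by apply/seteqP; split => x xa k kK i; have := xa k kK i;
    rewrite /initial_segment /= inordK// kN.
have nuE m : (nu (orthant K a) = \int[nu]_x (conditional_bridge_mean g B (N m) h x)%:E)%E.
  have mS := @measurable_segment_orthant K a (N m).
  have := nuc (N m) isT _ setT mS measurableT.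
  rewrite (integral_path_measure g p_gt0 Bp setT as_int mS) /segment_event preE => nuN.
  transitivity (nu (initial_segment (N m) @^-1` @segment_orthant K a (N m))).
    by rewrite preE.
  transitivity (nu [set x | segment_orthant K a (initial_segment (N m) x) /\ setT (path_tail (N m) x)]).
    by congr (nu _); apply/seteqP; split => x; [|move=> []].
  by rewrite nuN; apply: eq_integral => x _; rewrite indicT /= mule1.
have lim : (\int[nu]_x (conditional_bridge_mean g B (N m) h x)%:E @[m --> \oo] -->
    \int[nu]_x (fine (mu (orthant K a)))%:E)%E.
  apply: (@bounded_convergence _ _ _ nu (fun m => conditional_bridge_mean g B (N m) h)
    (cst (fine (mu (orthant K a)))) 1) => //.
  - by move=> m; exact: measurable_conditional_bridge_mean.
  - by move=> m x; exact: conditional_bridge_mean_bound.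
  apply: almost_surely_imp as_lln => x xlln.
  have v_freq i : x (N m) i / (N m)%:R @[m --> \oo] --> p i.
    have H1 : x (N m) i / (N m).+1%:R @[m --> \oo] --> p i.
      exact: (cvg_comp _ _ NS_oo (xlln i)).
    have H2 : (m + K).+1%:R^-1 @[m --> \oo] --> (0 : R).
      exact: (cvg_comp _ _ N_oo (@cvg_harmonic R)).
    have H3 : x (N m) i / (N m).+1%:R * (1 + (m + K).+1%:R^-1) @[m --> \oo] --> p i * (1 + 0).
      by apply: cvgM => //; apply: cvgD => //; exact: cvg_cst.
    rewrite addr0 mulr1 in H3; apply: cvg_trans H3; apply: near_eq_cvg.
    apply: nearW => m; rewrite -/(N m).
    have Nn : (N m)%:R != 0 :> R by rewrite pnatr_eq0.
    rewrite -[X in X + _](mulfV Nn) -[X in _ + X]mul1r -mulrDl natr1 mulrA divfK//.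
  have := conditional_bridge_mean_cvg d_gt0 p_gt0 p_incr Bp N_incr v_freq muE mh h1
    (ae_continuous_orthant K a).
  have -> : (\int[mu]_x (h x)%:E = (fine (mu (orthant K a)))%:E)%E.
    by rewrite (integral_indic mu measurableT mE) setIT fineK// fin_num_measure.
  move=> /fine_cvg.
  apply: cvg_trans; apply: near_eq_cvg; apply: nearW => m /=.
  exact: conditional_bridge_mean_at.
rewrite probability_integral_cst fineK ?fin_num_measure// in lim.
have cst_lim : nu (orthant K a) @[m --> \oo] --> mu (orthant K a).
  by apply: cvg_trans lim; apply: near_eq_cvg; apply: nearW => m; rewrite -nuE.
exact: (cvg_unique _ (cvg_cst _) cst_lim).
Qed.

(** Both components of a convex combination are dominated by [mu]. *)
Lemma restricted_ergodic : ergodic g mu.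
Proof.
split; first exact: (restricted_central d_gt0 p_gt0 p_incr Bp).
move=> [nu1 [nu2 [t [c1 c2 ne /andP[t0 t1] mix]]]]; apply: ne.
have dom A : measurable A -> mu A = 0%E -> nu1 A = 0%E /\ nu2 A = 0%E.
  move=> mA; rewrite mix// => /eqP; rewrite padde_eq0; last 2 first.
  - by rewrite mule_ge0// lee_fin ltW.
  - by rewrite mule_ge0// lee_fin subr_ge0 ltW.
  rewrite !mule_eq0 !eqe subr_eq0 (gt_eqF t0) (gt_eqF t1)/=.
  by move=> /andP[/eqP -> /eqP ->].
move=> A mA; rewrite (central_dominated_eq c1)//; last by move=> D mD /(dom _ mD)[].
by rewrite (central_dominated_eq c2)//; move=> D mD /(dom _ mD)[].
Qed.

(** The vertices [m * p] have the right frequencies, and the measures on the paths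
    to them converge. *)
Lemma restricted_frequencies : has_frequencies g p mu.
Proof.
have freq i : m%:R * p i / m%:R @[m --> \oo] --> p i.
  apply: cvg_near_cst; exists 1%N => // m /= m0.
  by rewrite mulrAC mulfV ?mul1r// pnatr_eq0 -lt0n.
exists id, (fun m i => m%:R * p i); split => //.
  move=> m; split => [i|i j]; first by rewrite mulr_ge0// ltW.
  rewrite leq_eqVlt => /predU1P[/val_inj ->//|ij].
  by rewrite ler_wpM2l// ltW// p_incr.
exact: (restricted_path_measures_cvg d_gt0 p_gt0 p_incr Bp muE).
Qed.

(** A measure with frequencies [p] is the weak limit of measures that converge to
    [mu]. *)
Lemma restricted_unique (nu : probability VS R) :
  has_frequencies g p nu -> same_measure nu mu.
Proof.
move=> [N [v [N_incr _ nu_cvg v_freq]]]; apply: measure_unique_continuous => k f fc fM.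
have mu_cvg := restricted_path_measures_cvg d_gt0 p_gt0 p_incr Bp muE N_incr v_freq fc fM.
exact: (cvg_unique _ (nu_cvg k f fc fM) mu_cvg).
Qed.

End ergodicity.

Theorem mainTheorem4 (R : realType) (d : nat) (p : 'I_d -> R)
    (g : branching_graph)
    (hd : (1 <= d)%N) (p_gt0 : forall i, 0 < p i)
    (p_incr : forall i j : 'I_d, (i < j)%N -> p i < p j) :
  (exists B : probability (vector_seq R d) R, cesaro_product p B) /\
  forall B : probability (vector_seq R d) R, cesaro_product p B ->
    (0 < B (path_space g))%E /\
    exists mu : probability (vector_seq R d) R,
      [/\ ergodic g mu /\ has_frequencies g p mu,
          forall nu : probability (vector_seq R d) R,
            ergodic g nu -> has_frequencies g p nu -> same_measure nu mu
        & forall A : set (vector_seq R d), measurable A ->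
            mu A = (B (A `&` path_space g) / B (path_space g))%E].
Proof.
split.
  have [B HB] := cesaro_exists hd p_gt0; exists B.
  exact: exponential_increments_cesaro_product.
move=> B /cesaro_product_increments Bp.
have G0 := path_space_gt0 g hd p_gt0 p_incr Bp; split => //.
have [mu muE] := conditional_exists (@measurable_path_space R d g) G0.
exists mu; split => //.
- split; first exact: (restricted_ergodic hd p_gt0 p_incr Bp).
  exact: (restricted_frequencies hd p_gt0 p_incr Bp).
- by move=> nu _; exact: (restricted_unique hd p_gt0 p_incr Bp).
Qed.
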